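(* Consider the aperiodic Harris recurrent chain and its blocks $B_1,B_2,\dots$ from the context ($m\ge1$). Let $\mathcal F$ be a countable class of $\pi$-integrable functions on $E$ with finite envelope $F$ such that $\pi f=0$ for all $f\in\mathcal F$. Suppose $\mathcal F$ is VC type with characteristics $(\mathsf A,\mathsf V)$ with $\mathsf A\ge4$ and $\mathsf V\ge1$. Let $\overline\sigma$ be any positive constant with $\sup_{f\in\mathcal F}\|\check f\|_{\check Q,2}\le\overline\sigma\le\|\check F\|_{\check Q,2}$. Then, up to a universal multiplicative constant, $$\mathbb E\Big[\sup_{f\in\mathcal F}\Big|\frac1{\sqrt n}\sum_{i=1}^n\check f(B_i)\Big|\Big]\lesssim\overline\sigma\sqrt{\mathsf V\log\big(\sqrt{\mathsf A}\|\check F\|_{\check Q,2}/\overline\sigma\big)}+\frac{\|\max_{1\le i\le n}\check F(B_i)\|_{\mathbb P,2}}{\sqrt n}\,\mathsf V\log\big(\sqrt{\mathsf A}\|\check F\|_{\check Q,2}/\overline\sigma\big).$$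
   Context: Chain. $(E,\mathcal E)$ is a countably generated measurable space; $\{X_t\}_{t\in\mathbb N_0}$ is an aperiodic Harris recurrent Markov chain on $E$ with transition probability $P$, initial distribution $\lambda$ and unique invariant probability measure $\pi$; $\pi f=\int f\,d\pi$. Fix an integer $m\ge1$, $S\in\mathcal E$, a probability measure $\nu$ supported on $S$ and $\theta>0$ with $P^m(x,A)\ge\theta\nu(A)$ for all $x\in S$, $A\in\mathcal E$. Split chain. The chain is embedded in a process with additional variables $Y_t\in\{0,1\}$ defined by $$\mathbb P(Y_t=1,X_{tm+1}\in dx_1,\dots,X_{(t+1)m-1}\in dx_{m-1},X_{(t+1)m}\in dy\mid Y_0^{t-1},X_0^{tm-1};X_{tm}=x)=\theta\frac{\mathbf 1_S(x)\nu(dy)}{P^m(x,dy)}P(x,dx_1)\cdots P(x_{m-1},dy)$$ (law of $\{X_t\}$ unchanged). $\mathbb P,\mathbb E$: split chain with $X_0\sim\lambda$. $\sigma_{\check\alpha}(0)=\min\{t\ge0:Y_t=1\}$, $\sigma_{\check\alpha}(i)=\min\{t>\sigma_{\check\alpha}(i-1):Y_t=1\}$. Blocks. $B_i=(X_{m(\sigma_{\check\alpha}(i-1)+1)},\dots,X_{m(\sigma_{\check\alpha}(i)+1)-1})$, $i\ge1$, a stationary sequence in $\check E=\bigcup_{k\ge1}E^k$ (independent if $m=1$, one-dependent if $m>1$) with common law $\check Q$. For $B=(x_1,\dots,x_k)$: $\check f(B)=\sum_{t=1}^kf(x_t)$. $\|\check f\|_{\check Q,2}$ is the $L^2$ norm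 of $\check f(B_1)$. VC type. $\mathcal F$ with finite envelope $F$ is VC type with characteristics $(\mathsf A,\mathsf V)$ if $\sup_RN(\mathcal F,\|\cdot\|_{R,2},\varepsilon\|F\|_{R,2})\le(\mathsf A/\varepsilon)^{\mathsf V}$ for $0<\varepsilon\le1$, supremum over finitely discrete probability measures $R$; $N$ is the covering number. *)

(* Defs.v *)
From HB Require Import structures.
From mathcomp Require Import all_boot all_order all_algebra.
From mathcomp Require Import all_classical all_reals all_analysis.

Set Implicit Arguments.
Unset Strict Implicit.
Unset Printing Implicit Defensive.
Import Order.TTheory GRing.Theory Num.Theory.
Import numFieldNormedType.Exports.

Local Open Scope classical_set_scope.
Local Open Scope ring_scope.
Local Open Scope ereal_scope.

Definition countably_generated d (E : measurableType d) : Prop :=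
  exists G : set (set E), countable G /\ @measurable d E = <<s G >>.

(* Taking << s >> of [past X n] gives the sigma-algebra of (X_0, ..., X_{n-1}). *)
Definition past d d' (Om : measurableType d) (T : measurableType d')
    (X : nat -> {mfun Om >-> T}) (n : nat) : set (set Om) :=
  \bigcup_(i in `I_n) g_sigma_algebra_preimage (X i).

Section chain.
Context d (E : measurableType d) (R : realType).
Implicit Types (P : R.-pker E ~> E) (A S : set E) (phi psi : {measure set E -> \bar R}).

(* Conditional probabilities are expressed by integration over all events of
   the conditioning sigma-algebra. *)
Definition markov_chain P (init : probability E R)
    d' (Om : measurableType d') (Pr : probability Om R)
    (X : nat -> {mfun Om >-> E}) : Prop :=
  (forall A, measurable A -> Pr (X 0%N @^-1` A) = init A) /\
  (forall t H A, <<s past X t.+1 >> H -> measurable A ->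
     Pr (H `&` X t.+1 @^-1` A) = \int[Pr]_(w in H) P (X t w) A).

Fixpoint kernel_pow P (n : nat) : R.-spker E ~> E :=
  if n is n'.+1 then mkcomp_noparam P (kernel_pow P n')
  else kdirac (@measurable_id _ E setT).

(* P_x(X_t \in A infinitely often) = 1; the law P_x of the path started at x is
   determined by P and x, so any realization of the chain can serve. *)
Definition visits_io P (x : E) A : Prop :=
  exists d' (Om : measurableType d') (Pr : probability Om R)
         (X : nat -> {mfun Om >-> E}),
    markov_chain P (\d_x : probability E R) Pr X /\
    Pr (lim_sup_set (fun t => X t @^-1` A)) = 1.

Definition harris_recurrent P : Prop :=
  exists phi, [/\ sigma_finite setT phi, 0 < phi setT &
    forall A, measurable A -> 0 < phi A -> forall x, visits_io P x A].

Definition irreducibility_measure P phi : Prop :=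
  [/\ sigma_finite setT phi, 0 < phi setT &
    forall A, measurable A -> 0 < phi A ->
      forall x, exists2 n, (0 < n)%N & 0 < kernel_pow P n x A].

Definition maximal_irreducibility_measure P psi : Prop :=
  irreducibility_measure P psi /\
  forall phi, irreducibility_measure P phi -> phi `<< psi.

Definition cyclic_decomposition P psi (k : nat) (D : 'I_k -> set E) : Prop :=
  [/\ forall i, measurable (D i), trivIset setT D,
      forall i x, D i x -> P x (D (ordS i)) = 1 &
      psi (~` \bigcup_i D i) = 0].

Definition aperiodic P : Prop :=
  exists2 psi, maximal_irreducibility_measure P psi &
    forall k (D : 'I_k -> set E), cyclic_decomposition P psi D -> k = 1%N.

Definition invariant_probability P (mu : probability E R) : Prop :=
  forall A, measurable A -> \int[mu]_x P x A = mu A.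

Definition unique_invariant_probability P (pi : probability E R) : Prop :=
  invariant_probability P pi /\
  forall mu : probability E R, invariant_probability P mu ->
    forall A, measurable A -> mu A = pi A.

Definition minorization P (m : nat) S (nu : probability E R) (theta : R) : Prop :=
  [/\ measurable S, nu S = 1, (0 < theta)%R &
    forall x A, S x -> measurable A -> theta%:E * nu A <= kernel_pow P m x A].

(* r (x, y) is a jointly measurable version of nu(dy) / P^m(x, dy), x \in S. *)
Definition minorization_density P (m : nat) S (nu : probability E R)
    (r : E * E -> R) : Prop :=
  [/\ measurable_fun setT r, forall z, (0 <= r z)%R &
    forall x A, S x -> measurable A ->
      nu A = \int[kernel_pow P m x]_(y in A) (r (x, y))%:E].

(* \int_{C 0} ... \int_{C (n-1)} h(x_n) P(x_{n-1}, dx_n) ... P(x, dx_1) *)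
Fixpoint path_integral P (n : nat) (C : nat -> set E) (h : E -> \bar R) (x : E)
    : \bar R :=
  if n is n'.+1 then
    \int[P x]_(y in C 0%N) path_integral P n' (fun j => C j.+1) h y
  else h x.

Section split.
Context d' (Om : measurableType d') (Pr : probability Om R).
Variables (X : nat -> {mfun Om >-> E}) (Y : nat -> {mfun Om >-> bool}).

Definition next_segment (m t : nat) (C : nat -> set E) : set Om :=
  [set w | forall j, (j < m)%N -> C j (X (t * m + j.+1)%N w)].

(* The second clause is the requirement that adjoining Y leaves the transitions
   of X unchanged: given Y_0^{t-1} and X_0^{tm}, the next m steps of X still
   follow P. Together with the third clause it determines the joint law. *)
Definition split_chain P (init : probability E R) (m : nat) S (theta : R)
    (r : E * E -> R) : Prop :=
  [/\ markov_chain P init Pr X,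
      forall t H (C : nat -> set E), <<s past X (t * m).+1 `|` past Y t >> H ->
        (forall j, measurable (C j)) ->
        Pr (H `&` next_segment m t C) =
        \int[Pr]_(w in H) path_integral P m C (cst 1) (X (t * m)%N w) &
      forall t H (C : nat -> set E), <<s past X (t * m).+1 `|` past Y t >> H ->
        (forall j, measurable (C j)) ->
        Pr (H `&` (Y t @^-1` [set true] `&` next_segment m t C)) =
        \int[Pr]_(w in H)
          ((theta * \1_S (X (t * m)%N w))%:E *
           path_integral P m C (fun y => (r (X (t * m)%N w, y))%:E)
             (X (t * m)%N w))].

(* The default value 0 is used only when the set of times is empty, an event of
   probability zero for the split chain of a Harris chain with pi S > 0. *)
Definition first_regeneration_from (y : nat -> bool) (s : nat) : nat :=
  match pselect (exists t, (s <= t)%N && y t) with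
  | left h => ex_minn h
  | right _ => 0%N
  end.

Fixpoint regeneration (i : nat) (w : Om) : nat :=
  if i is i'.+1 then
    first_regeneration_from (fun t => Y t w) (regeneration i' w).+1
  else first_regeneration_from (fun t => Y t w) 0.

(* Meaningful for i >= 1. *)
Definition block (m i : nat) (w : Om) : seq E :=
  [seq X k w | k <- index_iota (m * (regeneration i.-1 w).+1)
                               (m * (regeneration i w).+1)].

End split.

Definition block_sum (f : E -> R) (B : seq E) : R := (\sum_(x <- B) f x)%R.

Definition finite_envelope (F : set (E -> R)) (Fenv : E -> R) : Prop :=
  [/\ measurable_fun setT Fenv, forall x, (0 <= Fenv x)%R &
    forall f, F f -> forall x, (`|f x| <= Fenv x)%R].

(* Closed balls, whose centers need not belong to F. *)
Definition covering_number (Q : probability E R) (F : set (E -> R))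
    (e : \bar R) : \bar R :=
  ereal_inf [set k%:R%:E | k in [set k : nat |
    exists c : 'I_k -> {mfun E >-> R},
      forall f, F f -> exists i, 'N[Q]_2[(fun x => (f x - c i x)%:E)] <= e]].

Definition finitely_discrete (Q : probability E R) : Prop :=
  exists k (x : 'I_k -> E) (p : 'I_k -> R), (forall i, (0 <= p i)%R) /\
    forall A, measurable A -> Q A = \sum_(i < k) (p i)%:E * \d_(x i) A.

Definition VC_type (F : set (E -> R)) (Fenv : E -> R) (a v : R) : Prop :=
  forall e : R, (0 < e <= 1)%R ->
    ereal_sup [set covering_number Q F (e%:E * 'N[Q]_2[EFin \o Fenv])
              | Q in finitely_discrete]
    <= ((a / e) `^ v)%:E.

End chain.

(* Main.v *)
Require Import Defs.
From HB Require Import structures.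
From mathcomp Require Import all_boot all_order all_algebra.
From mathcomp Require Import all_classical all_reals all_analysis.
From mathcomp Require Import measurable_realfun.
From mathcomp Require Import ring lra.

Set Implicit Arguments.
Unset Strict Implicit.
Unset Printing Implicit Defensive.
Import Order.TTheory GRing.Theory Num.Theory.
Import numFieldNormedType.Exports.

Local Open Scope classical_set_scope.
Local Open Scope ring_scope.

(** * Rademacher averages *)

(** Regeneration reduces the claim to independent variables, to which a maximal inequality for
    classes of VC type applies.

    Regeneration. When $Y_t=1$, the state $X_{(t+1)m}$ has law $\nu$ whatever happened before, so
    all blocks have the same law and each is independent of what is decided before the regeneration
    that opens it ([renewal]). The preceding block runs past that time when $m>1$, so neighbouring
    blocks may be dependent; blocks whose indices differ by two or more are not, and the
    odd-numbered and the even-numbered blocks form two independent families ([blocks_independent]).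
    Regenerations recur because invariance of $\pi$ bounds the expected wait, in skeleton steps, by
    $1/(\theta\pi(S))$ ([occupation_bound], [regeneration_recurs]). The expected occupation of a
    block is an invariant measure, hence a multiple of $\pi$ ([integral_block_sum]), so block sums
    of $\pi$-centered functions are centered ([block_sum_centered]). The argument is run
    conditionally on infinitely many regenerations; a path without any regeneration has only empty
    blocks.

    Entropy. A weighted Cauchy-Schwarz inequality bounds the empirical $L^2$ distance of two block
    sums by an $L^2(Q)$ distance of the functions, with $Q$ finitely discrete on $E$. Hence block
    sums inherit the covering bounds of the class, with the block sum of the envelope as new
    envelope ([block_cover]).

    Maximal inequality for independent copies ([independent_maximal_inequality]). Symmetrization and
    chaining conditionally on the data ([rad_mean_chaining]) bound the expected supremum by the mean
    of $\sqrt{\mathsf V\,V\log(\mathsf A^2Y/V)}$ up to a constant, where $V$ is the largest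
    empirical sum of squares and $Y$ that of the envelope. The expression under the root is concave
    in $(V,Y)$ and is replaced by its tangent at a deterministic point. The same chaining applied to
    squared functions bounds the mean of $V$ by $3n\overline\sigma^2$ plus a term that involves $V$
    again; solving this inequality ([self_bounding]) gives both terms of the theorem.

    Everything is done for finite subfamilies ([finite_class_bound]); monotone convergence reaches
    the countable class ([integral_countable_sup_le]). *)

Section rademacher.
Context {R : realType}.
Implicit Types (n : nat).

(** With [4 <= a] this makes the logarithms below at least $2\ln2\ge1$, so that additive constants
    can be absorbed into them. *)
Lemma half_le_ln2 : 2^-1 <= ln (2 : R).
Proof.
have h : (0 : R) < 2^-1 by rewrite invr_gt0.
have := @le_ln1Dx R (- 2^-1).
have -> : 1 + - 2^-1 = 2^-1 :> R by lra.
rewrite lnV ?posrE// => H; have : - ln 2 <= - 2^-1 :> R by apply: H; lra.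
by rewrite lerN2.
Qed.

(** The constant 2 in the exponent is generous, which keeps the proof elementary: if
    [2 * x ^+ 2 > 1], each exponential is below the bound by itself; otherwise
    [expR y <= (1 - y)^-1] gives the mean $(1-x^2)^{-1}\le1+2x^2$. *)
Lemma cosh_le_expR2 (x : R) : (expR x + expR (- x)) / 2 <= expR (2 * x ^+ 2).
Proof.
wlog x0 : x / 0 <= x.
  move=> H; have [/H//|/ltW xn] := leP 0 x.
  by have := H (- x); rewrite opprK sqrrN addrC; apply; rewrite oppr_ge0.
have [x2|x2] := leP (2 * x ^+ 2) 1; last first.
  have xx : x <= 2 * x ^+ 2 by nra.
  have e1 : expR x <= expR (2 * x ^+ 2) by rewrite ler_expR.
  have e2 : expR (- x) <= expR (2 * x ^+ 2) by rewrite ler_expR; lra.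
  by lra.
have x1 : x < 1 by nra.
have ub (y : R) : -1 < y < 1 -> expR y <= (1 - y)^-1.
  move=> /andP[y1 y2]; rewrite -[y]opprK expRN lef_pV2 ?posrE ?expR_gt0; last lra.
    by rewrite opprK; exact: expR_ge1Dx.
  by lra.
have u1 := ub x; have u2 := ub (- x).
apply: (@le_trans _ _ (((1 - x)^-1 + (1 + x)^-1) / 2)).
  rewrite ler_pM2r ?invr_gt0// lerD//; first by apply: u1; lra.
  by rewrite -[X in (1 + X)^-1]opprK; apply: u2; lra.
have -> : ((1 - x)^-1 + (1 + x)^-1) / 2 = (1 - x ^+ 2)^-1.
  field; apply/and3P; split; apply/eqP; nra.
have p1 : 0 < 1 - x ^+ 2 by nra.
rewrite -[2 * _]opprK expRN lef_pV2 ?posrE ?expR_gt0//.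
rewrite expRN -[leRHS]invrK lef_pV2 ?posrE ?expR_gt0 ?invr_gt0//.
apply: (@le_trans _ _ (1 + 2 * x ^+ 2)); last exact: expR_ge1Dx.
rewrite -[leLHS]mul1r ler_pdivrMr//; nra.
Qed.

Definition rad_sum n (x : 'I_n -> R) (e : {ffun 'I_n -> bool}) : R :=
  \sum_i (-1) ^+ e i * x i.

(** The random signs are the coordinates of [e], uniform on a finite set. Their expectation is a
    finite average, so no product probability space has to be built over the data. *)
Definition rad_mean n (g : {ffun 'I_n -> bool} -> R) : R :=
  (2 ^+ n)^-1 * \sum_e g e.

Definition sqnorm n (x : 'I_n -> R) : R := \sum_i x i ^+ 2.

Lemma sqnorm_ge0 n (x : 'I_n -> R) : 0 <= sqnorm x.
Proof. by apply: sumr_ge0 => i _; rewrite sqr_ge0. Qed.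

Lemma sqnormD n (x y z : 'I_n -> R) : (forall i, z i = x i + y i) ->
  sqnorm z <= 2 * sqnorm x + 2 * sqnorm y.
Proof.
move=> zE; rewrite /sqnorm !mulr_sumr -big_split/=.
apply: ler_sum => i _; rewrite zE; have := sqr_ge0 (x i - y i); nra.
Qed.

Lemma rad_sumD n (x y z : 'I_n -> R) e : (forall i, z i = x i + y i) ->
  rad_sum z e = rad_sum x e + rad_sum y e.
Proof.
by move=> zE; rewrite -big_split/=; apply: eq_bigr => i _; rewrite zE mulrDr.
Qed.

Lemma norm_rad_sum n (x : 'I_n -> R) e : `|rad_sum x e| <= \sum_i `|x i|.
Proof.
apply: le_trans (ler_norm_sum _ _ _) _.
by apply: ler_sum => i _; rewrite normrMsign.
Qed.

Lemma le_rad_mean n (g h : {ffun 'I_n -> bool} -> R) :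
  (forall e, g e <= h e) -> rad_mean g <= rad_mean h.
Proof.
move=> gh; rewrite ler_wpM2l ?invr_ge0 ?exprn_ge0//.
by apply: ler_sum => e _.
Qed.

Lemma rad_meanD n (g h : {ffun 'I_n -> bool} -> R) :
  rad_mean (fun e => g e + h e) = rad_mean g + rad_mean h.
Proof. by rewrite /rad_mean big_split mulrDr. Qed.

Lemma rad_meanZ n c (g : {ffun 'I_n -> bool} -> R) :
  rad_mean (fun e => c * g e) = c * rad_mean g.
Proof. by rewrite /rad_mean -mulr_sumr mulrCA. Qed.

Lemma rad_mean_cst n (c : R) : rad_mean (fun _ : {ffun 'I_n -> bool} => c) = c.
Proof.
rewrite /rad_mean sumr_const card_ffun card_bool card_ord -[c *+ _]mulr_natl.
by rewrite natrX mulrA mulVf ?mul1r// expf_neq0.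
Qed.

Lemma rad_mean_sum n (I : Type) (r : seq I) (P : pred I)
    (g : I -> {ffun 'I_n -> bool} -> R) :
  rad_mean (fun e => \sum_(i <- r | P i) g i e) =
  \sum_(i <- r | P i) rad_mean (g i).
Proof. by rewrite /rad_mean exchange_big/= mulr_sumr. Qed.

(** The average of the product of exponentials factors over the coordinates into hyperbolic cosines.
    This is the sub-Gaussian estimate behind the bound on maxima. *)
Lemma rad_mean_expR n (x : 'I_n -> R) (l : R) :
  rad_mean (fun e => expR (l * rad_sum x e)) <= expR (2 * l ^+ 2 * sqnorm x).
Proof.
have -> : rad_mean (fun e => expR (l * rad_sum x e)) =
    \prod_i ((expR (l * x i) + expR (- (l * x i))) / 2).
  rewrite big_split/= prodr_const card_ord exprVn mulrC; congr (_ * _).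
  transitivity (\prod_(i < n) \sum_(b : bool) expR (l * ((-1) ^+ b * x i))).
    rewrite bigA_distr_bigA/=; apply: eq_bigr => e _.
    by rewrite /rad_sum mulr_sumr expR_sum.
  apply: eq_bigr => i _; rewrite big_bool/= expr1 expr0 mul1r mulN1r mulrN.
  by rewrite addrC.
rewrite /sqnorm mulr_sumr expR_sum; apply: ler_prod => i _; apply/andP; split.
  by rewrite divr_ge0// addr_ge0 ?expR_ge0//.
by apply: le_trans (cosh_le_expR2 _) _; rewrite ler_expR exprMn mulrA.
Qed.

(* Exponential moments of both signs, then [u <= c + exp (u - c) - 1]. *)
Lemma rad_mean_bigmax n (I : finType) (d : I -> 'I_n -> R) (b L : R) :
  0 < b -> 0 < L -> (forall k, sqnorm (d k) <= b ^+ 2) ->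
  2 * #|I|%:R <= expR L ->
  rad_mean (fun e => \big[Num.max/0]_k `|rad_sum (d k) e|) <=
    3 * b * Num.sqrt L.
Proof.
move=> b0 L0 db cI.
have sL : 0 < Num.sqrt L by rewrite sqrtr_gt0.
(* With this multiplier every exponential moment is at most [expR (2 * L)]. There are two signs and
   [#|I|] indices, so the moments add up to at most [expR (3 * L)], whence the threshold [c]
   below. *)
pose l := Num.sqrt L / b.
have l0 : 0 < l by rewrite divr_gt0.
have lb : l ^+ 2 * b ^+ 2 = L.
  by rewrite /l expr_div_n mulfVK ?sqr_sqrtr ?ltW// expf_neq0// gt_eqF.
pose c := 3 * L.
suff H : l * rad_mean (fun e => \big[Num.max/0]_k `|rad_sum (d k) e|) <= c.
  rewrite -(ler_pM2l l0); apply: le_trans H _.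
  rewrite /l /c -{1}(sqr_sqrtr (ltW L0)) le_eqVlt; apply/orP; left; apply/eqP.
  by field; rewrite gt_eqF.
have [I0|] := eqVneq #|I| 0%N.
  have -> : (fun e => \big[Num.max/0]_k `|rad_sum (d k) e|) = fun=> 0.
    by apply/funext => e; apply: big_pred0 => i; have := fintype0 i I0.
  by rewrite rad_mean_cst mulr0 mulr_ge0 ?ltW.
rewrite -lt0n => /card_gt0P[k0 _].
pose S e := \sum_k (expR (l * rad_sum (d k) e) + expR (- l * rad_sum (d k) e)).
have S0 e : 0 <= S e by apply: sumr_ge0 => k _; rewrite addr_ge0 ?expR_ge0//.
have pw e k : l * `|rad_sum (d k) e| <= c - 1 + expR (- c) * S e.
  have : expR (l * `|rad_sum (d k) e|) <= S e.
    rewrite /S (bigD1 k)//= -[leLHS]addr0 lerD//; last first.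
      by apply: sumr_ge0 => j _; rewrite addr_ge0 ?expR_ge0//.
    have [r0|r0] := leP 0 (rad_sum (d k) e).
      by rewrite (ger0_norm r0) lerDl expR_ge0.
    by rewrite (ltr0_norm r0) mulrN -mulNr lerDr expR_ge0.
  move=> h; have := @expR_ge1Dx R (l * `|rad_sum (d k) e| - c).
  rewrite expRD [expR _ * _]mulrC => h1; have := ler_wpM2l (expR_ge0 (- c)) h; lra.
have pw1 e : l * \big[Num.max/0]_k `|rad_sum (d k) e| <=
    c - 1 + expR (- c) * S e.
  rewrite mulrC -ler_pdivlMr//; apply: bigmax_le.
    by rewrite divr_ge0 ?(ltW l0)//; apply: le_trans (pw e k0); rewrite mulr_ge0// ltW.
  by move=> k _; rewrite ler_pdivlMr// mulrC.
rewrite -rad_meanZ; apply: le_trans (le_rad_mean pw1) _.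
rewrite rad_meanD rad_mean_cst rad_meanZ.
suff : rad_mean S <= expR c.
  move=> h; have : expR (- c) * rad_mean S <= 1.
    by rewrite expRN ler_pdivrMl ?expR_gt0// mulr1.
  lra.
rewrite /S rad_mean_sum.
apply: (@le_trans _ _ (\sum_(k : I) (2 * expR (2 * L)))).
  apply: ler_sum => k _; rewrite rad_meanD.
  have h m : m ^+ 2 = l ^+ 2 ->
      rad_mean (fun e => expR (m * rad_sum (d k) e)) <= expR (2 * L).
    move=> ml; apply: le_trans (rad_mean_expR _ _) _.
    by rewrite ler_expR ml -mulrA ler_wpM2l// -lb ler_wpM2l// sqr_ge0.
  by rewrite mulr_natl mulr2n lerD ?h// sqrrN.
rewrite sumr_const -[_ *+ #|_|]mulr_natl mulrA [_ * 2]mulrC /c.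
have -> : 3 * L = L + 2 * L by ring.
by rewrite expRD ler_wpM2r ?expR_ge0.
Qed.

End rademacher.

(** * Chaining for finite families of vectors *)

Section chaining.
Context {R : realType}.

(** Total cost of the links of a chain: level [j] contributes its radius times a bound for the
    square root of its entropy factor [4 + j]. *)
Lemma sum_half_pow_le (J : nat) :
  \sum_(j < J) 2 ^- j * (4 + j%:R) / 2 <= 5 :> R.
Proof.
suff -> : \sum_(j < J) 2 ^- j * (4 + j%:R) / 2 = 5 - 2 ^- J * (5 + J%:R) :> R.
  by rewrite gerBl mulr_ge0// ?invr_ge0 ?exprn_ge0// addr_ge0.
elim: J => [|J IH]; first by rewrite big_ord0 expr0 invr1; ring.
rewrite big_ord_recr/= IH exprS invfM -[J.+1%:R]natr1.
set p := 2 ^- J; lra.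
Qed.

Variables (n K : nat) (T : Type) (C : set T) (f : 'I_K -> T).
Variables (x y : T -> 'I_n -> R) (a v l r N : R).
Hypotheses (r0 : 0 < r) (rN : r <= N) (a4 : 4 <= a) (v1 : 1 <= v) (l0 : 0 < l).
Hypothesis ylip : forall g h, C g -> C h ->
  sqnorm (fun i => y g i - y h i) <= l ^+ 2 * sqnorm (fun i => x g i - x h i).
Hypothesis Cf : forall k, C (f k).
Hypothesis fr : forall k, sqnorm (y (f k)) <= (l * r) ^+ 2.
Hypothesis cover : forall e : R, 0 < e <= 1 -> exists k (c : 'I_k -> T),
  [/\ k%:R <= 2 * (a / e) `^ v, forall i, C (c i) &
    forall g, C g -> exists i,
      sqnorm (fun j => x g j - x (c i) j) <= (2 * e * N) ^+ 2].

Let entropy := v * ln (a * N / r).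

(** From [4 <= a] and [r <= N] the logarithm is at least $2\ln2$. The bound lets chaining absorb
    constants into the entropy. *)
Lemma entropy_ge1 : 1 <= entropy.
Proof.
have N0 : 0 < N by apply: lt_le_trans rN.
have aNr : 4 <= a * N / r.
  rewrite ler_pdivlMr//; apply: ler_pM => //; exact: ltW.
have : 2 * ln 2 <= ln (a * N / r).
  rewrite mulr_natl -lnXn// ler_ln ?posrE ?exprn_gt0//; last exact: lt_le_trans aNr.
  by rewrite expr2 -natrM.
have := @half_le_ln2 R; rewrite /entropy; set X := ln (a * N / r).
move=> h1 h2; have : 1 * 1 <= v * X by apply: ler_pM => //; lra.
lra.
Qed.

(** Chosen so that the covering radius [2 * scale j * N] is [2 * r * 2 ^- j]. *)
Let scale (j : nat) : R := r / N * 2 ^- j.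

Let N0 : 0 < N. Proof. exact: lt_le_trans rN. Qed.

Let scale_bound j : 0 < scale j <= 1.
Proof.
rewrite /scale; apply/andP; split; first by rewrite mulr_gt0// ?divr_gt0 ?invr_gt0 ?exprn_gt0//.
rewrite -[leRHS]mulr1 ler_pM ?divr_ge0// ?(ltW r0) ?(ltW N0)//.
  by rewrite ler_pdivrMr// mul1r.
by rewrite invf_le1 ?exprn_gt0// exprn_ege1// ler1n.
Qed.

Let size_bound j : 2 * (a / scale j) `^ v = 2 * expR (entropy + v * j%:R * ln 2).
Proof.
have a0 : 0 < a by apply: lt_le_trans a4.
have /andP[s0 _] := scale_bound j.
rewrite /powR gt_eqF ?divr_gt0//=; congr (_ * expR _).
rewrite /entropy -[v * _ * ln 2]mulrA -mulrDr; congr (_ * _).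
rewrite mulr_natl -lnXn// -lnM ?posrE ?mulr_gt0 ?invr_gt0 ?exprn_gt0//.
congr ln; rewrite /scale; field.
by rewrite !gt_eqF ?exprn_gt0.
Qed.

(** Each vector is the sum of a center of level 0, links between centers of consecutive levels, and
    a remainder; [rad_mean_bigmax] bounds each level. There are two coordinate maps because
    coverings are known for [x] while the average concerns [y], which is [l]-Lipschitz in [x]: later
    [y] is [x] itself, or the squares of its coordinates, for which this replaces a contraction
    principle. *)
Lemma rad_mean_chaining :
  rad_mean (fun e => \big[Num.max/0]_k `|rad_sum (y (f k)) e|) <=
  100 * l * r * Num.sqrt entropy.
Proof.
have e1 := entropy_ge1.
have e0 : 0 < entropy by apply: lt_le_trans e1.
have s1 : 1 <= Num.sqrt entropy by rewrite -[leLHS]sqrtr1 ler_wsqrtr.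
have lr : 0 < l * r by rewrite mulr_gt0.
pose w1 j := cid (cover (scale_bound j)).
pose k_ j := projT1 (w1 j).
pose w2 j := cid (projT2 (w1 j)).
pose c_ j : 'I_(k_ j) -> T := projT1 (w2 j).
have cP j : [/\ (k_ j)%:R <= 2 * (a / scale j) `^ v, forall i, C (c_ j i) &
    forall g, C g -> exists i, sqnorm (fun t => x g t - x (c_ j i) t) <=
      (2 * scale j * N) ^+ 2] := projT2 (w2 j).
move: k_ c_ cP => {w2} {w1} k_ c_ cP.
(* By [sqnormD], the level 0 center and each link used by a chain have squared norm at most
   $(2+8)(lr2^{-j})^2$, and $10\le4^2$. *)
pose b (j : nat) := 4 * l * r * 2 ^- j.
have b0 j : 0 < b j by rewrite /b !mulr_gt0 ?invr_gt0 ?exprn_gt0//.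
have scaleN j : 2 * scale j * N = 2 * r * 2 ^- j.
  by rewrite /scale; field; rewrite !gt_eqF ?exprn_gt0.
(* A vector that is too long is replaced by zero, so that [rad_mean_bigmax] applies to all pairs of
   centers at once. The links used by a chain are short and stay unchanged. *)
pose cap (z : 'I_n -> R) (t : R) i := if sqnorm z <= t ^+ 2 then z i else 0.
have cap_le z t : sqnorm (cap z t) <= t ^+ 2.
  rewrite /cap; case: (leP (sqnorm z) (t ^+ 2)) => // _.
  rewrite /sqnorm big1 => [|i _]; first by rewrite sqr_ge0.
  by rewrite expr0n.
pose d0 (i : 'I_(k_ 0%N)) := cap (y (c_ 0%N i)) (b 0%N).
pose d j (i : 'I_(k_ j.+1) * 'I_(k_ j)) :=
  cap (fun t => y (c_ j.+1 i.1) t - y (c_ j i.2) t) (b j).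
pose S0 e := \big[Num.max/0]_i `|rad_sum (d0 i) e|.
pose S j e := \big[Num.max/0]_i `|rad_sum (d j i) e|.
have mS0 : rad_mean S0 <= 24 * (l * r) * Num.sqrt entropy.
  apply: le_trans (@rad_mean_bigmax _ _ _ d0 (b 0%N) (4 * entropy) _ _ _ _) _.
  - exact: b0.
  - by rewrite mulr_gt0.
  - by move=> i; apply: cap_le.
  - have [+ _ _] := cP 0%N; rewrite card_ord size_bound mulr0 mul0r addr0 => h.
    apply: (@le_trans _ _ (4 * expR entropy)); first lra.
    have -> : 4 * entropy = entropy + 3 * entropy by ring.
    rewrite expRD mulrC ler_wpM2l ?expR_ge0//.
    by apply: le_trans (expR_ge1Dx _); lra.
  - rewrite /b expr0 invr1 sqrtrM// (_ : 4 = 2 ^+ 2 :> R); last by rewrite expr2; lra.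
    by rewrite sqrtr_sqr ger0_norm//; lra.
have mS j : rad_mean (S j) <=
    12 * (l * r) * Num.sqrt entropy * (2 ^- j * (4 + j%:R) / 2).
  have j4 : (0 : R) < 4 + j%:R by rewrite ltr_wpDr.
  (* The logarithm of twice the number of pairs is at most $3\ln2+2\,\mathrm{entropy}+\mathsf
     V(2j+1)\ln2$, and $2\mathsf V\ln2\le\mathrm{entropy}$; this is where the factor [4 + j] comes
     from. *)
  apply: le_trans (@rad_mean_bigmax _ _ _ (d j) (b j) (entropy * (4 + j%:R)) _ _ _ _) _.
  - exact: b0.
  - by rewrite mulr_gt0.
  - by move=> i; apply: cap_le.
  - have [+ _ _] := cP j; have [+ _ _] := cP j.+1.
    rewrite card_prod !card_ord natrM !size_bound => h1 h2.
    have := ler_pM (ler0n _ _) (ler0n _ _) h1 h2.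
    rewrite mulrACA -expRD => h3.
    apply: (@le_trans _ _ (expR (3 * ln 2 + (entropy + v * j.+1%:R * ln 2 + (entropy + v * j%:R * ln 2))))).
      rewrite [leRHS]expRD expRM_natl lnK ?posrE//.
      rewrite (_ : 2 ^+ 3 = 2 * (2 * 2) :> R); last by rewrite !exprS expr0; lra.
      by rewrite -mulrA ler_wpM2l.
    rewrite ler_expR -[j.+1%:R]natr1.
    have h4 : v * (2 * ln 2) <= entropy.
      rewrite ler_wpM2l ?(le_trans _ v1)//.
      rewrite mulr_natl -lnXn// ler_ln ?posrE ?exprn_gt0//.
        rewrite ler_pdivlMr// expr2 -natrM.
        apply: ler_pM => //; exact: ltW.
      by rewrite divr_gt0// mulr_gt0// (lt_le_trans _ a4).
    have := @half_le_ln2 R; have j0 := ler0n R j.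
    have : 0 < ln 2 :> R by rewrite ln_gt0// ltr1n.
    set q := ln 2 in h4 * => q0 _.
    have vq : q <= v * q by rewrite ler_peMl// ltW.
    have : 0 <= (entropy - v * (2 * q)) * j%:R by rewrite mulr_ge0// subr_ge0.
    have -> : v * (j%:R + 1) * q = v * q * j%:R + v * q by ring.
    have -> : v * j%:R * q = v * q * j%:R by ring.
    rewrite mulrBl -mulrA; lra.
  - rewrite /b sqrtrM ?(ltW e0)//.
    have h : Num.sqrt (4 + j%:R) <= (4 + j%:R) / 2 :> R.
      rewrite -[leRHS]ger0_norm; last by rewrite divr_ge0// ltW.
      by rewrite -sqrtr_sqr ler_wsqrtr//; have := ler0n R j; nra.
    have p0 : 0 < 2 ^- j :> R by rewrite ?invr_gt0 ?exprn_gt0.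
    have q0 : 0 <= 3 * (4 * l * r * 2 ^- j) * Num.sqrt entropy.
      by rewrite !mulr_ge0// ?ltW.
    by have := ler_wpM2l q0 h; rewrite -!mulrA; lra.
have pick k : exists p : forall j, 'I_(k_ j),
    forall j, sqnorm (fun t => x (f k) t - x (c_ j (p j)) t) <= (2 * r * 2 ^- j) ^+ 2.
  have H j : exists i : 'I_(k_ j),
      sqnorm (fun t => x (f k) t - x (c_ j i) t) <= (2 * r * 2 ^- j) ^+ 2.
    by have [_ _ /(_ _ (Cf k))] := cP j; rewrite scaleN.
  by exists (fun j => xchoose (H j)) => j; exact: xchooseP (H j).
have pick_y k (p : forall j, 'I_(k_ j)) j :
    sqnorm (fun t => x (f k) t - x (c_ j (p j)) t) <= (2 * r * 2 ^- j) ^+ 2 ->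
    sqnorm (fun t => y (f k) t - y (c_ j (p j)) t) <= (l * (2 * r * 2 ^- j)) ^+ 2.
  move=> h; have [_ Cc _] := cP j.
  apply: le_trans (ylip (Cf k) (Cc _)) _.
  by rewrite exprMn ler_wpM2l// sqr_ge0.
(* At depth [n] the remainder has [n] coordinates of size at most [2 * l * r * 2 ^- n]. Since
   $n<2^n$ it is harmless, and chains may stop there. *)
pose J := n.
have pw e k : `|rad_sum (y (f k)) e| <= 2 * l * r + S0 e + \sum_(j < J) S j e.
  have [p pP] := pick k.
  have last_step : `|rad_sum (fun t => y (f k) t - y (c_ J (p J)) t) e| <= 2 * l * r.
    apply: le_trans (norm_rad_sum _ _) _.
    have h t : `|y (f k) t - y (c_ J (p J)) t| <= 2 * l * r * 2 ^- J.
      have p0 : 0 < 2 ^- J :> R by rewrite ?invr_gt0 ?exprn_gt0.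
      rewrite -[leRHS]ger0_norm; last by rewrite !mulr_ge0// ?ltW.
      rewrite -ler_sqr ?nnegrE// !real_normK ?num_real//.
      apply: le_trans (_ : _ <= (l * (2 * r * 2 ^- J)) ^+ 2) _; last first.
        by rewrite le_eqVlt; apply/orP; left; apply/eqP; congr (_ ^+ 2); ring.
      apply: le_trans (pick_y k p J (pP J)).
      rewrite /sqnorm (bigD1 t)//= lerDl.
      by apply: sumr_ge0 => i _; rewrite sqr_ge0.
    apply: le_trans (ler_sum _ (fun t _ => h t)) _.
    rewrite sumr_const card_ord -[_ *+ _]mulr_natl mulrCA -[leRHS]mulr1 ler_wpM2l//.
      by rewrite !mulr_ge0// ltW.
    by rewrite ler_pdivrMr ?exprn_gt0// mul1r -natrX ler_nat ltnW// ltn_expl.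
  have head j : `|rad_sum (y (c_ j (p j))) e| <= S0 e + \sum_(i < j) S i e.
    elim: j => [|j IH].
      rewrite big_ord0 addr0.
      suff h : sqnorm (y (c_ 0%N (p 0%N))) <= (b 0%N) ^+ 2.
        have -> : y (c_ 0%N (p 0%N)) = d0 (p 0%N) by rewrite /d0 /cap h.
        exact: (le_bigmax _ (fun i => `|rad_sum (d0 i) e|)).
      apply: le_trans (sqnormD (_ : forall i, _ = y (f k) i + - (y (f k) i - y (c_ 0%N (p 0%N)) i))) _.
        by move=> i; ring.
      have h := pick_y k p 0%N (pP 0%N).
      have -> : sqnorm (fun i => - (y (f k) i - y (c_ 0%N (p 0%N)) i)) =
          sqnorm (fun i => y (f k) i - y (c_ 0%N (p 0%N)) i).
        by apply: eq_bigr => i _; rewrite sqrrN.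
      move: h (fr k); rewrite /b expr0 invr1 !exprMn.
      have : 0 <= l ^+ 2 * r ^+ 2 by rewrite mulr_ge0 ?sqr_ge0.
      by rewrite !expr1n !mulr1; nra.
    rewrite big_ord_recr/= addrA.
    rewrite (rad_sumD (x := y (c_ j (p j))) (y := fun t => y (c_ j.+1 (p j.+1)) t - y (c_ j (p j)) t)); last by move=> i; ring.
    apply: le_trans (ler_normD _ _) _; apply: lerD => //.
    suff h : sqnorm (fun t => y (c_ j.+1 (p j.+1)) t - y (c_ j (p j)) t) <= (b j) ^+ 2.
      have -> : (fun t => y (c_ j.+1 (p j.+1)) t - y (c_ j (p j)) t) = d j (p j.+1, p j).
        by rewrite /d /cap/= h.
      exact: (le_bigmax _ (fun i => `|rad_sum (d j i) e|)).
    apply: le_trans (sqnormD (_ : forall i, _ = (y (f k) i - y (c_ j (p j)) i) + - (y (f k) i - y (c_ j.+1 (p j.+1)) i))) _.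
      by move=> i; ring.
    have h := pick_y k p j (pP j); have := pick_y k p j.+1 (pP j.+1).
    have -> : sqnorm (fun i => - (y (f k) i - y (c_ j.+1 (p j.+1)) i)) =
        sqnorm (fun i => y (f k) i - y (c_ j.+1 (p j.+1)) i).
      by apply: eq_bigr => i _; rewrite sqrrN.
    move: h; rewrite /b [2 ^+ j.+1]exprS invfM !exprMn; set Z := 2 ^- j.
    have : 0 <= l ^+ 2 * r ^+ 2 * Z ^+ 2.
      by apply: mulr_ge0; [apply: mulr_ge0|]; exact: sqr_ge0.
    nra.
  rewrite (rad_sumD (x := fun t => y (f k) t - y (c_ J (p J)) t) (y := y (c_ J (p J)))); last by move=> i; ring.
  apply: le_trans (ler_normD _ _) _.
  by rewrite -addrA lerD.
have S_ge0 j e : 0 <= S j e.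
  by apply: bigmax_ge_id.
have S0_ge0 e : 0 <= S0 e by apply: bigmax_ge_id.
have pw1 e : \big[Num.max/0]_k `|rad_sum (y (f k)) e| <=
    2 * l * r + S0 e + \sum_(j < J) S j e.
  apply: bigmax_le => [|k _]; last exact: pw.
  apply: addr_ge0; last by apply: sumr_ge0 => j _; exact: S_ge0.
  by apply: addr_ge0 => //; rewrite -mulrA mulr_ge0// ltW.
(* Remainder, level 0 and links cost $2+24+60=86\le100$ times $lr\sqrt{\mathrm{entropy}}$. *)
apply: le_trans (le_rad_mean pw1) _.
rewrite !rad_meanD rad_mean_cst rad_mean_sum.
have hs : \sum_(j < J) rad_mean (S j) <= 60 * (l * r) * Num.sqrt entropy.
  apply: (@le_trans _ _ (\sum_(j < J) 12 * (l * r) * Num.sqrt entropy *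
      (2 ^- j * (4 + j%:R) / 2))); first by apply: ler_sum => j _; exact: mS.
  rewrite -mulr_sumr.
  have q0 : 0 <= 12 * (l * r) * Num.sqrt entropy by rewrite !mulr_ge0// ltW.
  by have := ler_wpM2l q0 (sum_half_pow_le J); lra.
have : l * r <= l * r * Num.sqrt entropy by rewrite ler_peMr// ltW.
rewrite -[100 * l * r]mulrA; lra.
Qed.

End chaining.

(** * Solving the self-bounding inequality for the random variance *)

Section tangent.
Context {R : realType}.

(* Concavity of [(V, Y) |-> V * ln (c * Y / V)], homogeneous of degree one. *)
Lemma entropy_tangent (c V Y V0 Y0 : R) : 0 < c -> 0 < V -> 0 < Y -> 0 < V0 ->
  0 < Y0 ->
  V * ln (c * Y / V) <= V * (ln (c * Y0 / V0) - 1) + Y * V0 / Y0.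
Proof.
move=> c0 V_gt0 Y_gt0 V00 Y00.
have -> : c * Y / V = (c * Y0 / V0) * (Y * V0 / (Y0 * V)).
  by field; rewrite !gt_eqF.
rewrite lnM ?posrE ?divr_gt0 ?mulr_gt0//.
have h : ln (Y * V0 / (Y0 * V)) <= Y * V0 / (Y0 * V) - 1.
  have := @le_ln1Dx R (Y * V0 / (Y0 * V) - 1).
  rewrite addrCA subrr addr0; apply.
  by rewrite ltrBrDl subrr divr_gt0 ?mulr_gt0.
have := ler_wpM2l (ltW V_gt0) h.
have -> : V * (Y * V0 / (Y0 * V) - 1) = Y * V0 / Y0 - V.
  by field; rewrite !gt_eqF.
by rewrite mulrDr; lra.
Qed.

Lemma sqrt_le_amgm (z t : R) : 0 <= z -> 0 < t -> Num.sqrt z <= (z / t + t) / 2.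
Proof.
move=> z0 t0; rewrite -{2}(sqr_sqrtr z0); set s := Num.sqrt z.
rewrite ler_pdivlMr// -subr_ge0.
have -> : s ^+ 2 / t + t - s * 2 = (s - t) ^+ 2 / t by field; rewrite gt_eqF.
by rewrite divr_ge0 ?sqr_ge0// ltW.
Qed.

(** With [K <= 4 * L] one gets $KD\le36n\sigma^2L+16c(mL)^2$, which is below the square of the right
    side because $16c\le k^2$ and the cross term is nonnegative. *)
Lemma sqrt_self_bound (K D L m n sigma c k : R) :
  0 <= K -> 0 <= D -> 0 <= L -> 0 <= m -> 0 <= n -> 0 <= sigma -> 0 <= c ->
  0 <= k -> K <= 4 * L -> 16 * c <= k ^+ 2 ->
  D <= 9 * n * sigma ^+ 2 + c * K * m ^+ 2 ->
  Num.sqrt (K * D) <= 6 * Num.sqrt n * sigma * Num.sqrt L + k * m * L.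
Proof.
move=> K0 D0 L0 m0 n0 sigma0 c0 k0 KL kc D_le.
have s2 : Num.sqrt L ^+ 2 = L by rewrite sqr_sqrtr.
have q2 : Num.sqrt n ^+ 2 = n by rewrite sqr_sqrtr.
pose A := Num.sqrt n * sigma * Num.sqrt L.
have A0 : 0 <= A by rewrite !mulr_ge0 ?sqrtr_ge0.
have A2 : A ^+ 2 = n * sigma ^+ 2 * L by rewrite /A !exprMn s2 q2.
pose B := m * L.
have B0 : 0 <= B by rewrite mulr_ge0.
have -> : 6 * Num.sqrt n * sigma * Num.sqrt L + k * m * L = 6 * A + k * B.
  by rewrite /A /B !mulrA.
rewrite -[leRHS]ger0_norm; last by rewrite addr_ge0 ?mulr_ge0.
rewrite -sqrtr_sqr ler_wsqrtr//.
apply: (@le_trans _ _ (4 * L * (9 * n * sigma ^+ 2 + c * (4 * L) * m ^+ 2))).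
  apply: ler_pM => //; apply: le_trans D_le _; rewrite lerD2l.
  by apply: ler_wpM2r; [exact: sqr_ge0|exact: ler_wpM2l].
have -> : 4 * L * (9 * n * sigma ^+ 2 + c * (4 * L) * m ^+ 2) =
    36 * (n * sigma ^+ 2 * L) + 16 * c * B ^+ 2 by rewrite /B; ring.
rewrite -A2.
have h1 : 0 <= k * A * B by rewrite !mulr_ge0.
have h2 := ler_wpM2r (sqr_ge0 B) kc.
have -> : (6 * A + k * B) ^+ 2 = 36 * A ^+ 2 + 12 * (k * A * B) + k ^+ 2 * B ^+ 2.
  by ring.
by rewrite -addrA lerD2l; apply: le_trans h2 _; rewrite lerDr mulr_ge0.
Qed.

End tangent.

Section self_bounding.
Context d (Om : measurableType d) (R : realType) (Pr : probability Om R).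
Local Open Scope ereal_scope.

Lemma ge0_integral_EFinD (f g : Om -> R) :
  measurable_fun setT f -> measurable_fun setT g ->
  (forall w, 0 <= f w)%R -> (forall w, 0 <= g w)%R ->
  \int[Pr]_w (f w + g w)%:E = \int[Pr]_w (f w)%:E + \int[Pr]_w (g w)%:E.
Proof.
move=> mf mg f0 g0; rewrite -ge0_integralD//.
- by move=> w _; rewrite lee_fin.
- exact/measurable_EFinP.
- by move=> w _; rewrite lee_fin.
- exact/measurable_EFinP.
Qed.

Lemma ge0_integral_EFinZl (c : R) (f : Om -> R) :
  measurable_fun setT f -> (0 <= c)%R -> (forall w, 0 <= f w)%R ->
  \int[Pr]_w (c * f w)%:E = c%:E * \int[Pr]_w (f w)%:E.
Proof.
move=> mf c0 f0; rewrite -ge0_integralZl//.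
- exact/measurable_EFinP.
- by move=> w _; rewrite lee_fin.
Qed.

Lemma ge0_le_integral_EFin (f g : Om -> R) :
  measurable_fun setT f -> measurable_fun setT g ->
  (forall w, 0 <= f w)%R -> (forall w, f w <= g w)%R ->
  \int[Pr]_w (f w)%:E <= \int[Pr]_w (g w)%:E.
Proof.
move=> mf mg f0 fg; apply: ge0_le_integral => //.
- by move=> w _; rewrite lee_fin.
- exact/measurable_EFinP.
- exact/measurable_EFinP.
- by move=> w _; rewrite lee_fin.
Qed.

Lemma integral_cst_EFin (c : R) : \int[Pr]_w c%:E = c%:E.
Proof.
have := integral_cst Pr measurableT c%:E.
by rewrite [X in _ * X](@probability_setT _ _ _ Pr) mule1.
Qed.

Variables (V Y M S1 S2 : Om -> R) (n a v sigma Phi m : R).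
Hypotheses (mV : measurable_fun setT V) (mY : measurable_fun setT Y)
  (mM : measurable_fun setT M) (mS1 : measurable_fun setT S1)
  (mS2 : measurable_fun setT S2).
Hypotheses (V0 : forall w, (0 <= V w)%R) (VY : forall w, (V w <= Y w)%R)
  (S1_ge0 : forall w, (0 <= S1 w)%R) (S2_ge0 : forall w, (0 <= S2 w)%R)
  (M0 : forall w, (0 <= M w)%R).
Hypotheses (n1 : (1 <= n)%R) (a4 : (4 <= a)%R) (v1 : (1 <= v)%R)
  (sigma0 : (0 < sigma)%R) (sigma_Phi : (sigma <= Phi)%R) (m0 : (0 <= m)%R).
Hypothesis EY : \int[Pr]_w (Y w)%:E <= (n * Phi ^+ 2)%:E.
Hypothesis EM : \int[Pr]_w (M w ^+ 2)%:E <= (m ^+ 2)%:E.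
(** The tangent of [entropy_tangent] at [(D, Y0)], evaluated at the random point [(V w, Y w)]. *)
Let psi (D Y0 : R) w := (V w * (ln (a ^+ 2 * Y0 / D) - 1) + Y w * D / Y0)%R.
Hypothesis S1_le : forall D Y0 w, (0 < D)%R -> (0 < Y0)%R -> (D <= Y0)%R ->
  (S1 w <= 100 * Num.sqrt (v / 2 * psi D Y0 w))%R.
Hypothesis S2_le : forall D Y0 w, (0 < D)%R -> (0 < Y0)%R -> (D <= Y0)%R ->
  (S2 w <= 200 * M w * Num.sqrt (v / 2 * psi D Y0 w))%R.
Hypothesis EV : \int[Pr]_w (V w)%:E <=
  (3 * n * sigma ^+ 2)%:E + 2%:E * \int[Pr]_w (S2 w)%:E.

Let L := (v * ln (Num.sqrt a * Phi / sigma))%R.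

(** The argument is circular by design: [S2] controls the mean of [V], and the bounds on [S1] and
    [S2] contain [V]. Since [psi] is linear in [(V, Y)], the arithmetic-geometric mean inequality
    lets expectations pass under the root. The resulting inequality bounds [D] after part of [D] has
    been absorbed, and the mean of [S1] is at most [75 * Num.sqrt (K * D)]. *)
Lemma self_bounding : 2%:E * \int[Pr]_w (S1 w)%:E <=
  ((500 * 400) * (Num.sqrt n * sigma * Num.sqrt L + m * L))%:E.
Proof.
have Phi0 : (0 < Phi)%R by apply: lt_le_trans sigma_Phi.
have n0 : (0 < n)%R by apply: lt_le_trans n1.
have a0 : (0 < a)%R by apply: lt_le_trans a4.
have v0 : (0 < v)%R by apply: lt_le_trans v1.
have Y_ge0 w : (0 <= Y w)%R by apply: le_trans (VY w).
pose Y0 := (n * Phi ^+ 2)%R.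
have Y00 : (0 < Y0)%R by rewrite mulr_gt0// exprn_gt0.
have EVY : \int[Pr]_w (V w)%:E <= Y0%:E.
  by apply: le_trans EY; apply: ge0_le_integral_EFin.
have [ev evE ev0] : exists2 ev, \int[Pr]_w (V w)%:E = ev%:E & (0 <= ev)%R.
  have h0 : 0 <= \int[Pr]_w (V w)%:E by apply: integral_ge0 => w _; rewrite lee_fin.
  exists (fine (\int[Pr]_w (V w)%:E)); last exact: fine_ge0.
  by rewrite fineK// ge0_fin_numE// (le_lt_trans EVY)// ltry.
have evY0 : (ev <= Y0)%R by rewrite -lee_fin -evE.
pose D := Num.max ev (n * sigma ^+ 2)%R.
have D0 : (0 < D)%R by rewrite lt_max (mulr_gt0 n0) ?exprn_gt0// orbT.
have DY0 : (D <= Y0)%R.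
  rewrite ge_max evY0 ler_pM2l// ler_sqr// ?nnegrE ltW//.
pose lam := ln (a ^+ 2 * Y0 / D).
have a16 : (16 <= a ^+ 2 * Y0 / D)%R.
  rewrite ler_pdivlMr//; apply: ler_pM => //; first exact: ltW.
  by have := a4; nra.
have lam1 : (1 <= lam)%R.
  have : (2 * ln 2 <= lam)%R.
    rewrite mulr_natl -lnXn// ler_ln ?posrE ?exprn_gt0//; last exact: lt_le_trans a16.
    by apply: le_trans a16; rewrite expr2; lra.
  by have := @half_le_ln2 R; lra.
pose l0 := ln (Num.sqrt a * Phi / sigma).
have sa0 : (0 < Num.sqrt a)%R by rewrite sqrtr_gt0.
(* Source of the square root of [a] in the theorem: $a^2Y_0/D\le a^2(\Phi/\sigma)^2$, and as
   $\sigma\le\Phi$ this is at most the fourth power of $\sqrt a\,\Phi/\sigma$. *)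
have lam_l0 : (lam <= 4 * l0)%R.
  rewrite /lam /l0 mulr_natl -lnXn; last by rewrite divr_gt0// mulr_gt0.
  rewrite ler_ln ?posrE ?exprn_gt0 ?divr_gt0 ?mulr_gt0 ?exprn_gt0//.
  rewrite ler_pdivrMr// !exprMn exprVn.
  rewrite (_ : (Num.sqrt a ^+ 4 = a ^+ 2)%R); last by rewrite (exprM _ 2 2) sqr_sqrtr// ltW.
  apply: (@le_trans _ _ (a ^+ 2 * Phi ^+ 4 / sigma ^+ 4 * (n * sigma ^+ 2)))%R; last first.
    rewrite ler_wpM2l// ?le_max ?lexx ?orbT//.
    by rewrite divr_ge0// ?mulr_ge0 ?exprn_ge0// ltW.
  rewrite -mulrA -mulrA ler_wpM2l ?sqr_ge0// /Y0.
  have -> : (Phi ^+ 4 * (sigma ^- 4 * (n * sigma ^+ 2)) = n * Phi ^+ 2 * (Phi / sigma) ^+ 2)%R.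
    by field; rewrite gt_eqF.
  rewrite ler_peMr ?(ltW Y00)// exprn_ege1// ler_pdivlMr// mul1r//.
have lamD0 : (0 <= v / 2 * (D * lam))%R.
  by rewrite !mulr_ge0// ?invr_ge0 ?ltW// (lt_le_trans _ lam1).
have psi_ge0 w : (0 <= psi D Y0 w)%R.
  by rewrite addr_ge0 ?mulr_ge0 ?invr_ge0 ?subr_ge0// ltW.
have mpsi : measurable_fun setT (psi D Y0).
  apply: measurable_funD; first exact: measurable_funM.
  by apply: measurable_funM => //; exact: measurable_funM.
have Epsi : \int[Pr]_w (psi D Y0 w)%:E <= (D * lam)%:E.
  rewrite ge0_integral_EFinD//; first last.
  - by move=> w; rewrite !mulr_ge0// ?invr_ge0 ltW.
  - by move=> w; rewrite mulr_ge0// subr_ge0.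
  - by apply: measurable_funM => //; exact: measurable_funM.
  - exact: measurable_funM.
  under eq_integral do rewrite mulrC.
  under [X in _ + X]eq_integral do rewrite -mulrA mulrC.
  rewrite !ge0_integral_EFinZl// ?subr_ge0//; last by rewrite divr_ge0 ?ltW.
  rewrite evE -EFinM.
  have h : (D / Y0)%:E * \int[Pr]_w (Y w)%:E <= D%:E.
    apply: (@le_trans _ _ ((D / Y0)%:E * Y0%:E)).
      by apply: lee_wpmul2l => //; rewrite lee_fin divr_ge0 ?ltW.
    by rewrite -EFinM lee_fin divfK// gt_eqF.
  apply: le_trans (leeD2l _ h) _; rewrite -EFinD lee_fin.
  have : (ev <= D)%R by rewrite le_max lexx.
  by rewrite -/lam; nra.
have msq w (u : R) : (0 < u)%R -> (M w * Num.sqrt (v / 2 * psi D Y0 w) <=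
    (u * M w ^+ 2 + v / (2 * u) * psi D Y0 w) / 2)%R.
  move=> u0; set z := Num.sqrt _.
  have z2 : (z ^+ 2 = v / 2 * psi D Y0 w)%R.
    by rewrite sqr_sqrtr// mulr_ge0// divr_ge0 ?ltW.
  have -> : (v / (2 * u) * psi D Y0 w = z ^+ 2 / u)%R by rewrite z2; field; rewrite gt_eqF.
  rewrite -subr_ge0.
  have -> : ((u * M w ^+ 2 + z ^+ 2 / u) / 2 - M w * z = (u * M w - z) ^+ 2 / (2 * u))%R.
    by field; rewrite gt_eqF.
  by rewrite divr_ge0 ?sqr_ge0// mulr_ge0// ltW.
pose K := (v * lam)%R.
have K1 : (1 <= K)%R by rewrite -[leLHS]mulr1 ler_pM.
have K0 : (0 < K)%R by apply: lt_le_trans K1.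
have ES2 : \int[Pr]_w (S2 w)%:E <= ((100 * 200) * K * m ^+ 2 + D / 4)%:E.
  (* This weight in the arithmetic-geometric mean inequality makes the [psi] term contribute
     [D / 4]. *)
  pose u := (200 * K)%R.
  have u0 : (0 < u)%R by rewrite mulr_gt0.
  apply: (@le_trans _ _ (\int[Pr]_w ((100 * u) * M w ^+ 2 + 50 * (v / u) * psi D Y0 w)%:E)).
    apply: ge0_le_integral_EFin => //.
    - apply: measurable_funD; apply: measurable_funM => //.
      exact: measurable_funX.
    - move=> w; apply: le_trans (S2_le w D0 Y00 DY0) _.
      have := msq w u u0; rewrite -mulrA.
      have -> : (v / (2 * u) = v / u / 2)%R by field; rewrite gt_eqF.
      by lra.
  rewrite ge0_integral_EFinD//; first last.
  - by move=> w; rewrite mulr_ge0// mulr_ge0// divr_ge0// ltW.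
  - by move=> w; rewrite mulr_ge0 ?sqr_ge0// mulr_ge0// ltW.
  - exact: measurable_funM.
  - by apply: measurable_funM => //; exact: measurable_funX.
  rewrite !ge0_integral_EFinZl//; first last.
  - by move=> w; rewrite sqr_ge0.
  - by rewrite mulr_ge0// ltW.
  - exact: measurable_funX.
  - by rewrite mulr_ge0// divr_ge0 ?ltW.
  apply: (@le_trans _ _ ((100 * u)%:E * (m ^+ 2)%:E + (50 * (v / u))%:E * (D * lam)%:E)).
    apply: leeD; apply: lee_wpmul2l => //; rewrite lee_fin.
      by rewrite mulr_ge0// ltW.
    by rewrite mulr_ge0// divr_ge0 ?ltW.
  rewrite -!EFinM -EFinD lee_fin /u /K le_eqVlt; apply/orP; left; apply/eqP.
  by field; rewrite !gt_eqF//; apply: lt_le_trans lam1.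
(* If [D] is the mean of [V], the term [2 * (D / 4)] moves to the left side, which is legitimate
   because [D] is a real number. Otherwise [D] equals [n * sigma ^+ 2] and the bound is
   immediate. *)
have D_le : (D <= 9 * n * sigma ^+ 2 + (400 * 200) * K * m ^+ 2)%R.
  have : (ev <= 3 * n * sigma ^+ 2 + 2 * ((100 * 200) * K * m ^+ 2 + D / 4))%R.
    rewrite -lee_fin -evE; apply: le_trans EV _.
    rewrite (EFinD (3 * n * sigma ^+ 2)); apply: leeD => //.
    by rewrite (EFinM 2); apply: lee_wpmul2l.
  have h1 : (0 <= K * m ^+ 2)%R by rewrite mulr_ge0 ?sqr_ge0 ?ltW.
  have h2 : (0 <= n * sigma ^+ 2)%R by rewrite mulr_ge0 ?sqr_ge0 ?ltW.
  rewrite /D; case: (leP ev (n * sigma ^+ 2)%R) => ?; lra.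
pose t := Num.sqrt (K * D).
have KD0 : (0 < K * D)%R by rewrite mulr_gt0.
have t0 : (0 < t)%R by rewrite sqrtr_gt0.
have ES1 : \int[Pr]_w (S1 w)%:E <= (75 * t)%:E.
  apply: (@le_trans _ _ (\int[Pr]_w (25 * v / t * psi D Y0 w + 50 * t)%:E)).
    apply: ge0_le_integral_EFin => //.
      by apply: measurable_funD => //; apply: measurable_funM.
    move=> w; apply: le_trans (S1_le w D0 Y00 DY0) _.
    have h0 : (0 <= v / 2 * psi D Y0 w)%R by rewrite mulr_ge0// divr_ge0 ?ltW.
    have := sqrt_le_amgm h0 t0; lra.
  rewrite ge0_integral_EFinD//; first last.
  - by move=> w; rewrite mulr_ge0// (ltW t0).
  - by move=> w; apply: mulr_ge0 => //; rewrite divr_ge0 ?(ltW t0)// mulr_ge0// ltW.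
  - exact: measurable_funM.
  rewrite integral_cst_EFin ge0_integral_EFinZl//; last first.
    by rewrite divr_ge0// ?ltW// mulr_gt0.
  apply: (@le_trans _ _ ((25 * v / t)%:E * (D * lam)%:E + (50 * t)%:E)).
    by apply: leeD => //; apply: lee_wpmul2l => //; rewrite lee_fin divr_ge0 ?ltW// mulr_gt0.
  rewrite -EFinM -EFinD lee_fin.
  have -> : (25 * v / t * (D * lam) = 25 * (K * D / t))%R by rewrite /K; ring.
  by rewrite -(sqr_sqrtr (ltW KD0)) -/t expr2 mulfK ?gt_eqF//; lra.
have l00 : (0 <= l0)%R by have := lam1; have := lam_l0; lra.
have L0 : (0 <= L)%R by rewrite mulr_ge0// ltW.
have KL : (K <= 4 * L)%R.
  by rewrite /K /L -/l0 mulrCA; apply: ler_wpM2l => //; exact: ltW.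
(* The square of [40 * 30] exceeds [16 * (400 * 200)], as [sqrt_self_bound] requires. *)
have t_le : (t <= 6 * Num.sqrt n * sigma * Num.sqrt L + (40 * 30) * m * L)%R.
  have c0 : (0 <= 400 * 200 :> R)%R by rewrite mulr_ge0 ?ler0n.
  have k0 : (0 <= 40 * 30 :> R)%R by rewrite mulr_ge0 ?ler0n.
  apply: (sqrt_self_bound (ltW K0) (ltW D0) L0 m0 (ltW n0) (ltW sigma0) c0 k0 KL _ D_le).
  by rewrite expr2; lra.
apply: (@le_trans _ _ (2%:E * (75 * t)%:E)); first by apply: lee_wpmul2l.
rewrite -EFinM lee_fin.
have : (0 <= Num.sqrt n * sigma * Num.sqrt L)%R by rewrite !mulr_ge0 ?sqrtr_ge0// ltW.
have : (0 <= m * L)%R by rewrite mulr_ge0.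
lra.
Qed.

End self_bounding.

(** * Symmetrization *)

(** Ties go to the smallest index, so that the events [first_argmax g k] are disjoint over [k] and
    exhaust all outcomes when [K] is positive. *)
Definition first_argmax {R : realType} (K : nat) (g : 'I_K -> R) (k : 'I_K) :=
  [forall j : 'I_K, (g j <= g k) && ((j < k)%N ==> (g j < g k))].

Lemma first_argmax_inj {R : realType} (K : nat) (g : 'I_K -> R) k l :
  first_argmax g k -> first_argmax g l -> k = l.
Proof.
rewrite /first_argmax => /forallP gk /forallP gl; apply: ord_inj; apply/eqP.
rewrite eqn_leq; apply/andP; split; rewrite leqNgt; apply/negP => h.
- have /andP[_ /implyP/(_ h)] := gk l; have /andP[+ _] := gl k.
  by rewrite leNgt => /negbTE->.
- have /andP[_ /implyP/(_ h)] := gl k; have /andP[+ _] := gk l.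
  by rewrite leNgt => /negbTE->.
Qed.

Lemma first_argmax_ex {R : realType} (K : nat) (g : 'I_K -> R) :
  (0 < K)%N -> exists k, first_argmax g k.
Proof.
move=> K0; pose k0 := Ordinal K0.
pose m := [arg max_(i > k0) g i]%O.
have mP j : g j <= g m by rewrite /m; case: arg_maxP => // i _; exact.
have mm : g m == g m by [].
case: (@arg_minnP _ m (fun i => g i == g m) val mm) => k /eqP gk kmin.
exists k; apply/forallP => j; rewrite gk mP/=; apply/implyP => jk.
rewrite lt_neqAle mP andbT; apply/negP => /kmin.
by rewrite leqNgt jk.
Qed.

Lemma measurable_bigmax d (T : measurableType d) (R : realType) (D : set T)
    (I : Type) (s : seq I) (f : I -> T -> R) :
  (forall i, measurable_fun D (f i)) ->
  measurable_fun D (fun w => \big[Num.max/0]_(i <- s) f i w).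
Proof.
move=> mf; elim: s => [|i s IH].
  by under eq_fun do rewrite big_nil; exact: measurable_cst.
by under eq_fun do rewrite big_cons; exact: measurable_maxr.
Qed.

Section real_integrals.
Context d (T : measurableType d) (R : realType) (mu : {measure set T -> \bar R}).
Local Open Scope ereal_scope.

Lemma integrable_EFinD (f g : T -> R) :
  mu.-integrable setT (EFin \o f) -> mu.-integrable setT (EFin \o g) ->
  mu.-integrable setT (fun w => (f w + g w)%:E).
Proof. by move=> fi gi; apply: (integrableD measurableT fi gi). Qed.

Lemma integrable_EFin_sum (I : Type) (s : seq I) (P : pred I) (f : I -> T -> R) :
  (forall i, P i -> mu.-integrable setT (EFin \o f i)) ->
  mu.-integrable setT (fun w => (\sum_(i <- s | P i) f i w)%:E).
Proof.
move=> fi; under eq_fun do rewrite -sumEFin.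
exact: integrable_sum.
Qed.

Lemma integrable_EFinZl (c : R) (f : T -> R) :
  mu.-integrable setT (EFin \o f) ->
  mu.-integrable setT (fun w => (c * f w)%:E).
Proof. by move=> fi; under eq_fun do rewrite EFinM; exact: integrableZl. Qed.

Lemma integrable_EFin_norm (f : T -> R) :
  mu.-integrable setT (EFin \o f) ->
  mu.-integrable setT (fun w => `|f w|%:E).
Proof. exact: integrable_norm. Qed.

Lemma integrable_EFin_bigmax (K : nat) (f : 'I_K -> T -> R) :
  (forall k, mu.-integrable setT (EFin \o f k)) ->
  mu.-integrable setT (fun w => (\big[Num.max/0%R]_k `|f k w|)%:E).
Proof.
move=> fi; have mf k : measurable_fun setT (f k).
  by apply/measurable_EFinP; exact: measurable_int (fi k).
apply: (@le_integrable _ _ _ _ _ measurableT _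
  (fun w => (\sum_k `|f k w|)%:E)) => //; last 2 first.
- move=> w _; rewrite /= !ger0_norm; last 2 first.
  + by apply: sumr_ge0.
  + exact: bigmax_ge_id.
  rewrite lee_fin; apply: bigmax_le => [|k _]; first exact: sumr_ge0.
  by rewrite (bigD1 k)//= lerDl sumr_ge0.
- by apply: integrable_EFin_sum => k _; exact: integrable_EFin_norm.
- apply/measurable_EFinP.
  by apply: measurable_bigmax => k; exact: measurableT_comp.
Qed.

End real_integrals.

Lemma measurable_set_bool d (T : measurableType d) (b : T -> bool) :
  measurable_fun setT b -> measurable [set w | b w].
Proof.
move=> mb; have : measurable (setT `&` b @^-1` [set true]) by exact: mb.
by rewrite setTI.
Qed.

Lemma measurable_sum_pred d (T : measurableType d) (R : realType) (D : set T)
    (I : Type) (s : seq I) (P : pred I) (h : I -> T -> R) :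
  (forall i, P i -> measurable_fun D (h i)) ->
  measurable_fun D (fun x => \sum_(i <- s | P i) h i x).
Proof.
move=> mh; rewrite (_ : (fun x => \sum_(i <- s | P i) h i x) =
    (fun x => \sum_(i <- s) if P i then h i x else 0)); last first.
  by apply/funext => x; rewrite -big_mkcond.
apply: measurable_sum => i; case: (P i) (mh i) => [|_]; first exact.
exact: measurable_cst.
Qed.

Section symmetrization.
Context d (Om : measurableType d) (R : realType) (Pr : probability Om R).
Variables (n K : nat) (G : 'I_n -> set (set Om)).
Hypothesis Gm : forall i, <<s G i>> `<=` measurable.
Local Open Scope ereal_scope.

Let maxabs (W : 'I_K -> Om -> R) w := \big[Num.max/0%R]_k `|W k w|%R.

(* Jensen's inequality for a perturbation [sum_i D k i] whose conditional
   expectation given a sigma-algebra containing sigma(W) vanishes: integrate it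
   over the events where a given signed coordinate of W realizes the maximum. *)
Lemma le_integral_maxabs (J : pred 'I_n) (W : 'I_K -> Om -> R)
    (D : 'I_K -> 'I_n -> Om -> R) :
  (forall k, Pr.-integrable setT (EFin \o W k)) ->
  (forall k i, Pr.-integrable setT (EFin \o D k i)) ->
  (forall i k, J i -> measurable_fun setT (W k : g_sigma_algebraType (G i) -> R)) ->
  (forall k i H, J i -> <<s G i>> H -> \int[Pr]_(w in H) (D k i w)%:E = 0) ->
  \int[Pr]_w (maxabs W w)%:E <=
  \int[Pr]_w (maxabs (fun k w => W k w + \sum_(i | J i) D k i w)%R w)%:E.
Proof.
move=> Wi Di Wm D0;
pose V k w := (W k w + \sum_(i | J i) D k i w)%R.
change (\int[Pr]_w (maxabs W w)%:E <= \int[Pr]_w (maxabs V w)%:E).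
case: (posnP K) => [K0|K0].
  have noK (k : 'I_K) : False.
    by have := leq_ltn_trans (leq0n k) (ltn_ord k); rewrite {1}K0.
  rewrite (_ : V = W)//; apply/funext => k; by have := noK k.
have Vi k : Pr.-integrable setT (EFin \o V k).
  by apply: integrable_EFinD => //; exact: integrable_EFin_sum.
pose A (p : 'I_K * bool) : set Om :=
  [set w | first_argmax (fun j => `|W j w|%R) p.1 && ((0 <= W p.1 w)%R == p.2)].
have mA i p : J i -> <<s G i>> (A p).
  move=> Ji; pose Gi := g_sigma_algebraType (G i).
  have mabs k : measurable_fun setT ((fun w => `|W k w|%R) : Gi -> R).
    by apply: (measurableT_comp (@normr_measurable R setT)); exact: Wm.
  have : measurable_fun setT ((fun w : Gi => (0 <= W p.1 w)%R)).
    by apply: measurable_fun_ler => //; exact: Wm.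
  move=> mpos.
  have -> : A p = (\bigcap_(j : 'I_K) ([set w : Gi | (`|W j w| <= `|W p.1 w|)%R] `&`
       [set w : Gi | (j < p.1)%N ==> (`|W j w| < `|W p.1 w|)%R])) `&`
       [set w : Gi | (0 <= W p.1 w)%R == p.2].
    apply/seteqP; split => w.
      by move=> /andP[/forallP h hp]; split => // j _; have /andP[] := h j.
    move=> [h1 h2]; apply/andP; split => //; apply/forallP => j.
    by have [h3 h4] := h1 j Logic.I; apply/andP; split.
  change (measurable ((\bigcap_(j : 'I_K) ([set w : Gi | (`|W j w| <= `|W p.1 w|)%R] `&`
       [set w : Gi | (j < p.1)%N ==> (`|W j w| < `|W p.1 w|)%R])) `&`
       [set w : Gi | (0 <= W p.1 w)%R == p.2])).
  apply: measurableI.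
    apply: fin_bigcap_measurable => [|j _]; first exact: finite_finset.
    apply: measurableI.
      exact: measurable_set_bool (measurable_fun_ler (mabs j) (mabs p.1)).
    case: (ltnP j p.1) => jp /=.
      exact: measurable_set_bool (measurable_fun_ltr (mabs j) (mabs p.1)).
    by rewrite (_ : [set w | true] = setT)//; apply/seteqP; split.
  rewrite (_ : [set w | _] = (fun w : Gi => (0 <= W p.1 w)%R) @^-1` [set p.2]).
    by rewrite -[X in measurable X]setTI; apply: mpos.
  by apply/seteqP; split => w /= /eqP.
pose sg (b : bool) : R := (if b then 1 else -1)%R.
pose t (p : 'I_K * bool) i w :=
  (if J i then \1_(A p) w * (sg p.2 * D p.1 i w) else 0)%R.
pose T w := (\sum_p \sum_i t p i w)%R.
have tE p i : J i ->
    EFin \o t p i = (EFin \o (fun w => sg p.2 * D p.1 i w)%R) \_ (A p).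
  move=> Ji; apply/funext => w; rewrite patchE /t /= Ji indicE.
  by case: ifPn => _ /=; rewrite ?mul1r ?mul0r.
have Ti0 p i : Pr.-integrable setT (EFin \o t p i).
  have [Ji|Ji] := boolP (J i); last first.
    rewrite (_ : _ \o _ = cst 0); first exact: integrable0.
    by apply/funext => w; rewrite /t /= (negbTE Ji).
  have mAp := Gm (mA i p Ji).
  rewrite tE//; apply/(integrable_mkcond _ mAp).1.
  by apply: integrableS (integrable_EFinZl _ (Di p.1 i)) => //.
have Ti : Pr.-integrable setT (EFin \o T).
  by apply: integrable_EFin_sum => p _; apply: integrable_EFin_sum => i _; exact: Ti0.
have T0 : \int[Pr]_w (T w)%:E = 0.
  rewrite /T; under eq_integral do rewrite -sumEFin.
  rewrite integral_sum//; last first.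
    by move=> p; apply: integrable_EFin_sum => i _; exact: Ti0.
  apply: big1 => p _; under eq_integral do rewrite -sumEFin.
  rewrite integral_sum//; last exact: Ti0.
  apply: big1 => i _.
  have [Ji|Ji] := boolP (J i); last first.
    by apply: integral0_eq => w _; rewrite /t (negbTE Ji).
  change (\int[Pr]_w ((EFin \o t p i) w) = 0); rewrite tE// -integral_mkcond /=.
  under eq_integral do rewrite EFinM.
  have mAp := mA i p Ji.
  have iD : Pr.-integrable (A p) (EFin \o D p.1 i).
    by apply: integrableS (Di p.1 i) => //; exact: Gm mAp.
  by rewrite (integralZl (Gm mAp) iD) (D0 _ _ _ Ji)// mule0.
(* On [A p] the maximum of $|W|$ is a signed coordinate of [W]. Adding the perturbation with the
   same sign gives the signed coordinate of [V], which is at most the maximum of $|V|$; other events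
   contribute nothing to [T w]. *)
have pw w : (maxabs W w + T w <= maxabs V w)%R.
  have [k kP] := first_argmax_ex (fun j => `|W j w|%R) K0.
  pose p := (k, (0 <= W k w)%R).
  have Ap : A p w by rewrite /A/= kP eqxx.
  have Aq q : q != p -> (\1_(A q) w = 0 :> R)%R.
    move=> qp; rewrite indicE memNset// => /andP[h1 /eqP h2].
    move/eqP: qp; apply; have kq := first_argmax_inj h1 kP.
    by rewrite /p [q]surjective_pairing -h2 kq.
  have -> : T w = (sg p.2 * \sum_(i | J i) D k i w)%R.
    rewrite /T (bigD1 p)//= [X in (_ + X)%R]big1; last first.
      by move=> q qp; apply: big1 => i _; rewrite /t Aq// mul0r; case: ifP.
    rewrite addr0 mulr_sumr [RHS]big_mkcond; apply: eq_bigr => i _.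
    by rewrite /t indicE mem_set// mul1r.
  have -> : maxabs W w = (sg p.2 * W k w)%R.
    transitivity `|W k w|%R.
      apply/eqP; rewrite eq_le; apply/andP; split.
        apply: bigmax_le => // j _; move/forallP: kP => /(_ j) /andP[]//.
      exact: (le_bigmax _ (fun k => `|W k w|%R)).
    rewrite /sg /=; case: (leP 0%R (W k w)) => h; first by rewrite ger0_norm// mul1r.
    by rewrite ltr0_norm// mulN1r.
  rewrite -mulrDr -/(V k w).
  apply: le_trans (le_bigmax _ (fun k => `|V k w|%R) k).
  rewrite /sg; case: ifP => _; rewrite ?mul1r ?mulN1r ?ler_norm// -normrN ler_norm//.
have Mi U : (forall k, Pr.-integrable setT (EFin \o U k)) ->
    Pr.-integrable setT (EFin \o maxabs U) by exact: integrable_EFin_bigmax.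
rewrite -[leLHS]adde0 -T0 -integralD_EFin//; [|exact: Mi..].
apply: le_integral => //; [|exact: Mi|by move=> w _; rewrite lee_fin].
by apply: integrable_EFinD => //; exact: Mi.
Qed.

(* A fixed choice of signs already suffices: the sums over the indices with sign
   +1 and -1 are each dominated by their difference. *)
Lemma symmetrization (Z : 'I_K -> 'I_n -> Om -> R) :
  (forall k i, Pr.-integrable setT (EFin \o Z k i)) ->
  (forall i j k, i != j ->
    measurable_fun setT (Z k i : g_sigma_algebraType (G j) -> R)) ->
  (forall k i H, <<s G i>> H -> \int[Pr]_(w in H) (Z k i w)%:E = 0) ->
  \int[Pr]_w (\big[Num.max/0%R]_k `|\sum_i Z k i w|%R)%:E <=
  2%:E * \int[Pr]_w
    (rad_mean (fun e => \big[Num.max/0%R]_k `|rad_sum (fun i => Z k i w) e|%R))%:E.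
Proof.
move=> Zi Zm Z0.
have Zsum (J : pred 'I_n) (k : 'I_K) :
    Pr.-integrable setT (EFin \o (fun w => \sum_(i | J i) Z k i w)%R).
  by apply: integrable_EFin_sum.
pose S (e : {ffun 'I_n -> bool}) w := \big[Num.max/0%R]_k `|rad_sum (fun i => Z k i w) e|%R.
have radi k e : Pr.-integrable setT (EFin \o (fun w => rad_sum (fun i => Z k i w) e)).
  by apply: integrable_EFin_sum => i _; exact: integrable_EFinZl.
have Si e : Pr.-integrable setT (EFin \o S e) by exact: integrable_EFin_bigmax.
have mS e : measurable_fun setT (S e).
  by apply/measurable_EFinP; exact: measurable_int (Si e).
have S0 e w : (0 <= S e w)%R by exact: bigmax_ge_id.
have mmax (W : 'I_K -> Om -> R) : (forall k, Pr.-integrable setT (EFin \o W k)) ->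
    measurable_fun setT (maxabs W).
  move=> Wi; apply/measurable_EFinP; exact: measurable_int (integrable_EFin_bigmax Wi).
(* The perturbation is minus the variables whose sign differs from [b]. The perturbed sum is then,
   up to a global sign, the signed sum for [e]. *)
have half (e : {ffun 'I_n -> bool}) (b : bool) :
    \int[Pr]_w (maxabs (fun k w => \sum_(i | e i == b) Z k i w)%R w)%:E <=
    \int[Pr]_w (S e w)%:E.
  pose J := [pred i : 'I_n | e i != b].
  apply: le_trans (@le_integral_maxabs J _ (fun k i w => -1 * Z k i w)%R _ _ _ _) _.
  - by move=> k; exact: Zsum.
  - by move=> k i; exact: integrable_EFinZl.
  - move=> i k /= eib.
    apply: measurable_sum_pred => j /eqP ejb; apply: Zm.
    by apply: contraNneq eib => <-; rewrite ejb.
  - move=> k i H _ HG; under eq_integral do rewrite EFinM.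
    have iZ : Pr.-integrable H (EFin \o Z k i).
      by apply: integrableS (Zi k i) => //; exact: Gm HG.
    by rewrite (integralZl (Gm HG) iZ) (Z0 _ _ _ HG) mule0.
  rewrite le_eqVlt; apply/orP; left; apply/eqP; apply: eq_integral => w _.
  congr EFin; apply: eq_bigr => k _.
  have -> : (rad_sum (fun i => Z k i w) e =
      (-1) ^+ b * (\sum_(i | e i == b) Z k i w + \sum_(i | J i) (-1) * Z k i w))%R.
    rewrite mulrDr !mulr_sumr /rad_sum (bigID (fun i => e i == b))/=; congr (_ + _)%R.
      by apply: eq_bigr => i /eqP->.
    apply: eq_bigr => i; rewrite mulrA; by case: (e i) b {J} => -[]//= _; congr (_ * _)%R; rewrite !(expr0, expr1); ring.
  by rewrite normrMsign.
have key e : \int[Pr]_w (maxabs (fun k w => \sum_i Z k i w)%R w)%:E <=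
    2%:E * \int[Pr]_w (S e w)%:E.
  apply: (@le_trans _ _ (\int[Pr]_w
     (maxabs (fun k w => \sum_(i | e i == true) Z k i w)%R w +
      maxabs (fun k w => \sum_(i | e i == false) Z k i w)%R w)%:E)).
    apply: ge0_le_integral_EFin.
    - exact: mmax.
    - by apply: measurable_funD; exact: mmax.
    - by move=> w; exact: bigmax_ge_id.
    - move=> w; apply: bigmax_le => [|k _].
        by apply: addr_ge0; exact: bigmax_ge_id.
      rewrite (bigID (fun i => e i == true))/=; apply: le_trans (ler_normD _ _) _.
      apply: lerD; first exact: (le_bigmax _ (fun k => `|\sum_(i | e i == true) Z k i w|%R)).
      rewrite (eq_bigl (fun i => e i == false)); last by move=> i; case: (e i).
      exact: (le_bigmax _ (fun k => `|\sum_(i | e i == false) Z k i w|%R)).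
  rewrite ge0_integral_EFinD; first last.
  - by move=> w; exact: bigmax_ge_id.
  - by move=> w; exact: bigmax_ge_id.
  - exact: mmax.
  - exact: mmax.
  by rewrite mule_natl mule2n leeD.
have fin (g : Om -> R) : Pr.-integrable setT (EFin \o g) ->
    \int[Pr]_w (g w)%:E = (fine (\int[Pr]_w (g w)%:E))%:E.
  by move=> gi; rewrite fineK//; exact: integrable_fin_num gi.
have -> : \int[Pr]_w (rad_mean (S^~ w))%:E =
    (rad_mean (fun e => fine (\int[Pr]_w (S e w)%:E)))%:E.
  rewrite /rad_mean ge0_integral_EFinZl; first last.
  - by move=> w; apply: sumr_ge0.
  - by rewrite invr_ge0 exprn_ge0.
  - exact: measurable_sum.
  rewrite EFinM; congr (_ * _); rewrite -sumEFin.
  under eq_integral do rewrite -sumEFin.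
  rewrite ge0_integral_sum//.
  - by apply: eq_bigr => e _; exact: fin.
  - by move=> e; exact/measurable_EFinP.
  - by move=> e w _; rewrite lee_fin.
have Mi : Pr.-integrable setT (EFin \o maxabs (fun k w => \sum_i Z k i w)%R).
  by apply: integrable_EFin_bigmax => k; exact: Zsum.
rewrite (fin _ Mi) -EFinM lee_fin -[leLHS](@rad_mean_cst _ n) -rad_meanZ.
apply: le_rad_mean => e; rewrite -lee_fin EFinM -(fin _ (Si e)) -(fin _ Mi).
exact: key.
Qed.

End symmetrization.

(** * The space of blocks *)

Section finite_measures.
Context d (T : measurableType d) (R : realType).

(** Uniqueness of finite measures on a pi-system. It extends the renewal identity and the
    independence of one variable from the others beyond cylinders. *)
Lemma eq_finite_measure (G : set (set T)) (m1 m2 : {measure set T -> \bar R}) :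
  G `<=` measurable -> setI_closed G -> m1 setT = m2 setT ->
  (m1 setT < +oo)%E -> (forall A, G A -> m1 A = m2 A) ->
  forall A, <<s G >> A -> m1 A = m2 A.
Proof.
move=> Gm GI mT fin mG A GA.
have GE : [set X | G X /\ X `<=` setT] = G.
  by apply/seteqP; split => [X []//|X].
apply: (g_sigma_algebra_measure_unique_trace G setT) => //.
- by move=> X [/Gm].
- by rewrite GE.
- by move=> X [/mG].
- by rewrite GE.
Qed.

End finite_measures.

HB.instance Definition _ (E : pointedType) := isPointed.Build (seq E) [::].

Section block_space.
Context d (E : measurableType d) (R : realType).

(** The length is part of the cylinder: no constraint reads the default value of [nth], and lists of
    different lengths are separated. *)
Definition cylinder (n : nat) (C : nat -> set E) : set (seq E) :=
  [set s | size s = n /\ forall k, (k < n)%N -> C k (nth point s k)].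

Definition cylinders : set (set (seq E)) :=
  [set A | exists n C, (forall k, measurable (C k)) /\ A = cylinder n C].

Definition block_space : Type := g_sigma_algebraType cylinders.
HB.instance Definition _ := Measurable.on block_space.

Lemma measurable_cylinder n C : (forall k, measurable (C k)) ->
  measurable (cylinder n C : set block_space).
Proof. by move=> mC; apply: sub_sigma_algebra; exists n, C. Qed.

(** Cylinders of different lengths are disjoint, and the empty set must itself be presented as a
    cylinder: length one with an empty coordinate set. *)
Lemma cylinders_setI : setI_closed cylinders.
Proof.
move=> _ _ [n [C [mC ->]]] [n' [C' [mC' ->]]].
have [<-|nn'] := eqVneq n n'.
  exists n, (fun k => C k `&` C' k); split.
    by move=> k; exact: measurableI.
  apply/seteqP; split => [s [[sn h] [_ h']]|s [sn h]].
    by split => // k kn; split; [exact: h|exact: h'].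
  by split; split => // k kn; have [] := h k kn.
exists 1%N, (fun=> set0); split; first by move=> _; exact: measurable0.
apply/seteqP; split => [s [[sn _] [sn' _]]|s [_ h]].
  by move: nn'; rewrite -sn -sn' eqxx.
by have := h 0%N isT.
Qed.

Lemma measurable_size (U : set nat) :
  measurable ([set s | U (size s)] : set block_space).
Proof.
rewrite (_ : [set s | _] = \bigcup_(n in U) cylinder n (fun=> setT)); last first.
  apply/seteqP; split => [s Us|s]; first by exists (size s).
  by case=> n Un; case=> sn _; rewrite /= sn.
by apply: bigcup_measurable => n _; exact: measurable_cylinder.
Qed.

Lemma measurable_nth (k : nat) :
  measurable_fun setT ((fun s : seq E => nth point s k) : block_space -> E).
Proof.
move=> _ U mU; rewrite setTI.
rewrite (_ : _ @^-1` _ =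
    (\bigcup_(n in [set n | (k < n)%N]) cylinder n (fun j => if j == k then U else setT)) `|`
    ([set s | (size s <= k)%N] `&` [set _ | U point])); last first.
  apply/seteqP; split => [s /= Us|s /=].
    case: (ltnP k (size s)) => ks; [left|right].
      by exists (size s) => //; split => // j js; case: eqP => [->|//].
    by split => //=; rewrite -(nth_default point ks).
  case=> [[n /= kn [sn h]]|[sk Up]].
    by have := h k kn; rewrite eqxx.
  by rewrite nth_default.
apply: measurableU.
  by apply: bigcup_measurable => n _; apply: measurable_cylinder => j; case: ifP.
apply: measurableI; first exact: (measurable_size [set n | (n <= k)%N]).
case: (pselect (U point)) => Up.
  by rewrite (_ : [set _ | _] = setT)//; apply/seteqP; split.
by rewrite (_ : [set _ | _] = set0)//; apply/seteqP; split.
Qed.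

(** The lengths give a countable measurable partition, and on each piece the sum has a fixed number
    of measurable terms. *)
Lemma measurable_block_sum (f : E -> R) : measurable_fun setT f ->
  measurable_fun setT (block_sum f : block_space -> R).
Proof.
move=> mf.
have bsE (s : seq E) : block_sum f s = \sum_(k < size s) f (nth point s k).
  by rewrite /block_sum (big_nth point) big_mkord.
pose S (n : nat) : set block_space := [set s | size s = n].
rewrite (_ : setT = \bigcup_n S n); last first.
  by apply/seteqP; split => // s _; exists (size s).
apply/measurable_fun_bigcup => [n|n]; first exact: (measurable_size [set n]).
apply: (@eq_measurable_fun _ _ _ _ _ (fun s : block_space => \sum_(k < n) f (nth point s k))).
  by move=> s /[!inE] /= sn; rewrite bsE -sn.
apply: measurable_sum => k; apply: measurable_funTS.
exact: (measurableT_comp mf (measurable_nth k)).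
Qed.

End block_space.

(** * Regeneration times *)

Section first_regeneration.
Implicit Types (y : nat -> bool).

Lemma first_regeneration_fromE y s t : (s <= t)%N -> y t ->
  (forall u, (s <= u < t)%N -> ~~ y u) -> first_regeneration_from y s = t.
Proof.
move=> st yt h; rewrite /first_regeneration_from; case: pselect => [ex|]; last first.
  by case; exists t; rewrite st.
case: ex_minnP => u /andP[su yu] umin; apply/eqP; rewrite eqn_leq umin ?st// andTb.
by rewrite leqNgt; apply/negP => ut; have := h u; rewrite su ut yu => /(_ isT).
Qed.

Lemma first_regeneration_from_none y s : (forall t, (s <= t)%N -> ~~ y t) ->
  first_regeneration_from y s = 0%N.
Proof.
move=> h; rewrite /first_regeneration_from; case: pselect => // ex.
exfalso; case: ex => t /andP[st yt]; by have := h t st; rewrite yt.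
Qed.

Lemma first_regeneration_from_ex y s t : (s <= t)%N -> y t ->
  [/\ (s <= first_regeneration_from y s)%N, y (first_regeneration_from y s) &
    forall u, (s <= u < first_regeneration_from y s)%N -> ~~ y u].
Proof.
move=> st yt; rewrite /first_regeneration_from; case: pselect => [ex|]; last first.
  by case; exists t; rewrite st.
case: ex_minnP => u /andP[su yu] umin; split => // u' /andP[su' u'u].
by apply/negP => yu'; have := umin u'; rewrite su' yu' leqNgt u'u => /(_ isT).
Qed.

Definition regen_count y (s : nat) : nat := \sum_(u < s) y u.

Lemma regen_countS y s : regen_count y s.+1 = (regen_count y s + y s)%N.
Proof. by rewrite /regen_count big_ord_recr. Qed.

Lemma regen_count_le y s t : (s <= t)%N -> (regen_count y s <= regen_count y t)%N.
Proof.
move=> /subnK<-; elim: (t - s)%N => [//|k IH].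
by rewrite addSn regen_countS (leq_trans IH)// leq_addr.
Qed.

Lemma regen_count_ex y j s : (j < regen_count y s)%N ->
  exists u, [/\ (u < s)%N, y u & regen_count y u = j].
Proof.
elim: s => [|s IH]; first by rewrite /regen_count big_ord0.
rewrite regen_countS; case: (ltnP j (regen_count y s)) => [/IH[u [us yu cu]] _|cj].
  by exists u; split => //; exact: ltnW.
case: (boolP (y s)) => ys; last by rewrite addn0 ltnNge cj.
rewrite addn1 ltnS => jc; exists s; split => //.
by apply/eqP; rewrite eqn_leq cj jc.
Qed.

Lemma regen_count_inj y s t : y s -> y t -> regen_count y s = regen_count y t ->
  s = t.
Proof.
move=> ys yt; wlog st : s t ys yt / (s < t)%N.
  move=> H; case: (ltngtP s t) => // st e; [exact: H|exact/esym/H].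
have := regen_count_le y st; rewrite regen_countS ys addn1 => h e.
by move: h; rewrite e ltnn.
Qed.

Lemma regen_count_between y s t : y s -> (forall u, (s < u < t)%N -> ~~ y u) ->
  (s < t)%N -> regen_count y t = (regen_count y s).+1.
Proof.
move=> ys; elim: t => // t IH h; rewrite ltnS leq_eqVlt => /orP[/eqP<-|st].
  by rewrite regen_countS ys addn1.
rewrite regen_countS IH// => [|u /andP[su ut]]; last first.
  by apply: h; rewrite su ltnW.
by have := h t; rewrite st ltnSn => /(_ isT) /negbTE->; rewrite addn0.
Qed.

End first_regeneration.

Section blocks.
Context d (E : measurableType d) (R : realType) d' (Om : measurableType d').
Variables (X : nat -> {mfun Om >-> E}) (Y : nat -> {mfun Om >-> bool}) (m : nat).

Definition segment (s1 s2 : nat) (w : Om) : seq E :=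
  [seq X k w | k <- index_iota (m * s1.+1) (m * s2.+1)].

(** The source sigma-algebra is left arbitrary because [decided_block] uses the lemma for the
    sigma-algebra of a finite past. *)
Lemma measurable_map_iota d0 (T : measurableType d0) (x : nat -> T -> E) (a b : nat) :
  (forall k, (k < b)%N -> measurable_fun setT (x k)) ->
  measurable_fun setT
    ((fun w => [seq x k w | k <- index_iota a b]) : T -> block_space E).
Proof.
move=> mx; apply: (@measurability _ _ T (block_space E) setT _
  (@cylinders _ E : set (set (block_space E)))) => //.
move=> _ [_ [n [C [mC ->]]] <-]; rewrite setTI.
have [nE|nE] := eqVneq (b - a)%N n; last first.
  rewrite (_ : _ @^-1` _ = set0)//; apply/seteqP; split => // w [/= + _].
  by rewrite size_map size_iota => /eqP; rewrite (negbTE nE).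
rewrite (_ : _ @^-1` _ = \bigcap_(k in `I_n) (x (a + k)%N @^-1` C k)).
  apply: fin_bigcap_measurable => // k /= kn.
  rewrite -[X in measurable X]setTI; apply: mx => //.
  by rewrite -nE ltn_subRL in kn.
apply/seteqP; split => w /=.
  move=> [_ h] k /= kn; have := h k kn.
  by rewrite (nth_map 0%N) ?size_iota ?nE// nth_iota ?nE.
move=> h; split; first by rewrite size_map size_iota.
move=> k kn; rewrite (nth_map 0%N) ?size_iota ?nE// nth_iota ?nE//.
exact: (h k kn).
Qed.

Lemma measurable_regeneration i t :
  measurable [set w | regeneration Y i w = t].
Proof.
have frf s u : measurable [set w | first_regeneration_from (fun t => Y t w) s = u].
  have mY k b : measurable [set w | Y k w = b].
    by rewrite -[X in measurable X]setTI; exact: (measurable_funPT (Y k) measurableT [set b]).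
  (* The second alternative accounts for the default value 0, taken when no regeneration occurs from
     [s] on. *)
  rewrite (_ : [set w | _] =
    ([set w | Y u w = true] `&` (\bigcap_(k in [set k | (s <= k < u)%N]) [set w | Y k w = false]) `&` [set _ | (s <= u)%N])
    `|` ((\bigcap_(k in [set k | (s <= k)%N]) [set w | Y k w = false]) `&` [set _ | u = 0%N])); last first.
    apply/seteqP; split => w /=.
      move=> fE; case: (pselect (exists k, (s <= k)%N && Y k w)) => [[k /andP[sk yk]]|no].
        left; have [h1 h2 h3] := first_regeneration_from_ex (y := fun t => Y t w) sk yk.
        rewrite fE in h1 h2 h3; split => //; split => // j /= /h3.
        exact: negbTE.
      right; have no' k : (s <= k)%N -> ~~ Y k w.
        by move=> sk; apply/negP => yk; apply: no; exists k; rewrite sk.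
      split; first by move=> k /= /no' /negbTE.
      by rewrite -fE; exact: first_regeneration_from_none.
    case=> [[[yu h] su]|[h ->]].
      by apply: first_regeneration_fromE => // k /h /= ->.
    by apply: first_regeneration_from_none => k /h /= ->.
  have mcst (Q : Prop) : measurable ([set _ | Q] : set Om).
    case: (pselect Q) => q.
      by rewrite (_ : [set _ | _] = setT)//; apply/seteqP; split.
    by rewrite (_ : [set _ | _] = set0)//; apply/seteqP; split.
  apply: measurableU; apply: measurableI => //.
    apply: measurableI => //; apply: bigcap_measurableType => k _; exact: mY.
  by apply: bigcap_measurableType => k _; exact: mY.
elim: i t => [|i IH] t /=; first exact: frf.
rewrite (_ : [set w | _] = \bigcup_s ([set w | regeneration Y i w = s] `&`
   [set w | first_regeneration_from (fun t => Y t w) s.+1 = t])).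
  by apply: bigcup_measurable => s _; apply: measurableI.
apply/seteqP; split => w /=; first by move=> h; exists (regeneration Y i w).
by case=> s _ [/= ->].
Qed.

Lemma measurable_block i : measurable_fun setT (block X Y m i : Om -> block_space E).
Proof.
pose D s t := [set w | regeneration Y i.-1 w = s] `&` [set w | regeneration Y i w = t].
have mD s t : measurable (D s t) by apply: measurableI; exact: measurable_regeneration.
rewrite (_ : setT = \bigcup_s \bigcup_t D s t); last first.
  apply/seteqP; split => // w _; exists (regeneration Y i.-1 w) => //.
  by exists (regeneration Y i w).
apply/measurable_fun_bigcup => [s|s]; first exact: bigcup_measurable.
apply/measurable_fun_bigcup => // t.
apply: (@eq_measurable_fun _ _ _ (block_space E) _ (segment s t)).
  by move=> w /[!inE] -[/= sE tE]; rewrite /block sE tE.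
by apply: measurable_funTS; apply: measurable_map_iota => k _.
Qed.

(** The event that [s] is the regeneration number [i], counted from 0. It depends only on [Y] up to
    time [s] and, unlike [regeneration Y i w = s], never holds through a default value. *)
Definition regen_at (i s : nat) : set Om :=
  [set w | Y s w && (regen_count (Y^~ w) s == i)].

Lemma regeneration_regen_at i s w : regen_at i s w -> regeneration Y i w = s.
Proof.
elim: i s => [|i IH] s /andP[ys /eqP cs] /=.
  apply: first_regeneration_fromE => // u /andP[_ us].
  apply/negP => yu; have := regen_count_le (Y^~ w) us.
  by rewrite regen_countS yu cs addn1.
have [s' [s's ys' cs']] : exists u, [/\ (u < s)%N, Y u w & regen_count (Y^~ w) u = i].
  by apply: regen_count_ex; rewrite cs.
rewrite (IH s'); last by rewrite /regen_at/= ys' cs' eqxx.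
apply: first_regeneration_fromE => // u /andP[s'u us]; apply/negP => yu.
have := regen_count_le (Y^~ w) us; rewrite regen_countS yu cs addn1.
have := regen_count_le (Y^~ w) s'u; rewrite regen_countS ys' cs' addn1.
by move=> h1 h2; have := leq_ltn_trans h1 h2; rewrite ltnn.
Qed.

End blocks.

(** * Events decided before a regeneration *)

Section past_events.
Context d (E : measurableType d) (R : realType) d' (Om : measurableType d').
Variables (X : nat -> {mfun Om >-> E}) (Y : nat -> {mfun Om >-> bool}) (m : nat).

(** Generates the conditioning sigma-algebra of [split_chain] at skeleton time [t]: it contains
    $X_{tm}$ but not $Y_t$. *)
Definition split_past (t : nat) : set (set Om) := past X (t * m).+1 `|` past Y t.

Let FT t := g_sigma_algebraType (split_past t).

Lemma split_past_X t k : (k <= t * m)%N -> measurable_fun setT (X k : FT t -> E).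
Proof.
move=> kt _ U mU; apply: sub_sigma_algebra; left; exists k => //.
by exists U.
Qed.

Lemma split_past_Y t k : (k < t)%N -> measurable_fun setT (Y k : FT t -> bool).
Proof.
move=> kt _ U mU; apply: sub_sigma_algebra; right; exists k => //.
by exists U.
Qed.

Lemma split_past_measurable t : <<s split_past t >> `<=` measurable.
Proof.
apply: smallest_sub; first exact: sigma_algebra_measurable.
by move=> A [[k _ [U mU <-]]|[k _ [U mU <-]]]; exact: measurable_funPT.
Qed.

Lemma split_past_mono s t : (s <= t)%N -> <<s split_past s >> `<=` <<s split_past t >>.
Proof.
move=> st; apply: smallest_sub; first exact: smallest_sigma_algebra.
move=> A [[k ks [U mU <-]]|[k ks [U mU <-]]]; apply: sub_sigma_algebra; [left|right].
  exists k; last by exists U.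
  by apply: leq_trans ks _; rewrite ltnS leq_mul2r st orbT.
by exists k; [exact: leq_trans ks st|exists U].
Qed.

Lemma split_past_regen_count t i s : (s <= t)%N ->
  <<s split_past t >> [set w | regen_count (Y^~ w) s == i].
Proof.
move=> st; change (measurable ([set w | regen_count (Y^~ w) s == i] : set (FT t))).
elim: s st i => [|s IH] st i.
  rewrite (_ : [set w | _] = [set _ | 0%N == i]); last first.
    by apply/seteqP; split => w; rewrite /regen_count /= big_ord0.
  case: eqP => _.
    by rewrite (_ : [set _ | _] = setT)//; apply/seteqP; split.
  by rewrite (_ : [set _ | _] = set0)//; apply/seteqP; split.
have mY b : measurable ([set w | Y s w = b] : set (FT t)).
  rewrite -[X in measurable X]setTI.
  have mb : measurable [set b] by [].
  exact: (split_past_Y st measurableT mb).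
rewrite (_ : [set w | _] =
  ([set w | regen_count (Y^~ w) s == i] `&` [set w | Y s w = false]) `|`
  (if i is i'.+1 then [set w | regen_count (Y^~ w) s == i'] `&` [set w | Y s w = true]
   else set0)); last first.
  apply/seteqP; split => w /=; rewrite regen_countS.
    case Ys : (Y s w) => h; [right|left]; last by rewrite addn0 in h.
    by case: i h => [|i]; rewrite addn1 ?eqSS.
  case=> [[h ->]|]; first by rewrite addn0.
  by case: i => [//|i] [/= h ->]; rewrite addn1 eqSS.
apply: measurableU; first by apply: measurableI => //; apply: IH; exact: ltnW.
case: i => [//|i]; apply: measurableI => //; apply: IH; exact: ltnW.
Qed.

Lemma split_past_regen_at t i s : (s < t)%N -> <<s split_past t >> (regen_at Y i s).
Proof.
move=> st; rewrite (_ : regen_at Y i s =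
    [set w | Y s w = true] `&` [set w | regen_count (Y^~ w) s == i]); last first.
  by apply/seteqP; split => w; [move=> /andP[]|move=> [/= ? ?]; apply/andP].
apply: (@measurableI _ (FT t)); last by apply: split_past_regen_count; exact: ltnW.
rewrite -[X in measurable X]setTI.
have mT : measurable [set true] by [].
exact: (split_past_Y st measurableT mT).
Qed.

Lemma measurable_regen_at i s : measurable (regen_at Y i s).
Proof. exact: (split_past_measurable (split_past_regen_at i (ltnSn s))). Qed.

(* [G] is decided by the trajectory before the [i]-th regeneration time [s]:
   by X up to time [s * m] and by Y before time [s]. *)
Definition decided_before (i : nat) (G : set Om) : Prop :=
  forall s, exists2 Gs, <<s split_past s >> Gs &
    G `&` regen_at Y i s = Gs `&` [set w | Y s w = true].

Lemma decided_setT i : decided_before i setT.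
Proof.
move=> s; exists [set w | regen_count (Y^~ w) s == i].
  exact: split_past_regen_count.
rewrite setTI; apply/seteqP; split => w; first by move=> /andP[].
by move=> [/= ? ?]; apply/andP.
Qed.

Lemma decided_setI i G H : decided_before i G -> decided_before i H ->
  decided_before i (G `&` H).
Proof.
move=> dG dH s; have [Gs mGs GE] := dG s; have [Hs mHs HE] := dH s.
exists (Gs `&` Hs); first exact: (@measurableI _ (FT s)).
by rewrite -[in LHS](setIid (regen_at Y i s)) setIACA GE HE setIACA setIid.
Qed.

Lemma decided_regen_at i s : decided_before i (regen_at Y i s).
Proof.
move=> t; have [->|ts] := eqVneq t s.
  have [Gs mGs GE] := decided_setT i s; exists Gs => //.
  by rewrite -GE setTI setIid.
exists set0; first exact: (@measurable0 _ (FT t)).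
rewrite set0I; apply/seteqP; split => // w [hs ht].
move/eqP: ts; apply.
by rewrite -(regeneration_regen_at hs) -(regeneration_regen_at ht).
Qed.

(** Block [j] ends just before time $m(\sigma(j)+1)$, where $\sigma(j)$ is the regeneration time
    number [j]. If [j < i] then $\sigma(j)+1\le s$, so only [X] up to [s * m] and [Y] before [s]
    matter. Block [i] itself runs beyond [s * m] when $m>1$, which is the source of
    one-dependence. *)
Lemma decided_block i j (D : set (block_space E)) : (0 < j)%N -> (j < i)%N ->
  measurable D -> decided_before i (block X Y m j @^-1` D).
Proof.
move=> j0 ji mD s.
exists ((\bigcup_(s1 in `I_s) \bigcup_(s2 in `I_s)
   (regen_at Y j.-1 s1 `&` regen_at Y j s2 `&` segment X m s1 s2 @^-1` D)) `&`
   [set w | regen_count (Y^~ w) s == i]).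
  apply: (@measurableI _ (FT s)); last exact: split_past_regen_count.
  apply: bigcup_measurable => s1 /= s1s; apply: bigcup_measurable => s2 /= s2s.
  apply: (@measurableI _ (FT s)).
    by apply: (@measurableI _ (FT s)); exact: split_past_regen_at.
  rewrite -[X in measurable X]setTI.
  apply: (measurable_map_iota (T := FT s)) => // k k2; apply: split_past_X.
  by rewrite mulnC; apply: ltnW (leq_trans k2 _); rewrite leq_mul2l s2s orbT.
have blockE s1 s2 w : regen_at Y j.-1 s1 w -> regen_at Y j s2 w ->
    block X Y m j w = segment X m s1 s2 w.
  by move=> h1 h2; rewrite /block (regeneration_regen_at h1) (regeneration_regen_at h2).
apply/seteqP; split => w.
  move=> [/= Dw /andP[ys /eqP cs]]; split => //; split; last exact/eqP.
  have [s2 [s2s y2 c2]] : exists u, [/\ (u < s)%N, Y u w & regen_count (Y^~ w) u = j].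
    by apply: regen_count_ex; rewrite cs.
  have [s1 [s1s y1 c1]] : exists u, [/\ (u < s)%N, Y u w & regen_count (Y^~ w) u = j.-1].
    by apply: regen_count_ex; rewrite cs (leq_ltn_trans (leq_pred j)).
  have r1 : regen_at Y j.-1 s1 w by rewrite /regen_at /= y1 c1 eqxx.
  have r2 : regen_at Y j s2 w by rewrite /regen_at /= y2 c2 eqxx.
  exists s1 => //; exists s2 => //; split; first by split.
  by rewrite /= -(blockE _ _ _ r1 r2).
move=> [[[s1 _ [s2 _ [[r1 r2] /= Dw]]] cs] ys]; split; last by apply/andP.
by rewrite /= (blockE _ _ _ r1 r2).
Qed.

End past_events.

(** * Integrals against mixtures of measures *)

Section integral_of_mixtures.
Context d d' (T : measurableType d) (E : measurableType d') (R : realType).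
Local Open Scope ereal_scope.
Import HBNNSimple.

(** True for indicators by the assumption on [mk], hence for simple functions, and in general by
    monotone convergence. It serves for powers of kernels, for laws of the chain and for image
    measures. *)
Lemma ge0_integral_bind (mu : {measure set T -> \bar R}) (D : set T)
    (k : T -> {measure set E -> \bar R}) (mk : {measure set E -> \bar R})
    (f : E -> \bar R) :
  measurable D ->
  (forall U, measurable U -> measurable_fun setT (k ^~ U)) ->
  (forall U, measurable U -> mk U = \int[mu]_(w in D) k w U) ->
  measurable_fun setT f -> (forall x, 0 <= f x) ->
  \int[mk]_x f x = \int[mu]_(w in D) \int[k w]_x f x.
Proof.
move=> mD mkU mkE mf f0.
pose f_ := nnsfun_approx measurableT mf.
have ndf : nondecreasing_seq (f_ : (E -> R)^nat) by exact: nd_nnsfun_approx.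
have ndx x : nondecreasing_seq (f_ ^~ x) by move=> a b ab; exact/lefP/ndf.
have f_f x : EFin \o f_ ^~ x @ \oo --> f x.
  by apply: (cvg_nnsfun_approx measurableT mf) => //.
have simple n : sintegral mk (f_ n) = \int[mu]_(w in D) sintegral (k w) (f_ n).
  under eq_integral do rewrite sintegralE.
  rewrite ge0_integral_fsum//.
  - rewrite sintegralE; apply: eq_fsbigr => r _.
    have [r0|r0] := leP 0%R r.
      rewrite mkE// ge0_integralZl//.
      by apply: measurable_funTS; exact: mkU.
    rewrite integral0_eq => [|w _]; last by rewrite preimage_nnfun0// measure0 mule0.
    by rewrite preimage_nnfun0// measure0 mule0.
  - move=> r; apply: measurable_funeM; apply: measurable_funTS; exact: mkU.
  - move=> r w _; have [r0|r0] := leP 0%R r; first by rewrite mule_ge0.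
    by rewrite preimage_nnfun0// measure0 mule0.
have msint n : measurable_fun D (fun w => sintegral (k w) (f_ n)).
  apply: measurable_funTS; under eq_fun do rewrite sintegralE.
  apply: emeasurable_fsum => // r; apply: measurable_funeM; exact: mkU.
rewrite (nd_ge0_integral_lim _ f0 ndx f_f).
under [in RHS]eq_integral do rewrite (nd_ge0_integral_lim _ f0 ndx f_f).
rewrite monotone_convergence//.
- by congr (limn _); apply/funext => n /=; exact: simple.
- by move=> n w _; exact: sintegral_ge0.
- by move=> w _ a b ab; apply: le_sintegral => x; exact/lefP/ndf.
Qed.

Lemma ge0_le_integral_measure (m1 m2 : {measure set E -> \bar R}) (f : E -> \bar R) :
  (forall U, measurable U -> m1 U <= m2 U) ->
  measurable_fun setT f -> (forall x, 0 <= f x) ->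
  \int[m1]_x f x <= \int[m2]_x f x.
Proof.
move=> m12 mf f0; pose f_ := nnsfun_approx measurableT mf.
have ndf : nondecreasing_seq (f_ : (E -> R)^nat) by exact: nd_nnsfun_approx.
have ndx x : nondecreasing_seq (f_ ^~ x) by move=> a b ab; exact/lefP/ndf.
have f_f x : EFin \o f_ ^~ x @ \oo --> f x.
  by apply: (cvg_nnsfun_approx measurableT mf) => //.
rewrite !(nd_ge0_integral_lim _ f0 ndx f_f).
have nds (mu : {measure set E -> \bar R}) : nondecreasing_seq (sintegral mu \o f_).
  by move=> a b ab; apply: le_sintegral => x; exact/lefP/ndf.
apply: lee_lim; try exact: ereal_nondecreasing_is_cvgn.
apply: nearW => n /=; rewrite !sintegralE; apply: lee_fsum => // r _.
have [r0|r0] := leP 0%R r; first by apply: lee_wpmul2l => //; exact: m12.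
by rewrite preimage_nnfun0// !measure0.
Qed.

End integral_of_mixtures.

(** * The split chain *)

Section path_integrals.
Context d (E : measurableType d) (R : realType) (P : R.-pker E ~> E).
Local Open Scope ereal_scope.

Lemma path_integralS n C (h : E -> \bar R) x : path_integral P n.+1 C h x =
  \int[P x]_(y in C 0%N) path_integral P n (fun j => C j.+1) h y.
Proof. by []. Qed.

Lemma path_integral_ge0 n C (h : E -> \bar R) x : (forall y, 0 <= h y) ->
  0 <= path_integral P n C h x.
Proof.
move=> h0; elim: n C x => [|n IH] C x //=.
by apply: integral_ge0 => y _; exact: IH.
Qed.

(** The first component of the pair is a frozen parameter: in [split_chain] the terminal integrand
    [r (x, y)] still depends on the starting point [x] of the path. *)
Lemma measurable_path_integral n C (h : E * E -> \bar R) :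
  (forall k, measurable (C k)) -> measurable_fun setT h -> (forall z, 0 <= h z) ->
  measurable_fun setT
    (fun zx : E * E => path_integral P n C (fun y => h (zx.1, y)) zx.2).
Proof.
move=> mC mh h0; elim: n C mC => [|n IH] C mC /=.
  by rewrite (_ : (fun zx => _) = h)//; apply/funext => -[].
pose g (zy : E * E) := path_integral P n (fun j => C j.+1) (fun y => h (zy.1, y)) zy.2.
have mg : measurable_fun setT g by exact: IH.
pose k (w : (E * E) * E) := g (w.1.1, w.2) * (\1_(C 0%N) w.2)%:E.
pose l : R.-fker (E * E)%type ~> E := kernel.kernel_snd P.
rewrite (_ : (fun zx => _) = (fun zx => \int[l zx]_y k (zx, y))).
  apply: measurable_fun_integral_finite_kernel.
    by move=> [[z x] y]; rewrite mule_ge0// ?lee_fin//; exact: path_integral_ge0.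
  apply: emeasurable_funM.
    apply: (measurableT_comp mg).
    apply/measurable_fun_pairP; split; last exact: measurable_snd.
    exact: (measurableT_comp measurable_fst measurable_fst).
  have m1 : measurable_fun setT (EFin \o (\1_(C 0%N) : E -> R)).
    by apply/measurable_EFinP; exact: measurable_indic.
  have ms : measurable_fun setT (snd : (E * E) * E -> E) by exact: measurable_snd.
  exact: (measurableT_comp m1 ms).
apply/funext => -[z x]; rewrite /= integral_mkcond; apply: eq_integral => y _.
by rewrite patchE /k indicE; case: ifP => _; rewrite ?mule1 ?mule0.
Qed.

Lemma measurable_path_integral_cst n C (h : E -> \bar R) :
  (forall k, measurable (C k)) -> measurable_fun setT h -> (forall z, 0 <= h z) ->
  measurable_fun setT (path_integral P n C h).
Proof.
move=> mC mh h0.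
have mhs : measurable_fun setT (h \o snd : E * E -> \bar R).
  by apply: measurableT_comp => //; exact: measurable_snd.
have h0s (z : E * E) : 0 <= (h \o snd) z by exact: h0.
have mp := measurable_path_integral n mC mhs h0s.
have md : measurable_fun setT (fun x : E => (x, x)) by apply/measurable_fun_pairP; split; exact: measurable_id.
exact: (measurableT_comp mp md).
Qed.

Lemma kernel_powS n x U : kernel_pow P n.+1 x U = \int[P x]_y kernel_pow P n y U.
Proof. by []. Qed.

Lemma kernel_pow_setT n x : kernel_pow P n x setT = 1.
Proof.
elim: n x => [|n IH] x; first by rewrite /= diracT.
rewrite kernel_powS; under eq_integral do rewrite IH.
by rewrite integral_cst// mul1e prob_kernel.
Qed.

Lemma integral_kernel_powS n x (h : E -> \bar R) : measurable_fun setT h ->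
  (forall y, 0 <= h y) ->
  \int[kernel_pow P n.+1 x]_y h y = \int[P x]_y \int[kernel_pow P n y]_z h z.
Proof.
move=> mh h0; apply: ge0_integral_bind => //.
by move=> U mU; exact: measurable_kernel.
Qed.

Lemma kernel_powSr n x U : measurable U ->
  kernel_pow P n.+1 x U = \int[kernel_pow P n x]_y P y U.
Proof.
move=> mU; have mP : measurable_fun setT (fun y => P y U) by exact: measurable_kernel.
elim: n x => [|n IH] x.
  rewrite kernel_powS /= integral_dirac// diracT mul1e.
  under eq_integral do rewrite /kdirac diracE -indicE.
  by rewrite integral_indic// setIT.
rewrite kernel_powS; under eq_integral do rewrite IH.
by rewrite integral_kernel_powS.
Qed.

Lemma path_integral_setT n (h : E -> \bar R) x : measurable_fun setT h ->
  (forall y, 0 <= h y) ->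
  path_integral P n (fun=> setT) h x = \int[kernel_pow P n x]_y h y.
Proof.
move=> mh h0; elim: n x => [|n IH] x /=.
  by rewrite integral_dirac// diracT mul1e.
by under eq_integral do rewrite IH; rewrite -integral_kernel_powS.
Qed.

(** Constraining a single coordinate turns path integrals into powers of the kernel, so that the
    clauses of [split_chain] yield the law of one variable. *)
Definition at_coordinate (i : nat) (U : set E) : nat -> set E :=
  fun j => if j == i then U else setT.

Lemma measurable_at_coordinate i U k : measurable U -> measurable (at_coordinate i U k).
Proof. by rewrite /at_coordinate; case: ifP. Qed.

Lemma at_coordinateS i U : (fun j => at_coordinate i.+1 U j.+1) = at_coordinate i U.
Proof. by apply/funext. Qed.

Lemma at_coordinate0 U : (fun j => at_coordinate 0 U j.+1) = fun=> setT.
Proof. by apply/funext. Qed.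

Lemma path_integral_last n U (h : E -> \bar R) x : measurable U ->
  measurable_fun setT h -> (forall y, 0 <= h y) ->
  path_integral P n.+1 (at_coordinate n U) h x =
  \int[kernel_pow P n.+1 x]_(y in U) h y.
Proof.
move=> mU mh h0; rewrite integral_mkcond.
have mhU : measurable_fun setT (h \_ U).
  by apply/(measurable_restrictT _ mU); exact: measurable_funTS.
have hU0 y : 0 <= (h \_ U) y by apply: erestrict_ge0.
elim: n x => [|n IH] x.
  rewrite integral_kernel_powS//= integral_mkcond.
  by apply: eq_integral => y _; rewrite integral_dirac// diracT mul1e.
rewrite integral_kernel_powS// path_integralS at_coordinateS.
by apply: eq_integral => y _; exact: IH.
Qed.

Lemma path_integral_coordinate n i U x : measurable U -> (i < n)%N ->
  path_integral P n (at_coordinate i U) (cst 1) x = kernel_pow P i.+1 x U.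
Proof.
move=> mU; elim: n i x => // n IH [|i] x; rewrite ?ltnS => lin /=.
  rewrite at_coordinate0.
  transitivity (\int[P x]_(y in U) (cst 1) y).
    apply: eq_integral => y _; rewrite path_integral_setT//.
    by rewrite integral_cst// mul1e kernel_pow_setT.
  rewrite integral_cst// mul1e -[RHS]/(kernel_pow P 1 x U) kernel_powSr//.
  by rewrite /= integral_dirac ?diracT ?mul1e//; exact: measurable_kernel.
rewrite at_coordinateS -[RHS]/(kernel_pow P i.+2 x U) kernel_powS.
by apply: eq_integral => y _; exact: IH.
Qed.

End path_integrals.

(** * One skeleton step of the split chain *)

Section split_chain_steps.
Context d (E : measurableType d) (R : realType) (P : R.-pker E ~> E).
Context (init nu : probability E R) (m : nat) (S : set E) (theta : R) (r : E * E -> R).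
Context d' (Om : measurableType d') (Pr : probability Om R).
Context (X : nat -> {mfun Om >-> E}) (Y : nat -> {mfun Om >-> bool}).
Hypotheses (m1 : (1 <= m)%N) (minor : minorization P m S nu theta)
  (dens : minorization_density P m S nu r)
  (split : split_chain Pr X Y P init m S theta r).
Local Open Scope ereal_scope.

Local Notation SP := (split_past X Y m).
Local Notation FT t := (g_sigma_algebraType (SP t)).

Let mX k U : measurable U -> measurable (X k @^-1` U).
Proof. by move=> mU; exact: measurable_funPTI. Qed.

Let mYb k b : measurable [set w | Y k w = b].
Proof. exact: (measurable_funPTI (Y k) (_ : measurable [set b])). Qed.

Let SPm t H : <<s SP t>> H -> measurable H.
Proof. exact: split_past_measurable. Qed.

Let SPX t k U : (k <= t * m)%N -> measurable U -> <<s SP t>> (X k @^-1` U).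
Proof.
move=> kt mU; rewrite -[X in <<s _>> X]setTI.
exact: (split_past_X (Y := Y) kt measurableT mU).
Qed.

Let SPY t k b : (k < t)%N -> <<s SP t>> [set w | Y k w = b].
Proof.
move=> kt; rewrite -[X in <<s _>> X]setTI.
have mb : measurable [set b] by [].
exact: (split_past_Y (X := X) (m := m) kt measurableT mb).
Qed.

Let SPI t A B : <<s SP t>> A -> <<s SP t>> B -> <<s SP t>> (A `&` B).
Proof. exact: (@measurableI _ (FT t)). Qed.

Lemma integral_law k H (f : E -> \bar R) (mu : {measure set E -> \bar R}) :
  measurable H -> (forall U, measurable U -> mu U = Pr (H `&` X k @^-1` U)) ->
  measurable_fun setT f -> (forall x, 0 <= f x) ->
  \int[mu]_x f x = \int[Pr]_(w in H) f (X k w).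
Proof.
move=> mH muE mf f0.
rewrite (@ge0_integral_bind _ _ _ _ _ Pr H (fun w => dirac (X k w)) mu f)//.
- by apply: eq_integral => w _; rewrite integral_dirac// diracT mul1e.
- move=> U mU; rewrite (_ : (fun w => _) = EFin \o (\1_U \o X k)).
    by apply/measurable_EFinP; apply: measurableT_comp.
  by apply/funext => w /=; rewrite diracE indicE.
- move=> U mU; rewrite muE//.
  rewrite (eq_integral (fun w => (\1_(X k @^-1` U) w)%:E)); last first.
    by move=> w _; rewrite /= diracE indicE.
  by rewrite (integral_indic Pr mH (mX k mU)) setIC.
Qed.

Definition law k H (mH : measurable H) : {measure set E -> \bar R} :=
  measure_function_pushforward__canonical__measure_function_Measure
    (mrestr Pr mH) (@measurable_funPT _ _ _ _ (X k)).

Lemma lawE k H (mH : measurable H) U : law k mH U = Pr (H `&` X k @^-1` U).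
Proof. by rewrite /law /= /pushforward /mrestr setIC. Qed.

(** Proportionality of laws is kept in cross-multiplied form here and in the renewal argument, so
    that no conditioning on a possibly null event occurs. *)
Lemma proportional_integral (c1 c2 : R) k1 k2 H1 H2 (f : E -> \bar R) :
  (0 <= c1)%R -> (0 <= c2)%R -> measurable H1 -> measurable H2 ->
  (forall U, measurable U ->
     c2%:E * Pr (H1 `&` X k1 @^-1` U) = c1%:E * Pr (H2 `&` X k2 @^-1` U)) ->
  measurable_fun setT f -> (forall x, 0 <= f x) ->
  c2%:E * \int[Pr]_(w in H1) f (X k1 w) = c1%:E * \int[Pr]_(w in H2) f (X k2 w).
Proof.
move=> c10 c20 mH1 mH2 H12 mf f0.
rewrite -(integral_law mH1 (mu := law k1 mH1))//; last by move=> U _; exact: lawE.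
rewrite -(integral_law mH2 (mu := law k2 mH2))//; last by move=> U _; exact: lawE.
rewrite -(ge0_integral_mscale (law k1 mH1) measurableT (NngNum c20) mf)//.
rewrite -(ge0_integral_mscale (law k2 mH2) measurableT (NngNum c10) mf)//.
apply: eq_measure_integral => U mU _.
change (c2%:E * law k1 mH1 U = c1%:E * law k2 mH2 U).
by rewrite !lawE H12.
Qed.

Let mr : measurable_fun setT (fun z : E * E => (r z)%:E).
Proof. by have [mr _ _] := dens; exact/measurable_EFinP. Qed.

Let r0 z : 0 <= (r z)%:E.
Proof. by have [_ r0 _] := dens; rewrite lee_fin. Qed.

Let mS : measurable S. Proof. by have [] := minor. Qed.

Let theta0 : (0 < theta)%R. Proof. by have [] := minor. Qed.

Let regen_density C x :=
  (theta * \1_S x)%:E * path_integral P m C (fun y => (r (x, y))%:E) x.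

Let regen_density_ge0 C x : 0 <= regen_density C x.
Proof.
apply: mule_ge0; first by rewrite lee_fin mulr_ge0// ltW.
exact: path_integral_ge0.
Qed.

Let measurable_regen_density C : (forall k, measurable (C k)) ->
  measurable_fun setT (regen_density C).
Proof.
move=> mC; apply: emeasurable_funM.
  apply/measurable_EFinP; apply: measurable_funM => //.
have md : measurable_fun setT (fun x : E => (x, x)).
  by apply/measurable_fun_pairP; split; exact: measurable_id.
exact: (measurableT_comp (measurable_path_integral P m mC mr r0) md).
Qed.

Lemma measurable_next_segment t C : (forall k, measurable (C k)) ->
  measurable (next_segment X m t C).
Proof.
move=> mC; rewrite (_ : next_segment _ _ _ _ =
    \bigcap_(j in `I_m) (X (t * m + j.+1)%N @^-1` C j)); last first.
  by apply/seteqP; split => w h j /=; exact: h.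
by apply: fin_bigcap_measurable => // j _; exact: mX.
Qed.

Lemma next_segment_last t U :
  next_segment X m t (at_coordinate m.-1 U) = X (t.+1 * m)%N @^-1` U.
Proof.
apply/seteqP; split => w h /=.
  have := h m.-1; rewrite /at_coordinate prednK// leqnn eqxx => /(_ isT).
  by rewrite mulSn addnC.
move=> j jm; rewrite /at_coordinate; case: eqP => // jE.
by rewrite jE prednK// addnC -mulSn.
Qed.

(* Given a regeneration at time t, X_{(t+1)m} has law nu independently of the past. *)
Lemma prob_regen t H U : <<s SP t>> H -> measurable U ->
  Pr (H `&` [set w | Y t w = true] `&` X (t.+1 * m)%N @^-1` U) =
  theta%:E * Pr (H `&` X (t * m)%N @^-1` S) * nu U.
Proof.
move=> HF mU; have [_ _ /(_ t H (at_coordinate m.-1 U) HF)] := split.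
have mC k : measurable (at_coordinate m.-1 U k) by exact: measurable_at_coordinate.
rewrite next_segment_last -setIA => /(_ mC) ->.
have mH := SPm HF.
transitivity (\int[Pr]_(w in H) ((theta%:E * nu U) * (\1_(X (t * m)%N @^-1` S) w)%:E)).
  apply: eq_integral => w _; rewrite !indicE /=.
  rewrite (_ : (w \in X (t * m)%N @^-1` S) = (X (t * m)%N w \in S)); last first.
    by apply/idP/idP; rewrite !inE.
  have [/[!inE] Sx|_] := boolP (X (t * m)%N w \in S); last by rewrite mulr0 mul0e mule0.
  rewrite mulr1 mule1; congr (_ * _).
  have mrx : measurable_fun setT (fun y => (r (X (t * m)%N w, y))%:E).
    by apply: (measurableT_comp mr); exact: measurable_pair1.
  have := path_integral_last P m.-1 (X (t * m)%N w) mU mrx (fun y => r0 _).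
  rewrite prednK// => ->.
  by have [_ _ /(_ _ U Sx mU) ->] := dens.
rewrite ge0_integralZl//.
- by rewrite (integral_indic Pr mH (mX _ mS)) (setIC H) muleAC.
- by apply/measurable_EFinP; apply: measurable_funTS; apply: measurable_indic; exact: mX.
- by rewrite mule_ge0// lee_fin ltW.
Qed.

(** Taking [U] to be the whole space in [prob_regen] identifies the factor in front of [nu U]. *)
Lemma prob_regen_nu t H U : <<s SP t>> H -> measurable U ->
  Pr (H `&` [set w | Y t w = true] `&` X (t.+1 * m)%N @^-1` U) =
  Pr (H `&` [set w | Y t w = true]) * nu U.
Proof.
move=> HF mU; rewrite prob_regen//; congr (_ * _).
have := prob_regen HF measurableT.
by rewrite preimage_setT setIT probability_setT mule1 => ->.
Qed.

Lemma prob_skeleton t H i U : <<s SP t>> H -> measurable U -> (i <= m)%N ->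
  Pr (H `&` X (t * m + i)%N @^-1` U) =
  \int[Pr]_(w in H) kernel_pow P i (X (t * m)%N w) U.
Proof.
move=> HF mU im; have mH := SPm HF.
case: i im => [|i] im.
  rewrite addn0; rewrite (eq_integral (fun w => (\1_(X (t * m)%N @^-1` U) w)%:E)).
    by rewrite (integral_indic Pr mH (mX _ mU)) setIC.
  by move=> w _; rewrite /= /kdirac diracE indicE.
have mC k : measurable (at_coordinate i U k) by exact: measurable_at_coordinate.
have [_ /(_ t H (at_coordinate i U) HF mC) + _] := split.
rewrite (_ : next_segment _ _ _ _ = X (t * m + i.+1)%N @^-1` U); last first.
  apply/seteqP; split => w h.
    by have := h i im; rewrite /at_coordinate eqxx.
  by move=> j jm; rewrite /at_coordinate; case: eqP => // ->.
move=> ->; apply: eq_integral => w _; exact: path_integral_coordinate.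
Qed.

Section proportional.
Variables (c1 c2 : R).
Hypotheses (c10 : (0 <= c1)%R) (c20 : (0 <= c2)%R).

(** Given the past, the next segment and [Y] depend only on the present state, so proportional laws
    of the state stay proportional. For [Y] true this is the third clause of [split_chain]; for [Y]
    false it follows from the second clause by subtraction, all probabilities being finite. *)
Lemma proportional_step t1 t2 H1 H2 C0 C b :
  <<s SP t1>> H1 -> <<s SP t2>> H2 -> measurable C0 -> (forall k, measurable (C k)) ->
  (forall U, measurable U ->
     c2%:E * Pr (H1 `&` X (t1 * m)%N @^-1` U) = c1%:E * Pr (H2 `&` X (t2 * m)%N @^-1` U)) ->
  c2%:E * Pr (H1 `&` X (t1 * m)%N @^-1` C0 `&` ([set w | Y t1 w = b] `&` next_segment X m t1 C)) =
  c1%:E * Pr (H2 `&` X (t2 * m)%N @^-1` C0 `&` ([set w | Y t2 w = b] `&` next_segment X m t2 C)).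
Proof.
move=> HF1 HF2 mC0 mC H12.
set K1 := H1 `&` _; set K2 := H2 `&` _.
have KF1 : <<s SP t1>> K1 by apply: SPI => //; exact: SPX.
have KF2 : <<s SP t2>> K2 by apply: SPI => //; exact: SPX.
have K12 U : measurable U ->
    c2%:E * Pr (K1 `&` X (t1 * m)%N @^-1` U) = c1%:E * Pr (K2 `&` X (t2 * m)%N @^-1` U).
  by move=> mU; rewrite /K1 /K2 -(setIA H1) -(setIA H2); apply: (H12 (C0 `&` U)); exact: measurableI.
have [_ sp0 sp1] := split.
have regen : c2%:E * Pr (K1 `&` ([set w | Y t1 w = true] `&` next_segment X m t1 C)) =
  c1%:E * Pr (K2 `&` ([set w | Y t2 w = true] `&` next_segment X m t2 C)).
  rewrite (sp1 t1 K1 C KF1 mC) (sp1 t2 K2 C KF2 mC).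
  exact: (proportional_integral c10 c20 (SPm KF1) (SPm KF2) K12
    (measurable_regen_density mC) (regen_density_ge0 C)).
case: b; first exact: regen.
have all : c2%:E * Pr (K1 `&` next_segment X m t1 C) =
    c1%:E * Pr (K2 `&` next_segment X m t2 C).
  rewrite (sp0 t1 K1 C KF1 mC) (sp0 t2 K2 C KF2 mC).
  apply: (proportional_integral c10 c20 (SPm KF1) (SPm KF2) K12).
    by apply: measurable_path_integral_cst.
  by move=> x; apply: path_integral_ge0.
have dec t K : measurable K -> Pr (K `&` next_segment X m t C) =
    Pr (K `&` ([set w | Y t w = false] `&` next_segment X m t C)) +
    Pr (K `&` ([set w | Y t w = true] `&` next_segment X m t C)).
  move=> mK; rewrite -measureU.
  - congr (Pr _); rewrite -setIUr; congr (_ `&` _); rewrite -setIUl.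
    rewrite (_ : _ `|` _ = setT) ?setTI//.
    by apply/seteqP; split => // w _ /=; case: (Y t w); [right|left].
  - apply: measurableI => //; apply: measurableI; [exact: mYb|exact: measurable_next_segment].
  - apply: measurableI => //; apply: measurableI; [exact: mYb|exact: measurable_next_segment].
  - by apply/seteqP; split => // w [[_ [/= -> _]] [_ [/= ]]].
have fin (K : set Om) : measurable K -> Pr K \is a fin_num by move=> mK; exact: fin_num_measure.
have mK1 := SPm KF1; have mK2 := SPm KF2.
have mT t K : measurable K ->
    measurable (K `&` ([set w | Y t w = true] `&` next_segment X m t C)).
  by move=> mK; apply: measurableI => //; apply: measurableI; [exact: mYb|exact: measurable_next_segment].
move: all; rewrite !dec// !muleDr ?fin_num_adde_defl ?fin// ?mT//.
rewrite regen; set b := c1%:E * Pr (K2 `&` ([set w | Y t2 w = true] `&` _)).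
have bfin : b \is a fin_num by rewrite fin_numM// fin//; exact: mT.
- by move=> /(congr1 (fun z => z - b)); rewrite !addeK.
- exact: mT.
- exact: mT.
Qed.

End proportional.

End split_chain_steps.

(** * Comparison of the blocks that follow two regenerations *)

Section renewal.
Context d (E : measurableType d) (R : realType) (P : R.-pker E ~> E).
Context (init nu : probability E R) (m : nat) (S : set E) (theta : R) (r : E * E -> R).
Context d' (Om : measurableType d') (Pr : probability Om R).
Context (X : nat -> {mfun Om >-> E}) (Y : nat -> {mfun Om >-> bool}).
Hypotheses (m1 : (1 <= m)%N) (minor : minorization P m S nu theta)
  (dens : minorization_density P m S nu r)
  (split : split_chain Pr X Y P init m S theta r).
Local Open Scope ereal_scope.

Local Notation SP := (split_past X Y m).
Local Notation FT t := (g_sigma_algebraType (SP t)).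

Let SPm t H : <<s SP t>> H -> measurable H.
Proof. exact: split_past_measurable. Qed.

Let SPX t k U : (k <= t * m)%N -> measurable U -> <<s SP t>> (X k @^-1` U).
Proof.
move=> kt mU; rewrite -[X in <<s _>> X]setTI.
exact: (split_past_X (Y := Y) kt measurableT mU).
Qed.

Let SPY t k b : (k < t)%N -> <<s SP t>> [set w | Y k w = b].
Proof.
move=> kt; rewrite -[X in <<s _>> X]setTI.
have mb : measurable [set b] by [].
exact: (split_past_Y (X := X) (m := m) kt measurableT mb).
Qed.

Let SPI t A B : <<s SP t>> A -> <<s SP t>> B -> <<s SP t>> (A `&` B).
Proof. exact: (@measurableI _ (FT t)). Qed.

Let mS : measurable S. Proof. by have [] := minor. Qed.

Let theta0 : (0 < theta)%R. Proof. by have [] := minor. Qed.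

(* No regeneration in the j skeleton steps after time s, with the trajectory
   since (s+1)m prescribed by C. *)
Definition quiet (s j : nat) (C : nat -> set E) : set Om :=
  [set w | (forall u, (s < u <= s + j)%N -> Y u w = false) /\
           (forall k, (k < j * m)%N -> C k (X (s.+1 * m + k)%N w))].

(** The step from skeleton time [s.+1 + j] visits the offsets [j * m + 1] to [j * m + m], counted
    from [s.+1 * m]. The last one is the next skeleton time and receives [U]; the others keep their
    constraint from [C]. *)
Definition shift_segment (j : nat) (U : set E) (C : nat -> set E) : nat -> set E :=
  fun i => if i.+1 == m then U else C (j * m + i.+1)%N.

(** When [s] is a regeneration time, the next one is then [s.+1 + j], and the block between them has
    exactly [j.+1 * m] entries. *)
Definition block_event (s j : nat) (C : nat -> set E) : set Om :=
  [set w | [/\ forall u, (s < u <= s + j)%N -> Y u w = false, Y (s.+1 + j)%N w = true &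
           forall k, (k < j.+1 * m)%N -> C k (X (s.+1 * m + k)%N w)]].

Lemma quiet0 s C : quiet s 0 C = setT.
Proof.
apply/seteqP; split => // w _; split => [u|k]; last by rewrite mul0n.
by rewrite addn0 => /andP[su us]; have := leq_trans su us; rewrite ltnn.
Qed.

Lemma next_segment_shift s j U C w :
  (C (j * m)%N (X ((s.+1 + j) * m)%N w) /\
   next_segment X m (s.+1 + j) (shift_segment j U C) w) <->
  ((forall k, (j * m <= k < j.+1 * m)%N -> C k (X (s.+1 * m + k)%N w)) /\
   U (X ((s.+1 + j.+1) * m)%N w)).
Proof.
split => [[h0 h]|[h hU]].
  split => [k /andP[jk kj]|].
    have [kE|kE] := eqVneq k (j * m)%N; first by rewrite kE -mulnDl.
    pose i := (k - j * m).-1.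
    have kjm : (j * m < k)%N by rewrite ltn_neqAle eq_sym kE.
    have iE : i.+1 = (k - j * m)%N by rewrite prednK// subn_gt0.
    have im : (i.+1 < m)%N by rewrite iE ltn_subLR// -mulSnr.
    have := h i (ltnW im); rewrite /shift_segment ltn_eqF// iE subnKC//.
    by rewrite mulnDl -addnA subnKC.
  have := h m.-1; rewrite /shift_segment prednK// leqnn eqxx => /(_ isT).
  by rewrite addnS mulSnr.
split; first by rewrite mulnDl; apply: h; rewrite leqnn/= ltn_pmul2r.
move=> i im; rewrite /shift_segment; case: eqP => [iE|/eqP iE].
  by rewrite iE -mulSnr -addnS.
rewrite mulnDl -addnA; apply: h; rewrite leq_addr/= mulSnr ltn_add2l.
by rewrite ltn_neqAle iE.
Qed.

Lemma quietS s j C U :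
  quiet s j.+1 C `&` X ((s.+1 + j.+1) * m)%N @^-1` U =
  quiet s j C `&` X ((s.+1 + j) * m)%N @^-1` (C (j * m)%N) `&`
  ([set w | Y (s.+1 + j)%N w = false] `&`
   next_segment X m (s.+1 + j) (shift_segment j U C)).
Proof.
apply/seteqP; split => w.
  move=> [[h1 h2] hU].
  have [hC hN] : C (j * m)%N (X ((s.+1 + j) * m)%N w) /\
      next_segment X m (s.+1 + j) (shift_segment j U C) w.
    by apply/next_segment_shift; split => // k /andP[_]; exact: h2.
  split; [split => //; split|split => //].
  - by move=> u /andP[su us]; apply: h1; rewrite su addnS ltnW.
  - by move=> k kj; apply: h2; rewrite (leq_trans kj)// leq_mul2r leqnSn orbT.
  - by apply: h1; rewrite addSn addnS leqnn ltnS leq_addr.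
move=> [[[h1 h2] hC] [/= hY hN]].
have [h3 hU] : (forall k, (j * m <= k < j.+1 * m)%N -> C k (X (s.+1 * m + k)%N w)) /\
   U (X ((s.+1 + j.+1) * m)%N w) by apply/next_segment_shift.
split => //; split => [u /andP[su]|k kj].
  rewrite addnS leq_eqVlt => /orP[/eqP->|us]; first by rewrite -addSn.
  by apply: h1; rewrite su -ltnS.
by case: (ltnP k (j * m)%N) => h; [exact: h2|apply: h3; rewrite h].
Qed.

Lemma block_eventE s j C : block_event s j C =
  quiet s j C `&` X ((s.+1 + j) * m)%N @^-1` (C (j * m)%N) `&`
  ([set w | Y (s.+1 + j)%N w = true] `&`
   next_segment X m (s.+1 + j) (shift_segment j setT C)).
Proof.
apply/seteqP; split => w.
  move=> [h1 h2 h3].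
  have [hC hN] : C (j * m)%N (X ((s.+1 + j) * m)%N w) /\
      next_segment X m (s.+1 + j) (shift_segment j setT C) w.
    by apply/next_segment_shift; split => // k /andP[_]; exact: h3.
  split; [split => //; split => // k kj|by split].
  by apply: h3; rewrite (leq_trans kj)// leq_mul2r leqnSn orbT.
move=> [[[h1 h2] hC] [/= hY hN]].
have [h3 _] : (forall k, (j * m <= k < j.+1 * m)%N -> C k (X (s.+1 * m + k)%N w)) /\
   setT (X ((s.+1 + j.+1) * m)%N w) by apply/next_segment_shift.
split => // k kj; case: (ltnP k (j * m)%N) => h; [exact: h2|].
by apply: h3; rewrite h.
Qed.

Lemma measurable_shift_segment j U C k : measurable U -> (forall k, measurable (C k)) ->
  measurable (shift_segment j U C k).
Proof. by move=> mU mC; rewrite /shift_segment; case: ifP. Qed.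

Lemma split_past_quiet s j C : (forall k, measurable (C k)) ->
  <<s SP (s.+1 + j)%N>> (quiet s j C).
Proof.
move=> mC; rewrite (_ : quiet s j C =
    (\bigcap_(u in `I_(s.+1 + j)) [set w | (s < u)%N -> Y u w = false]) `&`
    \bigcap_(k in `I_(j * m)) (X (s.+1 * m + k)%N @^-1` C k)); last first.
  apply/seteqP; split => w [h1 h2]; split => //.
  - by move=> u /= us su; apply: h1; rewrite su -ltnS -addSn.
  - by move=> u /andP[su us]; apply: h1 => //=; rewrite addSn ltnS.
apply: SPI; apply: (@fin_bigcap_measurable _ (FT (s.+1 + j)%N)) => //.
  move=> u /= us; case: (ltnP s u) => su.
    rewrite (_ : [set w | _] = [set w | Y u w = false]); first exact: SPY.
    by apply/seteqP; split => w /= h //; apply: h.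
  rewrite (_ : [set w | _] = setT); first exact: (@measurableT _ (FT (s.+1 + j)%N)).
  by apply/seteqP; split.
move=> k /= kj; apply: SPX => //.
by rewrite mulnDl leq_add2l ltnW.
Qed.

Lemma measurable_block_event s j C : (forall k, measurable (C k)) ->
  measurable (block_event s j C).
Proof.
move=> mC; rewrite block_eventE; apply: measurableI; apply: measurableI.
- exact: SPm (split_past_quiet mC).
- exact: measurable_funPTI.
- exact: (measurable_funPTI (Y (s.+1 + j)%N) (_ : measurable [set true])).
- by apply: measurable_next_segment => k; exact: measurable_shift_segment.
Qed.

Section two_regenerations.
Variables (s1 s2 : nat) (G1 G2 : set Om).
Hypotheses (GF1 : <<s SP s1>> G1) (GF2 : <<s SP s2>> G2).

Let H1 := G1 `&` [set w | Y s1 w = true].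
Let H2 := G2 `&` [set w | Y s2 w = true].

Let HF1 : <<s SP s1.+1>> H1.
Proof. by apply: SPI; [exact: split_past_mono GF1|exact: SPY]. Qed.

Let HF2 : <<s SP s2.+1>> H2.
Proof. by apply: SPI; [exact: split_past_mono GF2|exact: SPY]. Qed.

Let HQ1 j C : (forall k, measurable (C k)) -> <<s SP (s1.+1 + j)%N>> (H1 `&` quiet s1 j C).
Proof.
move=> mC; apply: SPI; last exact: split_past_quiet.
by apply: split_past_mono HF1; exact: leq_addr.
Qed.

Let HQ2 j C : (forall k, measurable (C k)) -> <<s SP (s2.+1 + j)%N>> (H2 `&` quiet s2 j C).
Proof.
move=> mC; apply: SPI; last exact: split_past_quiet.
by apply: split_past_mono HF2; exact: leq_addr.
Qed.

Let PrH (H : set Om) t : <<s SP t>> H -> Pr H = (fine (Pr H))%:E.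
Proof. by move=> HF; rewrite fineK// fin_num_measure//; exact: SPm HF. Qed.

(** Induction on [j]. At the start both laws are multiples of [nu] by [prob_regen_nu], and
    [proportional_step] without regeneration preserves proportionality. *)
Lemma proportional_quiet j C U : (forall k, measurable (C k)) -> measurable U ->
  Pr H2 * Pr (H1 `&` quiet s1 j C `&` X ((s1.+1 + j) * m)%N @^-1` U) =
  Pr H1 * Pr (H2 `&` quiet s2 j C `&` X ((s2.+1 + j) * m)%N @^-1` U).
Proof.
move=> mC; elim: j U => [|j IH] U mU.
  rewrite !quiet0 !setIT !addn0 /H1 /H2.
  rewrite (prob_regen_nu m1 minor dens split GF1 mU).
  by rewrite (prob_regen_nu m1 minor dens split GF2 mU) muleCA.
rewrite -(setIA H1) -(setIA H2) !quietS.
rewrite (setIA H1 (quiet s1 j C `&` _)) (setIA H1 (quiet s1 j C)).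
rewrite (setIA H2 (quiet s2 j C `&` _)) (setIA H2 (quiet s2 j C)).
rewrite (PrH HF1) (PrH HF2).
have c10 : (0 <= fine (Pr H1))%R by rewrite fine_ge0.
have c20 : (0 <= fine (Pr H2))%R by rewrite fine_ge0.
apply: (@proportional_step _ _ _ P init nu m S theta r _ _ Pr X Y minor dens split
  _ _ c10 c20 _ _ _ _ (C (j * m)%N) (shift_segment j U C) false
  (@HQ1 j C mC) (@HQ2 j C mC)) => //.
- by move=> k; exact: measurable_shift_segment.
- by move=> V mV; rewrite -(PrH HF1) -(PrH HF2) IH.
Qed.

(** The quiet stretch of [proportional_quiet] is closed by one step with regeneration. Thus the law
    of the block after a regeneration depends neither on its time nor on the past. *)
Lemma proportional_block j C : (forall k, measurable (C k)) ->
  Pr H2 * Pr (H1 `&` block_event s1 j C) = Pr H1 * Pr (H2 `&` block_event s2 j C).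
Proof.
move=> mC; rewrite !block_eventE.
rewrite (setIA H1 (quiet s1 j C `&` _)) (setIA H1 (quiet s1 j C)).
rewrite (setIA H2 (quiet s2 j C `&` _)) (setIA H2 (quiet s2 j C)).
rewrite (PrH HF1) (PrH HF2).
have c10 : (0 <= fine (Pr H1))%R by rewrite fine_ge0.
have c20 : (0 <= fine (Pr H2))%R by rewrite fine_ge0.
apply: (@proportional_step _ _ _ P init nu m S theta r _ _ Pr X Y minor dens split
  _ _ c10 c20 _ _ _ _ (C (j * m)%N) (shift_segment j setT C) true
  (@HQ1 j C mC) (@HQ2 j C mC)) => //.
- by move=> k; exact: measurable_shift_segment.
- by move=> V mV; rewrite -(PrH HF1) -(PrH HF2) proportional_quiet.
Qed.

End two_regenerations.

End renewal.

(** * Recurrence of regenerations and the renewal property *)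

Section occupation.
Context d (E : measurableType d) (R : realType) (P : R.-pker E ~> E).
Context (init nu pi : probability E R) (m : nat) (S : set E) (theta : R) (r : E * E -> R).
Context d' (Om : measurableType d') (Pr : probability Om R).
Context (X : nat -> {mfun Om >-> E}) (Y : nat -> {mfun Om >-> bool}).
Hypotheses (m1 : (1 <= m)%N) (minor : minorization P m S nu theta)
  (dens : minorization_density P m S nu r)
  (split : split_chain Pr X Y P init m S theta r)
  (inv : invariant_probability P pi).
Local Open Scope ereal_scope.
Hypothesis piS : 0 < pi S.

Local Notation SP := (split_past X Y m).
Local Notation FT t := (g_sigma_algebraType (SP t)).

Let SPm t H : <<s SP t>> H -> measurable H.
Proof. exact: split_past_measurable. Qed.

Let SPY t k b : (k < t)%N -> <<s SP t>> [set w | Y k w = b].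
Proof.
move=> kt; rewrite -[X in <<s _>> X]setTI.
have mb : measurable [set b] by [].
exact: (split_past_Y (X := X) (m := m) kt measurableT mb).
Qed.

Let SPI t A B : <<s SP t>> A -> <<s SP t>> B -> <<s SP t>> (A `&` B).
Proof. exact: (@measurableI _ (FT t)). Qed.

Let mS : measurable S. Proof. by have [] := minor. Qed.

Let theta0 : (0 < theta)%R. Proof. by have [] := minor. Qed.

Let mYb k b : measurable [set w | Y k w = b].
Proof. exact: (measurable_funPTI (Y k) (_ : measurable [set b])). Qed.

Lemma invariant_kernel_pow i U : measurable U ->
  \int[pi]_x kernel_pow P i x U = pi U.
Proof.
elim: i U => [|i IH] U mU.
  rewrite (eq_integral (fun x => (\1_U x)%:E)).
    by rewrite integral_indic// setIT.
  by move=> x _; rewrite /= /kdirac diracE indicE.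
under eq_integral do rewrite kernel_powSr//.
rewrite -(inv mU); apply/esym.
apply: (@ge0_integral_bind _ _ _ _ _ pi setT (kernel_pow P i) pi) => //.
- by move=> V mV; exact: measurable_kernel.
- by move=> V mV; rewrite IH.
- exact: measurable_kernel.
Qed.

Section after_regeneration.
Variables (s : nat) (G : set Om).
Hypothesis GF : <<s SP s>> G.

Let H := G `&` [set w | Y s w = true].

Let HF : <<s SP s.+1>> H.
Proof. by apply: SPI; [exact: split_past_mono GF|exact: SPY]. Qed.

Definition silence (j : nat) : set Om := quiet m X Y s j (fun=> setT).

Let HQ j : <<s SP (s.+1 + j)%N>> (H `&` silence j).
Proof.
apply: SPI; last exact: split_past_quiet.
by apply: split_past_mono HF; exact: leq_addr.
Qed.

Definition skeleton_law (j : nat) : {measure set E -> \bar R} :=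
  law Pr X ((s.+1 + j) * m)%N (SPm (@HQ j)).

Lemma skeleton_lawE j U :
  skeleton_law j U = Pr (H `&` silence j `&` X ((s.+1 + j) * m)%N @^-1` U).
Proof. exact: lawE. Qed.

Lemma integral_skeleton_law j (f : E -> \bar R) :
  measurable_fun setT f -> (forall x, 0 <= f x) ->
  \int[skeleton_law j]_x f x =
  \int[Pr]_(w in H `&` silence j) f (X ((s.+1 + j) * m)%N w).
Proof.
move=> mf f0; apply: integral_law => //; first exact: SPm (@HQ j).
by move=> U _; exact: skeleton_lawE.
Qed.

Let fin_law j U : measurable U -> skeleton_law j U \is a fin_num.
Proof.
move=> mU; rewrite skeleton_lawE fin_num_measure//.
by apply: measurableI; [exact: SPm (@HQ j)|exact: measurable_funPTI].
Qed.

Lemma skeleton_law0 U : measurable U -> skeleton_law 0 U = Pr H * nu U.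
Proof.
move=> mU; rewrite skeleton_lawE /silence quiet0 setIT addn0.
exact: (prob_regen_nu m1 minor dens split GF mU).
Qed.

(** A skeleton step is split by the value of [Y]: the regenerating part has mass $\theta$ times the
    mass of [S] and lands with law [nu]. *)
Lemma skeleton_lawS j U : measurable U ->
  skeleton_law j.+1 U + theta%:E * skeleton_law j S * nu U =
  \int[skeleton_law j]_x kernel_pow P m x U.
Proof.
move=> mU; rewrite integral_skeleton_law//; last exact: measurable_kernel.
rewrite -(prob_skeleton split (@HQ j) mU (leqnn m)) -mulSnr.
rewrite !skeleton_lawE -(prob_regen m1 minor dens split (@HQ j) mU).
set t := (s.+1 + j)%N.
have -> : H `&` silence j.+1 `&` X ((s.+1 + j.+1) * m)%N @^-1` U =
    H `&` silence j `&` [set w | Y t w = false] `&` X (t.+1 * m)%N @^-1` U.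
  rewrite -(setIA H) /silence quietS//; cbv beta.
  rewrite (_ : X ((s.+1 + j) * m)%N @^-1` [set: E] = setT)// setIT.
  rewrite (_ : shift_segment m j U (fun=> setT) = at_coordinate m.-1 U); last first.
    apply/funext => i; rewrite /shift_segment /at_coordinate.
    by rewrite -{1}(prednK m1) eqSS.
  by rewrite next_segment_last// !setIA.
have mHj := SPm (@HQ j).
have mXU : measurable (X (t.+1 * m)%N @^-1` U) by exact: measurable_funPTI.
rewrite -measureU.
- congr (Pr _); rewrite -setIUl; congr (_ `&` _); rewrite -setIUr.
  rewrite (_ : _ `|` _ = setT) ?setIT//.
  by apply/seteqP; split => // w _ /=; case: (Y t w); [right|left].
- by apply: measurableI => //; apply: measurableI.
- by apply: measurableI => //; apply: measurableI.
- by apply/seteqP; split => // w [[[_ /= ->] _] [[_ /=]]].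
Qed.

(* The kernel of the m-skeleton killed at regeneration. *)
Let killed U x := kernel_pow P m x U - (theta * \1_S x)%:E * nu U.

Let fin_nu U : measurable U -> nu U \is a fin_num.
Proof. exact: fin_num_measure. Qed.

Let killedK U x : measurable U ->
  killed U x + (theta * \1_S x)%:E * nu U = kernel_pow P m x U.
Proof. by move=> mU; rewrite subeK// fin_numM// fin_nu. Qed.

Let killed_ge0 U x : measurable U -> 0 <= killed U x.
Proof.
move=> mU; rewrite /killed sube_ge0; last by rewrite fin_numM ?fin_nu.
have [Sx|Sx] := pselect (S x); rewrite indicE.
  by rewrite mem_set// mulr1; have [_ _ _ h] := minor; exact: h.
by rewrite memNset// mulr0 mul0e.
Qed.

Let measurable_atom U : measurable U ->
  measurable_fun setT (fun x => (theta * \1_S x)%:E * nu U).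
Proof.
move=> mU; apply: emeasurable_funM => //.
by apply/measurable_EFinP; apply: measurable_funM.
Qed.

Let measurable_killed U : measurable U -> measurable_fun setT (killed U).
Proof.
move=> mU; apply: emeasurable_funB; last exact: measurable_atom.
exact: measurable_kernel.
Qed.

Let integral_killed (mu : {measure set E -> \bar R}) U : measurable U ->
  \int[mu]_x killed U x + theta%:E * mu S * nu U = \int[mu]_x kernel_pow P m x U.
Proof.
move=> mU; transitivity (\int[mu]_x killed U x + \int[mu]_x ((theta * \1_S x)%:E * nu U)).
  congr (_ + _).
  rewrite (eq_integral (fun x => (theta%:E * nu U) * (\1_S x)%:E)); last first.
    by move=> x _; rewrite EFinM muleAC.
  rewrite ge0_integralZl//.
  - by rewrite integral_indic// setIT muleAC.
  - exact/measurable_EFinP.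
  - by rewrite mule_ge0// lee_fin ltW.
rewrite -ge0_integralD//.
- by apply: eq_integral => x _; rewrite killedK.
- by move=> x _; exact: killed_ge0.
- exact: measurable_killed.
- by move=> x _; rewrite mule_ge0// lee_fin mulr_ge0// ltW.
- exact: measurable_atom.
Qed.

Let a : R := (theta * fine (pi S))%R.

Let a0 : (0 < a)%R.
Proof.
rewrite mulr_gt0// fine_gt0// piS/=.
by rewrite ltey_eq fin_num_measure.
Qed.

Let a_E : a%:E = theta%:E * pi S.
Proof. by rewrite /a EFinM fineK// fin_num_measure. Qed.

Let c := fine (Pr H).

Let c_E : Pr H = c%:E.
Proof. by rewrite /c fineK// fin_num_measure//; exact: SPm HF. Qed.

Let c0 : (0 <= c)%R. Proof. by rewrite fine_ge0. Qed.

(** Let $K$ be the killed kernel and $\mu_j$ the skeleton laws. Then $\mu_0=\mathbb P(H)\nu$ and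
    $\mu_{j+1}=\mu_jK$, while invariance reads $\pi=\pi K+a\nu$ with $a=\theta\pi(S)$. By induction
    $a\sum_{j\le n}\mu_j=a\mathbb P(H)\nu+(a\sum_{j<n}\mu_j)K\le\mathbb P(H)(a\nu+\pi K)=\mathbb
    P(H)\pi$. *)
Lemma occupation_bound n U : measurable U ->
  a%:E * \sum_(j < n) skeleton_law j U <= Pr H * pi U.
Proof.
elim: n U => [|n IH] U mU; first by rewrite big_ord0 mule0 mule_ge0.
pose k1 := mscale (NngNum (ltW a0)) (msum skeleton_law n).
pose k2 := mscale (NngNum c0) pi.
have k12 V : measurable V -> k1 V <= k2 V.
  by move=> mV; rewrite /k1 /k2 /mscale /msum /= -c_E; exact: IH.
have := ge0_le_integral_measure k12 (measurable_killed mU) (fun x => killed_ge0 x mU).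
rewrite /k1 /k2 !ge0_integral_mscale//; try exact: measurable_killed;
  try by move=> x _; exact: killed_ge0.
rewrite ge0_integral_measure_sum//; last 2 first.
- by move=> x _; exact: killed_ge0.
- exact: measurable_killed.
have -> : \sum_(j < n) \int[skeleton_law j]_x killed U x =
    \sum_(j < n) skeleton_law j.+1 U.
  apply: eq_bigr => j _; have := integral_killed (skeleton_law j) mU.
  have bfin : theta%:E * skeleton_law j S * nu U \is a fin_num.
    by rewrite !fin_numM// ?fin_law ?fin_nu.
  rewrite -skeleton_lawS// => /(congr1 (fun z => z - theta%:E * skeleton_law j S * nu U)).
  by rewrite !addeK.
move=> h; rewrite big_ord_recl ge0_muleDr//; last by apply: sume_ge0 => j _; exact: measure_ge0.
rewrite skeleton_law0// c_E.
have -> : a%:E * (c%:E * nu U) = c%:E * (theta%:E * pi S * nu U).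
  by rewrite a_E muleCA.
have -> : pi U = \int[pi]_x killed U x + theta%:E * pi S * nu U.
  by rewrite integral_killed// invariant_kernel_pow.
rewrite ge0_muleDr//.
- by rewrite addeC leeD.
- by apply: integral_ge0 => x _; exact: killed_ge0.
- by rewrite !mule_ge0// lee_fin ltW.
Qed.

(** The event lies in every [silence j], so its probability is at most the total mass of each
    skeleton law. By [occupation_bound], $n$ times this probability stays bounded as $n$ grows. *)
Lemma regeneration_recurs :
  Pr (H `&` [set w | forall u, (s < u)%N -> Y u w = false]) = 0.
Proof.
set N := _ `&` _.
have mN : measurable N.
  apply: measurableI; first exact: SPm HF.
  rewrite (_ : [set w | _] = \bigcap_(u in [set u | (s < u)%N]) [set w | Y u w = false]); last first.
    by apply/seteqP; split.
  by apply: bigcap_measurableType => u _.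
have NQ j : Pr N <= skeleton_law j setT.
  rewrite skeleton_lawE preimage_setT setIT.
  apply: le_measure; rewrite ?inE//; first exact: SPm (@HQ j).
  by move=> w [Hw hw]; split => //; split => // u /andP[su _]; exact: hw.
have PN : Pr N = (fine (Pr N))%:E by rewrite fineK// fin_num_measure.
have bound n : (a * (n%:R * fine (Pr N)) <= c)%R.
  rewrite -lee_fin !EFinM -PN -c_E.
  have := occupation_bound n measurableT; rewrite probability_setT mule1.
  apply: le_trans; apply: lee_wpmul2l; first by rewrite lee_fin ltW.
  have -> : n%:R%:E * Pr N = \sum_(j < n) Pr N.
    by rewrite PN -EFinM sumEFin sumr_const card_ord mulr_natl.
  by apply: lee_sum => j _.
apply/eqP; rewrite PN eqe eq_le fine_ge0// andbT leNgt; apply/negP => p0.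
have := bound (Num.truncn (c / (a * fine (Pr N)))).+1.
have ap : (0 < a * fine (Pr N))%R by rewrite mulr_gt0.
rewrite mulrCA -ler_pdivlMr// leNgt truncnS_gt//.
Qed.

End after_regeneration.

(** On this event every value of [regeneration] is a genuine regeneration time. *)
Definition infinitely_regenerating : set Om :=
  [set w | forall s, exists t, (s <= t)%N /\ Y t w = true].

Lemma measurable_infinitely_regenerating : measurable infinitely_regenerating.
Proof.
rewrite (_ : infinitely_regenerating =
    \bigcap_s \bigcup_(t in [set t | (s <= t)%N]) [set w | Y t w = true]).
  by apply: bigcap_measurableType => s _; apply: bigcup_measurable => t _.
apply/seteqP; split => w h s; last by have [t ? ?] := h s Logic.I; exists t.
by move=> _; have [t [? ?]] := h s; exists t.
Qed.

(** A path that regenerates at least once but not infinitely often has a last regeneration time [s].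
    For each of the countably many [s] this is null by [regeneration_recurs]. *)
Lemma prob_infinitely_regenerating D : measurable D ->
  (forall w, D w -> exists t, Y t w = true) ->
  Pr (D `&` infinitely_regenerating) = Pr D.
Proof.
move=> mD DY; have mI := measurable_infinitely_regenerating.
suff h : Pr (D `\` infinitely_regenerating) = 0.
  have e : Pr D = Pr (D `\` infinitely_regenerating) + Pr (D `&` infinitely_regenerating).
    exact: measureDI.
  by rewrite e h add0e.
pose N s := (setT `&` [set w | Y s w = true]) `&` [set w | forall u, (s < u)%N -> Y u w = false].
have N0 s : Pr (N s) = 0 by apply: regeneration_recurs; exact: (@measurableT _ (FT s)).
have mN s : measurable (N s).
  apply: measurableI; first by rewrite setTI.
  rewrite (_ : [set w | _] = \bigcap_(u in [set u | (s < u)%N]) [set w | Y u w = false]); last first.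
    by apply/seteqP; split.
  by apply: bigcap_measurableType => u _.
apply/eqP; rewrite eq_le measure_ge0 andbT.
have : Pr (\bigcup_s N s) = 0.
  apply/(@negligibleP _ _ _ Pr); first exact: bigcup_measurable.
  apply: negligible_bigcup => s; apply/(@negligibleP _ _ _ Pr); first exact: mN.
  exact: N0.
move=> <-; apply: le_measure; rewrite ?inE.
- exact: measurableD.
- exact: bigcup_measurable.
move=> w [Dw]; have [t0 yt0] := DY w Dw.
move=> /existsNP[s0 /forallNP no].
have y0 u : (s0 <= u)%N -> Y u w = false.
  by move=> su; apply/negP => yu; apply: (no u).
have s00 : (t0 < s0)%N by rewrite ltnNge; apply/negP => /y0; rewrite yt0.
have [s [ys cs]] : exists s, Y s w = true /\ forall u, (s < u)%N -> Y u w = false.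
  have ex : exists s, (s < s0)%N && Y s w by exists t0; rewrite s00 yt0.
  have ub : forall s, (s < s0)%N && Y s w -> (s <= s0)%N by move=> s /andP[/ltnW].
  case: (ex_maxnP ex ub) => s /andP[ss0 ys] smax; exists s; split => // u su.
  case: (ltnP u s0) => us0; last exact: y0.
  apply/negP => yu; have := smax u; rewrite us0 yu => /(_ isT).
  by rewrite leqNgt su.
by exists s.
Qed.

End occupation.

(** * Renewal property of the blocks *)

Section renewal_theorem.
Context d (E : measurableType d) (R : realType) (P : R.-pker E ~> E).
Context (init nu pi : probability E R) (m : nat) (S : set E) (theta : R) (r : E * E -> R).
Context d' (Om : measurableType d') (Pr : probability Om R).
Context (X : nat -> {mfun Om >-> E}) (Y : nat -> {mfun Om >-> bool}).
Hypotheses (m1 : (1 <= m)%N) (minor : minorization P m S nu theta)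
  (dens : minorization_density P m S nu r)
  (split : split_chain Pr X Y P init m S theta r)
  (inv : invariant_probability P pi).
Local Open Scope ereal_scope.
Hypothesis piS : 0 < pi S.

Local Notation SP := (split_past X Y m).
Local Notation Inf := (infinitely_regenerating Y).
Local Notation B i := (block X Y m i).

Let mInf : measurable Inf. Proof. exact: measurable_infinitely_regenerating. Qed.

Lemma Inf_count i w : Inf w -> exists s, (i < regen_count (Y^~ w) s)%N.
Proof.
move=> wI; elim: i => [|i [s IH]].
  by have [t [_ yt]] := wI 0%N; exists t.+1; rewrite regen_countS yt addn1.
have [t [st yt]] := wI s; exists t.+1; rewrite regen_countS yt addn1 ltnS.
by apply: leq_trans IH _; exact: regen_count_le.
Qed.

Lemma Inf_regen_at i w : Inf w -> exists s, regen_at Y i s w.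
Proof.
move=> /(Inf_count i)[s /regen_count_ex[u [_ yu cu]]].
by exists u; rewrite /regen_at /= yu cu eqxx.
Qed.

Lemma regen_at_next i s j w : regen_at Y i s w ->
  (forall u, (s < u <= s + j)%N -> Y u w = false) -> Y (s.+1 + j)%N w = true ->
  regen_at Y i.+1 (s.+1 + j) w.
Proof.
move=> /andP[ys /eqP cs] h yj; rewrite /regen_at /= yj /= -cs.
apply/eqP; apply: (regen_count_between (y := Y^~ w)) => //; last by rewrite addSn ltnS leq_addr.
by move=> u /andP[su]; rewrite addSn ltnS => us; rewrite h// su us.
Qed.

Lemma next_regen s w : Inf w -> exists j,
  (forall u, (s < u <= s + j)%N -> Y u w = false) /\ Y (s.+1 + j)%N w = true.
Proof.
move=> wI; have [t [st yt]] := wI s.+1.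
have [h1 h2 h3] := first_regeneration_from_ex (y := Y^~ w) st yt.
set u := first_regeneration_from _ _ in h1 h2 h3.
exists (u - s.+1)%N; rewrite subnKC//; split => // v /andP[sv vu].
apply/negbTE/h3; rewrite sv /=.
by rewrite -(subnKC h1) addSn ltnS.
Qed.

Lemma segment_cylinder n C s j w :
  cylinder n C (segment X m s (s.+1 + j) w) <->
  n = (j.+1 * m)%N /\ forall k, (k < j.+1 * m)%N -> C k (X (s.+1 * m + k)%N w).
Proof.
have sz : (m * (s.+1 + j).+1 - m * s.+1 = j.+1 * m)%N.
  by rewrite -mulnBr -addnS addKn mulnC.
rewrite /cylinder /segment /=; split.
  move=> [+ h]; rewrite size_map size_iota sz => nE; split => // k kj.
  have := h k; rewrite -nE => /(_ kj).
  by rewrite (nth_map 0%N) ?size_iota ?sz// nth_iota ?sz// mulnC.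
move=> [-> h]; split; first by rewrite size_map size_iota sz.
move=> k kj; rewrite (nth_map 0%N) ?size_iota ?sz// nth_iota ?sz// mulnC.
exact: h.
Qed.

Lemma block_cylinder i s n C w : (0 < i)%N -> regen_at Y i.-1 s w -> Inf w ->
  cylinder n C (B i w) <-> exists2 j, n = (j.+1 * m)%N & block_event m X Y s j C w.
Proof.
move=> i0 rs wI.
have BE j : (forall u, (s < u <= s + j)%N -> Y u w = false) ->
    Y (s.+1 + j)%N w = true -> B i w = segment X m s (s.+1 + j) w.
  move=> h yj; have := regen_at_next rs h yj; rewrite prednK// => rj.
  by rewrite /block (regeneration_regen_at rs) (regeneration_regen_at rj).
split.
  have [j [h yj]] := next_regen s wI; rewrite (BE j)// => /segment_cylinder[nE hC].
  by exists j.
by move=> [j nE [h yj hC]]; rewrite (BE j)//; apply/segment_cylinder.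
Qed.

Section renewal_at_cylinder.
Variables (i : nat) (G : set Om).
Hypotheses (i0 : (0 < i)%N) (mG : measurable G) (dG : decided_before X Y m i.-1 G).

(** The pieces are disjoint, since a regeneration number has one time, and each contains a
    regeneration, so that intersecting with [Inf] loses no mass. *)
Lemma sum_regen_at (F : nat -> set Om) : (forall s, measurable (F s)) ->
  Pr (\bigcup_s (F s `&` regen_at Y i.-1 s) `&` Inf) =
  \sum_(s <oo) Pr (F s `&` regen_at Y i.-1 s).
Proof.
move=> mF.
have mFs s : measurable (F s `&` regen_at Y i.-1 s).
  by apply: measurableI => //; exact: (measurable_regen_at X Y m).
rewrite (prob_infinitely_regenerating m1 minor dens split inv piS); last 2 first.
- exact: bigcup_measurable.
- by move=> w [s _ [_ /andP[ys _]]]; exists s.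
rewrite measure_bigcup//; last first.
  apply/trivIsetP => s t _ _ st; apply/seteqP; split => // w [[_ hs] [_ ht]].
  by move/eqP: st; apply; rewrite -(regeneration_regen_at hs) -(regeneration_regen_at ht).
by apply: eq_eseriesl => k; rewrite in_setT.
Qed.

(** Sum over the time [s] at which block [i] is opened. As [G] is decided before that regeneration,
    [proportional_block] compares each term with a fixed reference regeneration at [s0], whose
    factors do not depend on [s]. *)
Lemma renewal_reference s0 G0 j C : <<s SP s0>> G0 -> (forall k, measurable (C k)) ->
  Pr (G0 `&` [set w | Y s0 w = true]) * Pr (G `&` Inf `&` B i @^-1` cylinder (j.+1 * m) C) =
  Pr (G0 `&` [set w | Y s0 w = true] `&` block_event m X Y s0 j C) * Pr (G `&` Inf).
Proof.
move=> G0F mC.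
have mbe s : measurable (block_event m X Y s j C) by exact: measurable_block_event.
have -> : G `&` Inf = \bigcup_s (G `&` regen_at Y i.-1 s) `&` Inf.
  apply/seteqP; split => w [].
    by move=> Gw wI; have [s rs] := Inf_regen_at i.-1 wI; split => //; exists s.
  by move=> [s _ [Gw _]] wI.
have -> : \bigcup_s (G `&` regen_at Y i.-1 s) `&` Inf `&` B i @^-1` cylinder (j.+1 * m) C =
    \bigcup_s (G `&` block_event m X Y s j C `&` regen_at Y i.-1 s) `&` Inf.
  apply/seteqP; split => w.
    move=> [[[s _ [Gw rs]] wI] /= /(block_cylinder _ _ i0 rs wI)[j' jj' be]].
    split => //; exists s => //; split => //; split => //.
    suff -> : j = j' by [].
    by move/eqP: jj'; rewrite eqn_pmul2r// eqSS => /eqP.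
  move=> [[s _ [[Gw be] rs]] wI]; split; first by split => //; exists s.
  by apply/(block_cylinder _ _ i0 rs wI); exists j.
rewrite !sum_regen_at//; last by move=> s; exact: measurableI.
have mY : measurable [set w | Y s0 w = true].
  exact: (measurable_funPTI (Y s0) (_ : measurable [set true])).
have mH : measurable (G0 `&` [set w | Y s0 w = true]).
  by apply: measurableI => //; exact: split_past_measurable G0F.
have fin (A : set Om) : measurable A -> Pr A = (fine (Pr A))%:E.
  by move=> mA; rewrite fineK// fin_num_measure.
rewrite (fin _ mH) (fin _ (measurableI _ _ mH (mbe s0))) -!nneseriesZl//.
apply: eq_eseriesr => s _.
rewrite -(fin _ mH) -(fin _ (measurableI _ _ mH (mbe s0))).
have [Gs GsF GsE] := dG s.
rewrite setIAC GsE [RHS]muleC.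
exact: (proportional_block m1 minor dens split GsF G0F j mC).
Qed.

End renewal_at_cylinder.

Let mB i (D : set (block_space E)) : measurable D -> measurable (B i @^-1` D).
Proof.
move=> mD; rewrite -[X in measurable X]setTI.
exact: (measurable_block X Y m i measurableT mD).
Qed.

(** Block [i] and block 1 are compared with the same reference regeneration, which is then
    eliminated. *)
Lemma renewal_cylinder i G n C : (0 < i)%N -> measurable G ->
  decided_before X Y m i.-1 G -> (forall k, measurable (C k)) ->
  Pr Inf * Pr (G `&` Inf `&` B i @^-1` cylinder n C) =
  Pr (G `&` Inf) * Pr (Inf `&` B 1 @^-1` cylinder n C).
Proof.
move=> i0 mG dG mC; have mcyl : measurable (cylinder n C : set (block_space E)).
  exact: measurable_cylinder.
have mGI : measurable (G `&` Inf) by exact: measurableI.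
have [I0|I0] := eqVneq (Pr Inf) 0.
  suff -> : Pr (G `&` Inf) = 0 by rewrite I0 !mul0e.
  by apply/eqP; rewrite eq_le measure_ge0 andbT -I0 le_measure ?inE//; exact: subIsetr.
(* A block spans a whole positive number of skeleton intervals; cylinders of any other length are
   not met on [Inf]. *)
have [[j nE]|no] := pselect (exists j, n = (j.+1 * m)%N); last first.
  have B0 i' : (0 < i')%N -> Inf `&` B i' @^-1` cylinder n C = set0.
    move=> i'0; apply/seteqP; split => // w [wI /= h].
    have [s rs] := Inf_regen_at i'.-1 wI.
    by have /(block_cylinder n C i'0 rs wI)[j nE _] := h; apply: no; exists j.
  by rewrite -setIA !B0// setI0 measure0 !mule0.
(* The reference must have positive probability to be cancelled; it exists because the first
   regeneration has countably many possible times and [Pr Inf] is not zero. *)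
have [s0 s0P] : exists s0, Pr (regen_at Y 0 s0) != 0.
  apply: contrapT => /forallNP h; move/eqP: I0; apply.
  rewrite (_ : Inf = \bigcup_s (setT `&` regen_at Y 0 s) `&` Inf); last first.
    apply/seteqP; split => w; last by case.
    by move=> wI; split => //; have [s rs] := Inf_regen_at 0 wI; exists s.
  rewrite (@sum_regen_at 1 (fun=> setT))//; apply: eseries0 => s _ _.
  by rewrite setTI; apply/eqP; have := h s; case: eqP.
pose G0 := [set w | regen_count (Y^~ w) s0 == 0%N].
have G0F : <<s SP s0>> G0 by exact: split_past_regen_count.
have H0E : G0 `&` [set w | Y s0 w = true] = regen_at Y 0 s0.
  by apply/seteqP; split => w; [move=> [/= ? ?]; apply/andP|move=> /andP[]].
have := renewal_reference i0 mG dG j G0F mC.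
have := renewal_reference (ltn0Sn 0) measurableT (decided_setT X Y m 0) j G0F mC.
rewrite H0E setTI -nE.
have fin (A : set Om) : measurable A -> Pr A = (fine (Pr A))%:E.
  by move=> mA; rewrite fineK// fin_num_measure.
have mr := measurable_regen_at X Y m 0 s0.
have mbe : measurable (block_event m X Y s0 j C) by exact: measurable_block_event.
rewrite (fin _ mr) (fin _ (measurableI _ _ mInf (mB 1 mcyl))).
rewrite (fin _ (measurableI _ _ mr mbe)) (fin _ mInf) (fin _ mGI).
rewrite (fin _ (measurableI _ _ mGI (mB i mcyl))) -!EFinM => -[h1] [h2].
have r0 : fine (Pr (regen_at Y 0 s0)) != 0%R.
  by move: s0P; rewrite (fin _ mr) eqe.
congr EFin; apply: (mulfI r0); rewrite mulrCA h2 [RHS]mulrCA h1; ring.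
Qed.

(* The blocks are identically distributed given Inf, and each is independent of
   what is decided before the regeneration at which it starts. *)
Theorem renewal i G (D : set (block_space E)) : (0 < i)%N -> measurable G ->
  decided_before X Y m i.-1 G -> measurable D ->
  Pr Inf * Pr (G `&` Inf `&` B i @^-1` D) =
  Pr (G `&` Inf) * Pr (Inf `&` B 1 @^-1` D).
Proof.
move=> i0 mG dG mD; have mGI : measurable (G `&` Inf) by exact: measurableI.
have fin (A : set Om) : measurable A -> Pr A = (fine (Pr A))%:E.
  by move=> mA; rewrite fineK// fin_num_measure.
pose law1 : {measure set (block_space E) -> \bar R} :=
  measure_function_pushforward__canonical__measure_function_Measure
    (mrestr Pr mGI) (measurable_block X Y m i).
pose law2 : {measure set (block_space E) -> \bar R} :=
  measure_function_pushforward__canonical__measure_function_Measure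
    (mrestr Pr mInf) (measurable_block X Y m 1).
have p0 : (0 <= fine (Pr Inf))%R by rewrite fine_ge0.
have g0 : (0 <= fine (Pr (G `&` Inf)))%R by rewrite fine_ge0.
have [M1 M1E] : exists M : {measure set (block_space E) -> \bar R},
    forall A, M A = Pr Inf * Pr (G `&` Inf `&` B i @^-1` A).
  exists (mscale (NngNum p0) law1) => A.
  rewrite [in RHS](fin _ mInf) (setIC (G `&` Inf)).
  by change ((fine (Pr Inf))%:E * Pr (B i @^-1` A `&` (G `&` Inf)) =
    (fine (Pr Inf))%:E * Pr (B i @^-1` A `&` (G `&` Inf))).
have [M2 M2E] : exists M : {measure set (block_space E) -> \bar R},
    forall A, M A = Pr (G `&` Inf) * Pr (Inf `&` B 1 @^-1` A).
  exists (mscale (NngNum g0) law2) => A.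
  rewrite [in RHS](fin _ mGI) (setIC Inf).
  by change ((fine (Pr (G `&` Inf)))%:E * Pr (B 1 @^-1` A `&` Inf) =
    (fine (Pr (G `&` Inf)))%:E * Pr (B 1 @^-1` A `&` Inf)).
rewrite -M1E -M2E; apply: (@eq_finite_measure _ (block_space E) _ (@cylinders _ E)) => //.
- by move=> A AG; apply: sub_sigma_algebra.
- exact: cylinders_setI.
- by rewrite M1E M2E !preimage_setT !setIT muleC.
- rewrite M1E preimage_setT setIT (fin _ mInf) (fin _ mGI) -EFinM; exact: ltry.
- by move=> _ [n [C [mC ->]]]; rewrite M1E M2E; exact: renewal_cylinder.
Qed.

End renewal_theorem.

(** * Kac's formula *)

Section kac.
Context d (E : measurableType d) (R : realType) (P : R.-pker E ~> E).
Context (init nu pi : probability E R) (m : nat) (S : set E) (theta : R) (r : E * E -> R).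
Context d' (Om : measurableType d') (Pr : probability Om R).
Context (X : nat -> {mfun Om >-> E}) (Y : nat -> {mfun Om >-> bool}).
Hypotheses (m1 : (1 <= m)%N) (minor : minorization P m S nu theta)
  (dens : minorization_density P m S nu r)
  (split : split_chain Pr X Y P init m S theta r)
  (inv : unique_invariant_probability P pi).
Local Open Scope ereal_scope.
Hypothesis piS : 0 < pi S.

Local Notation SP := (split_past X Y m).
Local Notation Inf := (infinitely_regenerating Y).
Local Notation B i := (block X Y m i).

Let mInf : measurable Inf. Proof. exact: measurable_infinitely_regenerating. Qed.

Let mS : measurable S. Proof. by have [] := minor. Qed.

Let theta0 : (0 < theta)%R. Proof. by have [] := minor. Qed.

Section occupation_measure.
Variables (s : nat) (G : set Om).
Hypothesis GF : <<s SP s>> G.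

Let H := G `&` [set w | Y s w = true].
Local Notation silent j := (H `&` silence m X Y s j).

Let rho j : {measure set E -> \bar R} := skeleton_law Pr GF j.

Lemma split_past_silent j : <<s SP (s.+1 + j)%N>> (silent j).
Proof.
have mb : measurable [set true] by [].
have hY : <<s SP (s.+1 + j)%N>> [set w | Y s w = true].
  rewrite -[X in <<s _>> X]setTI.
  apply: (split_past_Y (X := X) (m := m) _ measurableT mb).
  by rewrite addSn ltnS leq_addr.
have hG : <<s SP (s.+1 + j)%N>> G.
  by apply: split_past_mono GF; rewrite addSn ltnW// ltnS leq_addr.
apply: (@measurableI _ (g_sigma_algebraType (SP (s.+1 + j)%N))); last exact: split_past_quiet.
exact: (@measurableI _ (g_sigma_algebraType (SP (s.+1 + j)%N))).
Qed.

Let msilent j : measurable (silent j).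
Proof. exact: split_past_measurable (split_past_silent (j := j)). Qed.

Let rhoE j U : rho j U = Pr (silent j `&` X ((s.+1 + j) * m)%N @^-1` U).
Proof. exact: skeleton_lawE. Qed.

(** Expected time spent in a set during the block that follows the regeneration at [s] on [G]:
    skeleton interval [j] belongs to that block exactly on [silence j], and contributes [m] time
    points. *)
Definition occupation_measure : {measure set E -> \bar R} :=
  mseries (fun j => msum (fun i => law Pr X ((s.+1 + j) * m + i)%N (msilent j)) m) 0.

Local Notation occ := occupation_measure.

Lemma integral_occupation (g : E -> \bar R) : measurable_fun setT g ->
  (forall x, 0 <= g x) ->
  \int[occ]_x g x = \sum_(j <oo) \sum_(i < m)
    \int[law Pr X ((s.+1 + j) * m + i)%N (msilent j)]_x g x.
Proof.
move=> mg g0; rewrite ge0_integral_measure_series//.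
by apply: eq_eseriesr => j _; rewrite ge0_integral_measure_sum.
Qed.

Lemma integral_occupation_kernel (g : E -> \bar R) : measurable_fun setT g ->
  (forall x, 0 <= g x) ->
  \int[occ]_x g x = \sum_(j <oo) \sum_(i < m)
    \int[rho j]_x \int[kernel_pow P i x]_y g y.
Proof.
move=> mg g0; rewrite integral_occupation//; apply: eq_eseriesr => j _.
apply: eq_bigr => i _.
apply: (@ge0_integral_bind _ _ _ _ _ (rho j) setT (kernel_pow P i)) => //.
  by move=> U mU; exact: measurable_kernel.
move=> U mU; rewrite lawE.
rewrite (prob_skeleton split (split_past_silent (j := j)) mU (ltnW (ltn_ord i))).
apply/esym; apply: (@integral_skeleton_law _ _ _ _ _ _ Pr X Y s G GF j (fun x => kernel_pow P i x U)) => //.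
exact: measurable_kernel.
Qed.

Let a j i U := \int[rho j]_x kernel_pow P i x U.

Let a_ge0 j i U : 0 <= a j i U. Proof. exact: integral_ge0. Qed.

Lemma occupationE U : measurable U -> occ U = \sum_(j <oo) \sum_(i < m) a j i U.
Proof.
move=> mU; have := integral_occupation_kernel (g := fun x => (\1_U x)%:E).
rewrite integral_indic// setIT => ->.
- apply: eq_eseriesr => j _; apply: eq_bigr => i _; apply: eq_integral => x _.
  by rewrite integral_indic// setIT.
- exact/measurable_EFinP.
- by move=> x; rewrite lee_fin.
Qed.

Lemma integral_occupation_step U : measurable U ->
  \int[occ]_x P x U = \sum_(j <oo) \sum_(i < m) a j i.+1 U.
Proof.
move=> mU; rewrite integral_occupation_kernel//; last exact: measurable_kernel.
apply: eq_eseriesr => j _; apply: eq_bigr => i _; apply: eq_integral => x _.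
by rewrite kernel_powSr.
Qed.

Let total U := \sum_(j <oo) rho j U.

Let c : R := fine (Pr H).

Let mH : measurable H.
Proof.
apply: measurableI; first exact: split_past_measurable GF.
exact: (measurable_funPTI (Y s) (_ : measurable [set true])).
Qed.

Let cE : Pr H = c%:E. Proof. by rewrite fineK// fin_num_measure. Qed.

Let total_fin U : measurable U -> total U \is a fin_num.
Proof.
move=> mU; rewrite ge0_fin_numE; last by apply: nneseries_ge0.
pose b : R := (theta * fine (pi S))%R.
have b0 : (0 < b)%R.
  by rewrite mulr_gt0// fine_gt0// piS/= ltey_eq fin_num_measure.
apply: (@le_lt_trans _ _ (b^-1%:E * (Pr H * pi U))); last first.
  by rewrite cE -(fineK (fin_num_measure pi U mU)) -!EFinM ltry.
apply: lime_le; first by apply: is_cvg_nneseries.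
apply: nearW => k; rewrite big_mkord.
have := occupation_bound m1 minor dens split inv.1 piS GF k mU.
rewrite -/b => h.
rewrite -[leLHS]mul1e -(mulVf (lt0r_neq0 b0)) EFinM -muleA.
by apply: lee_wpmul2l => //; rewrite lee_fin invr_ge0 ltW.
Qed.

Let total_rec U : measurable U -> total U = Pr H * nu U + \sum_(j <oo) rho j.+1 U.
Proof.
move=> mU; rewrite /total nneseries_recl//.
rewrite (skeleton_law0 m1 minor dens split GF mU); congr (_ + _).
rewrite -(nneseries_addn 1 (f := fun j => rho j U))//.
by apply: eq_eseriesr => j _; rewrite addn1.
Qed.

Lemma occupation_setT : occ setT = m%:R%:E * total setT.
Proof.
rewrite occupationE// /total -nneseriesZl//; apply: eq_eseriesr => j _.
rewrite (eq_bigr (fun=> rho j setT)); last first.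
  move=> i _; rewrite /a (eq_integral (cst 1)) ?integral_cst ?mul1e//.
  by move=> x _; rewrite kernel_pow_setT.
rewrite -(fineK (_ : rho j setT \is a fin_num)); last first.
  by rewrite rhoE preimage_setT setIT fin_num_measure.
by rewrite sumEFin sumr_const card_ord -EFinM mulr_natl.
Qed.

(** One step of [P] shifts the time index inside each skeleton interval: the terms $i=m$ enter and
    the terms $i=0$ leave. By [skeleton_lawS] the entering ones sum to
    $\sum_j\rho_{j+1}+\theta\,\mathrm{total}(S)\,\nu$, and the leaving ones are $\mathbb
    P(H)\nu+\sum_j\rho_{j+1}$. The common series is finite and cancels. *)
Lemma occupation_balance U : measurable U ->
  \int[occ]_x P x U + Pr H * nu U = occ U + theta%:E * total S * nu U.
Proof.
move=> mU.
have bal : \int[occ]_x P x U + total U =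
    occ U + (\sum_(j <oo) rho j.+1 U + theta%:E * total S * nu U).
  rewrite integral_occupation_step// occupationE// /total.
  have -> : \sum_(j <oo) rho j.+1 U + theta%:E * (\sum_(j <oo) rho j S) * nu U =
      \sum_(j <oo) a j m U.
    rewrite -nneseriesZl// muleC -(fineK (fin_num_measure nu U mU)) -nneseriesZl//; last first.
      by move=> j _; rewrite mule_ge0// lee_fin ltW.
    rewrite -nneseriesD//; last first.
      by move=> j _ _; rewrite mule_ge0// ?lee_fin ?fine_ge0// mule_ge0// lee_fin ltW.
    apply: eq_eseriesr => j _; rewrite fineK ?fin_num_measure// muleC.
    exact: (skeleton_lawS m1 minor dens split GF j mU).
  rewrite -nneseriesD//; [|by move=> *; exact: sume_ge0..].
  rewrite -nneseriesD//; [|by move=> *; exact: sume_ge0..].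
  apply: eq_eseriesr => j _.
  have -> : rho j U = a j 0%N U.
    by rewrite /a (eq_integral (fun x => (\1_U x)%:E)) ?integral_indic ?setIT.
  have -> : \sum_(i < m) a j i U + a j m U = \sum_(i < m.+1) a j i U.
    by rewrite big_ord_recr.
  by rewrite big_ord_recl/= addeC.
have tfin : \sum_(j <oo) rho j.+1 U \is a fin_num.
  rewrite ge0_fin_numE; last by apply: nneseries_ge0.
  have := total_fin mU; rewrite ge0_fin_numE; last by apply: nneseries_ge0.
  by apply: le_lt_trans; rewrite (total_rec mU) leeDr// mule_ge0.
move: bal; rewrite (total_rec mU); set t := \sum_(j <oo) rho j.+1 U in tfin *.
rewrite addeA (addeC t) addeA => /(congr1 (fun z => z - t)).
by rewrite !addeK.
Qed.

Lemma occupation_fin U : measurable U -> occ U \is a fin_num.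
Proof.
move=> mU; rewrite ge0_fin_numE//.
apply: (@le_lt_trans _ _ (occ setT)); first by rewrite le_measure ?inE.
by rewrite occupation_setT -(fineK (total_fin measurableT)) -EFinM ltry.
Qed.

(** The balance on the whole space says that [Pr H] equals [theta%:E * total S], so the two [nu]
    terms cancel in general. *)
Lemma occupation_invariant U : measurable U -> \int[occ]_x P x U = occ U.
Proof.
move=> mU.
have e : Pr H = theta%:E * total S.
  have := occupation_balance measurableT.
  rewrite (eq_integral (cst 1)); last by move=> x _; rewrite prob_kernel.
  rewrite integral_cst// mul1e probability_setT !mule1 => h.
  have ofin := occupation_fin measurableT.
  by move: h => /(congr1 (fun z => z - occ setT)); rewrite ![occ setT + _]addeC !addeK.
have := occupation_balance mU; rewrite -e => /(congr1 (fun z => z - Pr H * nu U)).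
by rewrite !addeK// cE fin_numM// fin_num_measure.
Qed.

(** If its mass is positive, the normalized occupation measure is an invariant probability, hence
    [pi] by uniqueness. *)
Lemma occupation_pi (U : set E) : measurable U -> occ U = occ setT * pi U.
Proof.
move=> mU; have ofin := occupation_fin measurableT.
have [z0|z0] := eqVneq (occ setT) 0.
  rewrite z0 mul0e; apply/eqP; rewrite eq_le measure_ge0 andbT -z0.
  by rewrite le_measure ?inE.
pose q : probability E R := mnormalize occ pi.
have normE A : q A = occ A * (fine (occ setT))^-1%:E.
  have noo : (occ setT == +oo) = false by apply/eqP => e; rewrite e in ofin.
  by rewrite /q /= /mnormalize (negbTE z0) noo.
have f0 : (0 < fine (occ setT))%R by rewrite fine_gt0// lt0e z0 measure_ge0/= ltey_eq ofin.
have i0 : (0 <= (fine (occ setT))^-1)%R by rewrite invr_ge0 ltW.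
have qinv : invariant_probability P q.
  move=> A mA; rewrite normE -(occupation_invariant mA).
  transitivity (\int[mscale (NngNum i0) occ]_x P x A).
    apply: eq_measure_integral => V mV _.
    by change (q V = (fine (occ setT))^-1%:E * occ V); rewrite normE muleC.
  by rewrite ge0_integral_mscale//; [rewrite muleC|exact: measurable_kernel].
rewrite -(inv.2 q qinv U mU) normE muleCA -[X in _ * (X * _)](fineK ofin) -EFinM.
by rewrite mulfV ?gt_eqF// mule1.
Qed.

Lemma integral_occupation_pi (g : E -> \bar R) : measurable_fun setT g ->
  (forall x, 0 <= g x) -> \int[occ]_x g x = occ setT * \int[pi]_x g x.
Proof.
move=> mg g0; have ofin := occupation_fin measurableT.
have f0 : (0 <= fine (occ setT))%R by rewrite fine_ge0.
rewrite -(fineK ofin) -(ge0_integral_mscale pi measurableT (NngNum f0) mg)//.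
apply: eq_measure_integral => U mU _.
by change (occ U = (fine (occ setT))%:E * pi U); rewrite fineK// occupation_pi.
Qed.

End occupation_measure.

End kac.

Section image.
Context d (T : measurableType d) (R : realType).
Context d' (Om : measurableType d') (mu : {measure set Om -> \bar R}).
Local Open Scope ereal_scope.

Lemma integral_image (f : Om -> T) H (nu : {measure set T -> \bar R}) (g : T -> \bar R) :
  measurable_fun setT f -> measurable H ->
  (forall U, measurable U -> nu U = mu (H `&` f @^-1` U)) ->
  measurable_fun setT g -> (forall x, 0 <= g x) ->
  \int[nu]_x g x = \int[mu]_(w in H) g (f w).
Proof.
move=> mf mH nuE mg g0.
have ms U : measurable U -> (fun w => \d_(f w) U) = EFin \o (\1_U \o f) :> (Om -> \bar R).
  by move=> _; apply/funext => w /=; rewrite diracE indicE.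
rewrite (@ge0_integral_bind _ _ _ _ _ mu H (fun w => dirac (f w)) nu g)//.
- by apply: eq_integral => w _; rewrite integral_dirac// diracT mul1e.
- by move=> U mU; rewrite ms//; apply/measurable_EFinP; apply: measurableT_comp.
- move=> U mU; rewrite nuE//.
  rewrite (eq_integral (fun w => (\1_(f @^-1` U) w)%:E)); last first.
    by move=> w _; rewrite /= diracE indicE.
  rewrite integral_indic//; first by rewrite setIC.
  by rewrite -[X in measurable X]setTI; exact: mf.
Qed.

Lemma proportional_image (f1 f2 : Om -> T) (c1 c2 : R) H1 H2 (g : T -> \bar R) :
  (0 <= c1)%R -> (0 <= c2)%R -> measurable H1 -> measurable H2 ->
  measurable_fun setT f1 -> measurable_fun setT f2 ->
  (forall U, measurable U ->
     c1%:E * mu (H1 `&` f1 @^-1` U) = c2%:E * mu (H2 `&` f2 @^-1` U)) ->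
  measurable_fun setT g -> (forall x, 0 <= g x) ->
  c1%:E * \int[mu]_(w in H1) g (f1 w) = c2%:E * \int[mu]_(w in H2) g (f2 w).
Proof.
move=> c10 c20 mH1 mH2 mf1 mf2 H12 mg g0.
pose law1 : {measure set T -> \bar R} :=
  measure_function_pushforward__canonical__measure_function_Measure (mrestr mu mH1) mf1.
pose law2 : {measure set T -> \bar R} :=
  measure_function_pushforward__canonical__measure_function_Measure (mrestr mu mH2) mf2.
have law1E U : law1 U = mu (H1 `&` f1 @^-1` U) by rewrite setIC.
have law2E U : law2 U = mu (H2 `&` f2 @^-1` U) by rewrite setIC.
rewrite -(integral_image mf1 mH1 (nu := law1))//.
rewrite -(integral_image mf2 mH2 (nu := law2))//.
rewrite -(ge0_integral_mscale law1 measurableT (NngNum c10) mg)//.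
rewrite -(ge0_integral_mscale law2 measurableT (NngNum c20) mg)//.
apply: eq_measure_integral => U mU _.
by change (c1%:E * law1 U = c2%:E * law2 U); rewrite law1E law2E H12.
Qed.

End image.

Lemma sum_iota_segments (V : nmodType) (h : nat -> V) (m s j : nat) :
  \sum_(m * s <= k < m * (s + j)) h k =
  \sum_(0 <= l < j) \sum_(i < m) h ((s + l) * m + i)%N.
Proof.
elim: j => [|j IH]; first by rewrite addn0 !big_geq.
rewrite big_nat_recr//= -IH addnS mulnS (big_cat_nat _ (n := (m * (s + j))%N))//=; last 2 first.
- by rewrite leq_mul2l leq_addr orbT.
- by rewrite leq_addl.
congr (_ + _); rewrite -{1}[(m * (s + j))%N]add0n big_addn addnK big_mkord.
by apply: eq_bigr => i _; rewrite addnC mulnC.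
Qed.

Section kac_formula.
Context d (E : measurableType d) (R : realType) (P : R.-pker E ~> E).
Context (init nu pi : probability E R) (m : nat) (S : set E) (theta : R) (r : E * E -> R).
Context d' (Om : measurableType d') (Pr : probability Om R).
Context (X : nat -> {mfun Om >-> E}) (Y : nat -> {mfun Om >-> bool}).
Hypotheses (m1 : (1 <= m)%N) (minor : minorization P m S nu theta)
  (dens : minorization_density P m S nu r)
  (split : split_chain Pr X Y P init m S theta r)
  (inv : unique_invariant_probability P pi).
Local Open Scope ereal_scope.
Hypothesis piS : 0 < pi S.

Local Notation SP := (split_past X Y m).
Local Notation Inf := (infinitely_regenerating Y).
Local Notation B i := (block X Y m i).

Let mInf : measurable Inf. Proof. exact: measurable_infinitely_regenerating. Qed.

(** The random length of the block is encoded by the indicators of [silence], so that the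
    expectation can be taken term by term. *)
Lemma block_sum_series (g : E -> R) s w : (forall x, 0 <= g x)%R ->
  regen_at Y 0 s w -> Inf w ->
  (block_sum g (B 1 w))%:E =
  \sum_(j <oo) (\1_(silence m X Y s j) w *
    \sum_(i < m) g (X ((s.+1 + j) * m + i)%N w))%:E.
Proof.
move=> g0 rs wI; have [J [h yJ]] := next_regen s wI.
have rJ := regen_at_next rs h yJ.
rewrite /block (regeneration_regen_at rs) (regeneration_regen_at rJ).
rewrite /block_sum big_map -addnS sum_iota_segments.
have t0 j : (0 <= \1_(silence m X Y s j) w *
    \sum_(i < m) g (X ((s.+1 + j) * m + i)%N w))%R.
  by rewrite mulr_ge0// sumr_ge0.
rewrite (@nneseries_split _ _ 0 J.+1)//; last by move=> k _; rewrite lee_fin.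
rewrite eseries0 ?adde0; last first.
  move=> j; rewrite add0n => Jj _; rewrite indicE memNset ?mul0r//.
  by move=> [hj _]; have := hj (s.+1 + J)%N; rewrite yJ addSn ltnS leq_addr -addnS leq_add2l => /(_ Jj).
rewrite add0n sumEFin; congr EFin; apply: eq_big_nat => j /andP[_ jJ].
rewrite indicE mem_set ?mul1r//; split => // u /andP[su us].
by apply: h; rewrite su (leq_trans us)// leq_add2l.
Qed.

Lemma integral_block_sum_regen_at s (GF : <<s SP s>> [set w | regen_count (Y^~ w) s == 0%N])
    (g : E -> R) : measurable_fun setT g -> (forall x, 0 <= g x)%R ->
  \int[Pr]_(w in regen_at Y 0 s `&` Inf) (block_sum g (B 1 w))%:E =
  \int[occupation_measure Pr GF]_x (g x)%:E.
Proof.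
move=> mg g0; have mr := measurable_regen_at X Y m 0 s.
have HE : [set w | regen_count (Y^~ w) s == 0%N] `&` [set w | Y s w = true] = regen_at Y 0 s.
  by apply/seteqP; split => w /=; [move=> [? ?]; apply/andP|move/andP => []].
have msil j : measurable (silence m X Y s j).
  by apply: (split_past_measurable (X := X) (Y := Y) (m := m) (t := (s.+1 + j)%N)); exact: split_past_quiet.
rewrite (eq_integral (fun w => \sum_(j <oo) (\1_(silence m X Y s j) w *
    \sum_(i < m) g (X ((s.+1 + j) * m + i)%N w))%:E)); last first.
  by move=> w /set_mem[rs wI]; exact: block_sum_series.
rewrite integral_nneseries//; last 3 first.
- exact: measurableI.
- move=> j; apply: measurable_funTS; apply/measurable_EFinP.
  apply: measurable_funM; first exact: measurable_indic.
  by apply: measurable_sum => i; apply: measurableT_comp.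
- by move=> j w _; rewrite lee_fin mulr_ge0// sumr_ge0.
rewrite integral_occupation//; last exact/measurable_EFinP.
apply: eq_eseriesr => j _.
transitivity (\sum_(i < m) \int[Pr]_(w in regen_at Y 0 s `&` Inf `&` silence m X Y s j)
    (g (X ((s.+1 + j) * m + i)%N w))%:E).
  rewrite -ge0_integral_sum//; last 3 first.
  - by apply: measurableI => //; exact: measurableI.
  - move=> i; apply: measurable_funTS; apply/measurable_EFinP.
    exact: measurableT_comp.
  - by move=> i w _; rewrite lee_fin.
  rewrite [RHS]integral_mkcondr; apply: eq_integral => w _.
  by rewrite patchE indicE; case: ifPn => _; rewrite ?mul1r ?mul0r// sumEFin.
apply: eq_bigr => i _; apply/esym.
apply: (integral_image (f := X _)) => //.
- by apply: measurableI => //; exact: measurableI.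
- move=> U mU; rewrite lawE HE.
  rewrite -(prob_infinitely_regenerating m1 minor dens split inv.1 piS).
  + by congr (Pr _); apply/seteqP; split => w /=; tauto.
  + by apply: measurableI; [exact: measurableI|exact: measurable_funPTI].
  + by move=> w [[/andP[ys _] _] _]; exists s.
- exact/measurable_EFinP.
Qed.

(* A form of Kac's formula. *)
Lemma integral_block_sum : exists2 c : R, (0 <= c)%R &
  forall g : E -> R, measurable_fun setT g -> (forall x, 0 <= g x)%R ->
  \int[Pr]_(w in Inf) (block_sum g (B 1 w))%:E = c%:E * \int[pi]_x (g x)%:E.
Proof.
have mbs (g : E -> R) : measurable_fun setT g ->
    measurable_fun setT (EFin \o block_sum g : block_space E -> \bar R).
  by move=> mg; apply/measurable_EFinP; exact: measurable_block_sum.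
have mB := measurable_block X Y m 1.
have [I0|I0] := eqVneq (Pr Inf) 0.
  exists 0%R => // g mg g0; rewrite mul0e null_set_integral//.
  by apply: measurable_funTS; exact: (measurableT_comp (mbs g mg) mB).
have [s s0] : exists s, Pr (regen_at Y 0 s) != 0.
  apply: contrapT => h; move/eqP: I0; apply.
  apply/eqP; rewrite eq_le measure_ge0 andbT.
  have mr := measurable_regen_at X Y m 0.
  have : Pr (\bigcup_s regen_at Y 0 s) = 0.
    apply/(@negligibleP _ _ _ Pr); first exact: bigcup_measurable.
    apply: negligible_bigcup => s; apply/(@negligibleP _ _ _ Pr); first exact: mr.
    by apply/eqP/negPn/negP => hs; apply: h; exists s.
  move=> <-; apply: le_measure; rewrite ?inE//; first exact: bigcup_measurable.
  by move=> w /(Inf_regen_at 0)[s rs]; exists s.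
have GF : <<s SP s>> [set w | regen_count (Y^~ w) s == 0%N] by exact: split_past_regen_count.
have mr := measurable_regen_at X Y m 0 s.
have rI : Pr (regen_at Y 0 s `&` Inf) = Pr (regen_at Y 0 s).
  apply: (prob_infinitely_regenerating m1 minor dens split inv.1 piS) => //.
  by move=> w /andP[ys _]; exists s.
have fin (A : set Om) : measurable A -> Pr A = (fine (Pr A))%:E.
  by move=> mA; rewrite fineK// fin_num_measure.
have ofin := occupation_fin m1 minor dens split inv piS GF measurableT.
pose a := fine (Pr (regen_at Y 0 s)); pose b := fine (Pr Inf).
have a0 : (0 < a)%R by rewrite fine_gt0// lt0e s0 measure_ge0/= ltey_eq fin_num_measure.
exists (a^-1 * b * fine (occupation_measure Pr GF setT))%R.
  by rewrite !mulr_ge0 ?invr_ge0 ?fine_ge0// ltW.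
move=> g mg g0.
(* The occupation identity is available on the event that the first regeneration is at [s]. By
   [renewal] with this event as [G], the law of block 1 there is proportional to its law on
   [Inf]. *)
have : b%:E * \int[Pr]_(w in regen_at Y 0 s `&` Inf) (block_sum g (B 1 w))%:E =
    a%:E * \int[Pr]_(w in Inf) (block_sum g (B 1 w))%:E.
  apply: (@proportional_image _ (block_space E) _ _ _ _ (B 1) (B 1) b a _ _ (EFin \o block_sum g)).
  - by rewrite fine_ge0.
  - exact: ltW.
  - exact: measurableI.
  - exact: mInf.
  - exact: mB.
  - exact: mB.
  - move=> U mU; rewrite /a /b -!fin// -rI.
    have dG : decided_before X Y m 0 (regen_at Y 0 s) by exact: decided_regen_at.
    exact: (renewal m1 minor dens split inv.1 piS (ltn0Sn 0) mr dG mU).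
  - exact: mbs.
  - by move=> B; rewrite /= lee_fin sumr_ge0.
rewrite (integral_block_sum_regen_at GF)//.
rewrite (integral_occupation_pi m1 minor dens split inv piS GF); last 2 first.
- exact/measurable_EFinP.
- by move=> x; rewrite lee_fin.
move=> e.
rewrite -[LHS]mul1e -(mulVf (lt0r_neq0 a0)) EFinM -muleA -e.
by rewrite -[in LHS](fineK ofin) !EFinM !muleA.
Qed.

End kac_formula.

(** * The maximal inequality for independent copies *)

Section independence.
Context d (Om : measurableType d) (R : realType) (Pr : probability Om R).
Context d' (T : measurableType d') (rho : probability T R).
Variables (n : nat) (b : 'I_n -> Om -> T).
Hypothesis mb : forall i, measurable_fun setT (b i).

(** Joint independence and the common law [rho] in one formula; choosing some [D i] to be the whole
    space covers subfamilies. *)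
Definition independent_copies : Prop := forall D : 'I_n -> set T,
  (forall i, measurable (D i)) ->
  Pr (\bigcap_i b i @^-1` D i) = (\prod_i fine (rho (D i)))%:E.

(** Plays the role of [G i] in [symmetrization]: each variable is centered conditionally on the
    others. *)
Definition others (i : 'I_n) : set (set Om) :=
  \bigcup_(j in [set j | j != i]) g_sigma_algebra_preimage (b j).

Let mbD i D : measurable D -> measurable (b i @^-1` D).
Proof. by move=> mD; rewrite -[X in measurable X]setTI; exact: mb. Qed.

Lemma others_measurable i : <<s others i>> `<=` measurable.
Proof.
apply: smallest_sub; first exact: sigma_algebra_measurable.
by move=> A [j _ [D mD <-]]; rewrite setTI; exact: mbD.
Qed.

Lemma measurable_others i j : i != j ->
  measurable_fun setT (b i : g_sigma_algebraType (others j) -> T).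
Proof.
move=> ij _ D mD; apply: sub_sigma_algebra; exists i => //.
by exists D.
Qed.

Hypothesis indep : independent_copies.
Local Open Scope ereal_scope.

Let cyl (i : 'I_n) : set (set Om) := [set A | exists D : 'I_n -> set T,
  [/\ forall j, measurable (D j), D i = setT & A = \bigcap_j b j @^-1` D j]].

Let others_cyl i : <<s others i>> `<=` <<s cyl i>>.
Proof.
apply: smallest_sub; first exact: smallest_sigma_algebra.
move=> A [j /= ji [D mD <-]]; apply: sub_sigma_algebra.
exists (fun k => if k == j then D else setT); split.
- by move=> k; case: ifP.
- by rewrite eq_sym (negbTE ji).
rewrite setTI; apply/seteqP; split => w /=; last by move=> /(_ j Logic.I); rewrite eqxx.
by move=> h k _; case: ifP => // /eqP ->.
Qed.

Let bigcap_split (i : 'I_n) (D : 'I_n -> set T) U : D i = setT ->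
  \bigcap_j b j @^-1` D j `&` b i @^-1` U =
  \bigcap_j b j @^-1` (if j == i then U else D j).
Proof.
move=> Di; apply/seteqP; split => w /=.
  by move=> [h hU] j _; case: ifP => [/eqP ->//|_]; exact: h.
move=> h; split; last by have := h i Logic.I; rewrite eqxx.
by move=> j _; have := h j Logic.I; case: ifP => // /eqP -> _; rewrite Di.
Qed.

Lemma independent_of_others i H U : <<s others i>> H -> measurable U ->
  Pr (H `&` b i @^-1` U) = Pr H * rho U.
Proof.
move=> oH mU; have mbU := mbD i mU.
have u0 : (0 <= fine (rho U))%R by rewrite fine_ge0.
have uE : rho U = (fine (rho U))%:E by rewrite fineK// fin_num_measure.
pose m1 : {measure set Om -> \bar R} := mrestr Pr mbU.
pose m2 : {measure set Om -> \bar R} := mscale (NngNum u0) Pr.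
have m1E A : m1 A = Pr (A `&` b i @^-1` U) by [].
have m2E A : m2 A = Pr A * rho U by rewrite muleC [in RHS]uE.
have key A : cyl i A -> m1 A = m2 A.
  move=> [D [mD Di ->]]; rewrite m1E m2E bigcap_split// !indep//; last by move=> j; case: ifP.
  rewrite [in RHS]uE -EFinM; congr EFin.
  rewrite (bigD1 i)//= eqxx [in RHS](bigD1 i)//= Di probability_setT mul1r mulrC.
  by congr (_ * _)%R; apply: eq_bigr => j /negbTE ->.
rewrite -m1E -m2E; apply: (eq_finite_measure (G := cyl i)) => //.
- move=> A [D [mD _ ->]]; apply: fin_bigcap_measurable => // j _; exact: mbD.
- move=> _ _ [D1 [mD1 D1i ->]] [D2 [mD2 D2i ->]].
  exists (fun j => D1 j `&` D2 j); split.
  + by move=> j; exact: measurableI.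
  + by rewrite D1i D2i setTI.
  by rewrite -bigcapI.
- apply: key; exists (fun=> setT); split => //.
  by apply/esym; apply/seteqP; split.
- rewrite m1E; apply: le_lt_trans (probability_le1 Pr _) (ltry 1).
  by rewrite setTI.
- exact: others_cyl.
Qed.

Lemma integral_independent i H (g : T -> \bar R) : <<s others i>> H ->
  measurable_fun setT g -> (forall x, 0 <= g x) ->
  \int[Pr]_(w in H) g (b i w) = Pr H * \int[rho]_x g x.
Proof.
move=> oH mg g0; have mH := others_measurable oH.
have h0 : (0 <= fine (Pr H))%R by rewrite fine_ge0.
have hE : Pr H = (fine (Pr H))%:E by rewrite fineK// fin_num_measure.
rewrite -(integral_image (mb i) mH (nu := mscale (NngNum h0) rho))//.
  by rewrite ge0_integral_mscale//= -hE.
move=> U mU; apply: etrans (esym (independent_of_others oH mU)); rewrite [in RHS]hE.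
by change ((fine (Pr H))%:E * rho U = (fine (Pr H))%:E * rho U).
Qed.

Lemma integral_copy i (g : T -> \bar R) :
  measurable_fun setT g -> (forall x, 0 <= g x) ->
  \int[Pr]_w g (b i w) = \int[rho]_x g x.
Proof.
move=> mg g0; rewrite integral_independent ?probability_setT ?mul1e//.
exact: (@measurableT _ (g_sigma_algebraType (others i))).
Qed.

Lemma integrable_copy i (g : T -> R) : rho.-integrable setT (EFin \o g) ->
  Pr.-integrable setT (EFin \o (fun w => g (b i w))).
Proof.
move=> /integrableP[mg ig]; apply/integrableP; split.
  exact: (measurableT_comp mg (mb i)).
rewrite (integral_copy i (g := fun x => `|(g x)%:E|))//.
exact: (measurableT_comp (@abse_measurable R setT) mg).
Qed.

(** Independence is applied to the positive and the negative part, whose integrals are finite and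
    equal. *)
Lemma integral_centered i H (g : T -> R) : <<s others i>> H ->
  rho.-integrable setT (EFin \o g) -> \int[rho]_x (g x)%:E = 0 ->
  \int[Pr]_(w in H) (g (b i w))%:E = 0.
Proof.
move=> oH ig g0; have mg : measurable_fun setT (EFin \o g) by case/integrableP: ig.
rewrite integralE.
rewrite (eq_integral (fun w => (EFin \o g)^\+ (b i w))); last first.
  by move=> w _; rewrite !funeposE.
rewrite [X in _ - X](eq_integral (fun w => (EFin \o g)^\- (b i w))); last first.
  by move=> w _; rewrite !funenegE.
rewrite (integral_independent oH (g := (EFin \o g)^\+))//; last exact: measurable_funepos.
rewrite (integral_independent oH (g := (EFin \o g)^\-))//; last exact: measurable_funeneg.
have fp := integrable_pos_fin_num measurableT ig.
have fn := integrable_neg_fin_num measurableT ig.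
have : \int[rho]_x (EFin \o g) x = 0 by exact: g0.
rewrite integralE => {}g0.
have mH := others_measurable oH.
have hE : Pr H = (fine (Pr H))%:E by rewrite fineK// fin_num_measure.
rewrite hE -muleBr; [|by []|by apply: fin_num_adde_defl; rewrite fin_numN].
by rewrite g0 mule0.
Qed.

End independence.

(** * Chaining, symmetrization and self-bounding combined *)

Section rademacher_bounds.
Context {R : realType}.

(* The chaining bound, linearized in (V, Y) at (D, Y0). *)
Lemma rad_mean_tangent (n K : nat) (T : Type) (C : set T) (f : 'I_K -> T)
    (x y : T -> 'I_n -> R) (a v l V Y D Y0 : R) :
  4 <= a -> 1 <= v -> 0 <= l -> 0 < D -> 0 < Y0 -> D <= Y0 -> 0 <= V <= Y ->
  (forall g h, C g -> C h ->
    sqnorm (fun i => y g i - y h i) <= l ^+ 2 * sqnorm (fun i => x g i - x h i)) ->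
  (forall k, C (f k)) ->
  (forall k, sqnorm (y (f k)) <= l ^+ 2 * V) ->
  (0 < Y -> forall e : R, 0 < e <= 1 -> exists k (c : 'I_k -> T),
    [/\ k%:R <= 2 * (a / e) `^ v, forall i, C (c i) &
      forall g, C g -> exists i,
        sqnorm (fun j => x g j - x (c i) j) <= (2 * e) ^+ 2 * Y]) ->
  rad_mean (fun e => \big[Num.max/0]_k `|rad_sum (y (f k)) e|) <=
  100 * l * Num.sqrt (v / 2 * (V * (ln (a ^+ 2 * Y0 / D) - 1) + Y * D / Y0)).
Proof.
move=> a4 v1 l0 D0 Y00 DY0 /andP[V0 VY] ylip Cf fV cover.
have a0 : 0 < a by apply: lt_le_trans a4.
have v0 : 0 < v by apply: lt_le_trans v1.
(* Degenerate case, in which chaining has no positive radius to start from: all the vectors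
   [y (f k)] vanish. *)
have [lV|lV] := leP (l ^+ 2 * V) 0.
  apply: (@le_trans _ _ 0); last by rewrite !mulr_ge0.
  rewrite -[leRHS](@rad_mean_cst R n); apply: le_rad_mean => e.
  apply: bigmax_le => // k _; apply: le_trans (norm_rad_sum _ _) _.
  have y0 i : y (f k) i = 0.
    apply/eqP; rewrite -sqrf_eq0 eq_le sqr_ge0 andbT.
    apply: le_trans lV; apply: le_trans (fV k).
    by rewrite /sqnorm (bigD1 i)//= lerDl sumr_ge0// => j _; rewrite sqr_ge0.
  by rewrite big1// => i _; rewrite y0 normr0.
have {}V0 : 0 < V by rewrite lt_neqAle V0 andbT; apply/eqP => V0'; rewrite -V0' mulr0 ltxx in lV.
have {}l0 : 0 < l.
  by rewrite lt_neqAle l0 andbT; apply/eqP => l0'; rewrite -l0' expr0n mul0r ltxx in lV.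
have Y_gt0 : 0 < Y by apply: lt_le_trans VY.
have sV : 0 < Num.sqrt V by rewrite sqrtr_gt0.
have sY : 0 < Num.sqrt Y by rewrite sqrtr_gt0.
have sV2 : Num.sqrt V ^+ 2 = V by rewrite sqr_sqrtr// ltW.
have sY2 : Num.sqrt Y ^+ 2 = Y by rewrite sqr_sqrtr// ltW.
apply: le_trans (@rad_mean_chaining R n K T C f x y a v l (Num.sqrt V) (Num.sqrt Y)
  sV _ a4 v1 l0 ylip Cf _ _) _.
- exact: ler_wsqrtr.
- by move=> k; rewrite exprMn sV2.
- move=> e e01; have [k [c [kc cC hc]]] := cover Y_gt0 e e01.
  by exists k, c; split => // g /hc[i hi]; exists i; rewrite exprMn sY2.
rewrite -[leLHS]mulrA ler_wpM2l//; first by rewrite mulr_ge0// ltW.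
rewrite -sqrtrM; last exact: ltW.
rewrite ler_wsqrtr//.
have lnE : ln (a * Num.sqrt Y / Num.sqrt V) = ln (a ^+ 2 * Y / V) / 2.
  have p0 : 0 < a * Num.sqrt Y / Num.sqrt V by rewrite divr_gt0// mulr_gt0.
  rewrite (_ : a ^+ 2 * Y / V = (a * Num.sqrt Y / Num.sqrt V) ^+ 2).
    by rewrite lnXn// -[ln _ *+ 2]mulr_natr mulfK.
  by rewrite !exprMn exprVn sV2 sY2.
rewrite lnE (_ : V * (v * (ln (a ^+ 2 * Y / V) / 2)) = v / 2 * (V * ln (a ^+ 2 * Y / V))); last by ring.
rewrite ler_wpM2l ?divr_ge0// ?(ltW v0)//.
by apply: entropy_tangent => //; rewrite exprn_gt0.
Qed.

End rademacher_bounds.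

Section maximal_inequality.
Context d (Om : measurableType d) (R : realType) (Pr : probability Om R).
Context d' (T : measurableType d') (rho : probability T R).
Variables (n K : nat) (b : 'I_n -> Om -> T).
Variables (C : set (T -> R)) (Phi : T -> R) (f : 'I_K -> T -> R).
Variables (a v sigma N m : R).
Hypotheses (mb : forall i, measurable_fun setT (b i))
  (indep : independent_copies Pr rho b) (n1 : (0 < n)%N).
Hypotheses (mPhi : measurable_fun setT Phi) (Cf : forall k, C (f k))
  (mC : forall g, C g -> measurable_fun setT g)
  (CPhi : forall g, C g -> forall x, `|g x| <= Phi x).
Hypotheses (a4 : 4 <= a) (v1 : 1 <= v) (sigma0 : 0 < sigma) (sigmaN : sigma <= N)
  (m0 : 0 <= m).
Local Open Scope ereal_scope.
Hypothesis Phi_N : \int[rho]_x (Phi x ^+ 2)%:E <= (N ^+ 2)%:E.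
Hypothesis f_sigma : forall k, \int[rho]_x (f k x ^+ 2)%:E <= (sigma ^+ 2)%:E.
Hypothesis f0 : forall k, \int[rho]_x (f k x)%:E = 0.
Hypothesis fi : forall k, rho.-integrable setT (EFin \o f k).
Hypothesis max_m :
  \int[Pr]_w ((\big[Num.max/0%R]_i Phi (b i w)) ^+ 2)%:E <= (m ^+ 2)%:E.
Hypothesis cover : forall t : 'I_n -> T, (0 < \sum_i Phi (t i) ^+ 2)%R ->
  forall e : R, (0 < e <= 1)%R -> exists k (c : 'I_k -> (T -> R)),
    [/\ (k%:R <= 2 * (a / e) `^ v)%R, forall i, C (c i) &
      forall g, C g -> exists i,
        (sqnorm (fun j => g (t j) - c i (t j)) <=
           (2 * e) ^+ 2 * \sum_i Phi (t i) ^+ 2)%R].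

Let Z k i w := f k (b i w).
Let V w := \big[Num.max/0%R]_k sqnorm (fun i => Z k i w).
Let Y w := (\sum_i Phi (b i w) ^+ 2)%R.
Let M w := \big[Num.max/0%R]_i Phi (b i w).
Let S1 w := rad_mean (fun e => \big[Num.max/0%R]_k `|rad_sum (fun i => Z k i w) e|%R).
Let S2 w := rad_mean (fun e => \big[Num.max/0%R]_k `|rad_sum (fun i => Z k i w ^+ 2)%R e|%R).

Let Phi_ge0 x : K <> 0%N -> (0 <= Phi x)%R.
Proof.
move=> K0; have k : 'I_K by case: (K) K0 => // K' _; exact: ord0.
by apply: le_trans (CPhi (Cf k) x).
Qed.

Let mZ k i : measurable_fun setT (Z k i).
Proof. by apply: measurableT_comp => //; exact: mC. Qed.

Let mS (W : 'I_K -> 'I_n -> Om -> R) : (forall k i, measurable_fun setT (W k i)) ->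
  measurable_fun setT
    (fun w => rad_mean (fun e => \big[Num.max/0%R]_k `|rad_sum (fun i => W k i w) e|%R)).
Proof.
move=> mW; apply: measurable_funM => //; apply: measurable_sum => e.
apply: measurable_bigmax => k; apply: (measurableT_comp (@normr_measurable R setT)).
by apply: measurable_sum => i; exact: measurable_funM.
Qed.

Let V_ge0 w : (0 <= V w)%R. Proof. exact: bigmax_ge_id. Qed.

Let Z_Phi k i w : (Z k i w ^+ 2 <= Phi (b i w) ^+ 2)%R.
Proof.
rewrite -(real_normK (num_real (Z k i w))) lerXn2r ?nnegrE//; last exact: CPhi.
by apply: le_trans (CPhi (Cf k) _).
Qed.

Let V_le_Y w : (V w <= Y w)%R.
Proof.
apply: bigmax_le => [|k _]; first by apply: sumr_ge0 => i _; rewrite sqr_ge0.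
by apply: ler_sum => i _; exact: Z_Phi.
Qed.

Let M_ge0 w : (0 <= M w)%R. Proof. exact: bigmax_ge_id. Qed.

Let sqnorm_le_V k w : (sqnorm (fun i => Z k i w) <= V w)%R.
Proof. exact: (le_bigmax _ (fun k => sqnorm (fun i => Z k i w))). Qed.

Let C_M g i w : C g -> (`|g (b i w)| <= M w)%R.
Proof.
move=> Cg; apply: le_trans (CPhi Cg _) _.
exact: (le_bigmax _ (fun i => Phi (b i w))).
Qed.

Let covering w : (0 < Y w)%R -> forall e : R, (0 < e <= 1)%R ->
  exists k (c : 'I_k -> (T -> R)),
    [/\ (k%:R <= 2 * (a / e) `^ v)%R, forall i, C (c i) &
      forall g, C g -> exists i,
        (sqnorm (fun j => g (b j w) - c i (b j w)) <= (2 * e) ^+ 2 * Y w)%R].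
Proof. exact: cover. Qed.

Let S1_le D Y0 w : (0 < D)%R -> (0 < Y0)%R -> (D <= Y0)%R ->
  (S1 w <= 100 * Num.sqrt (v / 2 * (V w * (ln (a ^+ 2 * Y0 / D) - 1) + Y w * D / Y0)))%R.
Proof.
move=> D0 Y00 DY0; rewrite -[100%R]mulr1.
apply: (rad_mean_tangent (C := C) (x := fun g i => g (b i w)) (y := fun g i => g (b i w))) => //.
- by rewrite V_ge0 V_le_Y.
- by move=> g h _ _; rewrite expr1n mul1r.
- by move=> k; rewrite expr1n mul1r; exact: sqnorm_le_V.
- exact: covering.
Qed.

(** Squaring is Lipschitz with constant [2 * M w] on the observed values, so the covering for the
    functions also serves for their squares. *)
Let S2_le D Y0 w : (0 < D)%R -> (0 < Y0)%R -> (D <= Y0)%R ->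
  (S2 w <= 200 * M w *
    Num.sqrt (v / 2 * (V w * (ln (a ^+ 2 * Y0 / D) - 1) + Y w * D / Y0)))%R.
Proof.
move=> D0 Y00 DY0; rewrite (_ : 200 * M w = 100 * (2 * M w))%R; last by ring.
apply: (rad_mean_tangent (C := C) (x := fun g i => g (b i w))
  (y := fun g i => (g (b i w) ^+ 2)%R)) => //.
- by rewrite mulr_ge0.
- by rewrite V_ge0 V_le_Y.
- move=> g h Cg Ch; rewrite /sqnorm mulr_sumr; apply: ler_sum => i _.
  rewrite subr_sqr exprMn mulrC ler_wpM2r ?sqr_ge0//.
  rewrite -(real_normK (num_real (_ + _))) lerXn2r ?nnegrE ?mulr_ge0//.
  apply: le_trans (ler_normD _ _) _; rewrite mulr_natl mulr2n.
  by apply: lerD; exact: C_M.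
- move=> k; apply: (@le_trans _ _ (M w ^+ 2 * V w))%R; last first.
    by rewrite ler_wpM2r// exprMn ler_peMl ?sqr_ge0//; lra.
  apply: (@le_trans _ _ (M w ^+ 2 * sqnorm (fun i => Z k i w)))%R; last first.
    by rewrite ler_wpM2l ?sqr_ge0// sqnorm_le_V.
  rewrite /sqnorm mulr_sumr; apply: ler_sum => i _.
  rewrite [(_ ^+ 2 ^+ 2)%R]expr2 ler_wpM2r ?sqr_ge0//.
  by rewrite -(real_normK (num_real (f k _))) lerXn2r ?nnegrE//; exact: C_M.
- exact: covering.
Qed.

Let fsq_fin k : \int[rho]_x (f k x ^+ 2)%:E \is a fin_num.
Proof.
rewrite ge0_fin_numE ?(le_lt_trans (f_sigma k)) ?ltry//.
by apply: integral_ge0 => x _; rewrite lee_fin sqr_ge0.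
Qed.

Let c k := fine (\int[rho]_x (f k x ^+ 2)%:E).

Let c_ge0 k : (0 <= c k)%R.
Proof.
by apply: fine_ge0; apply: integral_ge0 => x _; rewrite lee_fin sqr_ge0.
Qed.

Let c_le k : (c k <= sigma ^+ 2)%R.
Proof. by rewrite -lee_fin fineK ?fsq_fin// f_sigma. Qed.

Let mf2 k : measurable_fun setT (fun x => f k x ^+ 2)%R.
Proof. by apply: measurable_funX; exact: mC. Qed.

Let fsq_integrable k : rho.-integrable setT (EFin \o (fun x => f k x ^+ 2)%R).
Proof.
apply/integrableP; split; first exact/measurable_EFinP.
rewrite (eq_integral (fun x => (f k x ^+ 2)%:E)); last first.
  by move=> x _ /=; rewrite ger0_norm ?sqr_ge0.
by rewrite (le_lt_trans (f_sigma k)) ?ltry.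
Qed.

Let w2 k x := (f k x ^+ 2 - c k)%R.

Let w2_integrable k : rho.-integrable setT (EFin \o w2 k).
Proof.
apply: integrable_EFinD; first exact: fsq_integrable.
exact: finite_measure_integrable_cst.
Qed.

Let w2_centered k : \int[rho]_x (w2 k x)%:E = 0.
Proof.
have -> : \int[rho]_x (w2 k x)%:E =
    \int[rho]_x ((f k x ^+ 2)%:E - (cst (c k)%:E) x) by [].
rewrite integralB//=; last 2 first.
- exact: fsq_integrable.
- exact: finite_measure_integrable_cst.
rewrite integral_cst// [X in _ * X](@probability_setT _ _ _ rho) mule1 /c.
by rewrite fineK ?fsq_fin// subee ?fsq_fin.
Qed.

Let mG i : <<s others b i>> `<=` measurable.
Proof. exact: others_measurable. Qed.

Let symmetrize (g : 'I_K -> T -> R) : (forall k, measurable_fun setT (g k)) ->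
  (forall k, rho.-integrable setT (EFin \o g k)) ->
  (forall k, \int[rho]_x (g k x)%:E = 0) ->
  \int[Pr]_w (\big[Num.max/0%R]_k `|\sum_i g k (b i w)|%R)%:E <=
  2%:E * \int[Pr]_w
    (rad_mean (fun e => \big[Num.max/0%R]_k `|rad_sum (fun i => g k (b i w)) e|%R))%:E.
Proof.
move=> mg ig g0.
apply: (symmetrization mG (Z := fun k i w => g k (b i w))).
- by move=> k i; exact: (integrable_copy mb indep i (ig k)).
- move=> i j k ij; apply: measurableT_comp; first exact: mg.
  exact: measurable_others.
- by move=> k i H oH; exact: (integral_centered mb indep oH (ig k)).
Qed.

(** Centering the squares costs [n%:R * sigma ^+ 2]. The centered sums are symmetrized, and putting
    their means back inside the signed sums costs the same amount again, doubled by symmetrization;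
    hence the factor 3. *)
Let EV : \int[Pr]_w (V w)%:E <=
  (3 * n%:R * sigma ^+ 2)%:E + 2%:E * \int[Pr]_w (S2 w)%:E.
Proof.
have s2 := sqr_ge0 sigma.
pose u w := \big[Num.max/0%R]_k `|\sum_i w2 k (b i w)|%R.
pose q w := rad_mean (fun e => \big[Num.max/0%R]_k `|rad_sum (fun i => w2 k (b i w)) e|%R).
have mw2 k : measurable_fun setT (w2 k) by exact: measurable_funB.
have mu_ : measurable_fun setT u.
  apply: measurable_bigmax => k; apply: (measurableT_comp (@normr_measurable R setT)).
  by apply: measurable_sum => i; exact: measurableT_comp.
have mS2 : measurable_fun setT S2 by apply: mS => k i; exact: measurable_funX.
have S2_ge0 w : (0 <= S2 w)%R.
  by rewrite mulr_ge0 ?invr_ge0 ?exprn_ge0// sumr_ge0// => e _; exact: bigmax_ge_id.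
have c0 : (0 <= n%:R * sigma ^+ 2)%R by rewrite mulr_ge0.
have u0 w : (0 <= u w)%R by exact: bigmax_ge_id.
apply: (@le_trans _ _ (\int[Pr]_w (n%:R * sigma ^+ 2 + u w)%:E)).
  apply: ge0_le_integral_EFin => //.
  - by apply: measurable_bigmax => k; apply: measurable_sum => i; exact: measurable_funX.
  - exact: measurable_funD.
  - move=> w; apply: bigmax_le => [|k _]; first by rewrite addr_ge0.
    apply: (@le_trans _ _ (n%:R * c k + \sum_i w2 k (b i w)))%R; last first.
      apply: lerD; first by rewrite ler_wpM2l.
      apply: le_trans (ler_norm _) _.
      exact: (le_bigmax _ (fun k => `|\sum_i w2 k (b i w)|%R)).
    by rewrite /w2 sumrB sumr_const card_ord mulr_natl addrC subrK.
rewrite ge0_integral_EFinD// integral_cst_EFin.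
apply: (@le_trans _ _ ((n%:R * sigma ^+ 2)%:E + 2%:E * \int[Pr]_w (q w)%:E)).
  by apply: leeD2l; exact: symmetrize.
have qS w : (q w <= S2 w + n%:R * sigma ^+ 2)%R.
  rewrite -[X in (_ + X)%R](@rad_mean_cst R n) -rad_meanD; apply: le_rad_mean => e.
  apply: bigmax_le => [|k _]; first by rewrite addr_ge0// bigmax_ge_id.
  rewrite (@rad_sumD R n (fun i => Z k i w ^+ 2)%R (fun=> - c k)%R)//.
  apply: le_trans (ler_normD _ _) _; apply: lerD.
    exact: (le_bigmax _ (fun k => `|rad_sum (fun i => Z k i w ^+ 2)%R e|%R)).
  apply: le_trans (norm_rad_sum _ _) _; rewrite normrN ger0_norm// sumr_const card_ord.
  by rewrite -[X in (X <= _)%R]mulr_natl ler_wpM2l.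
have h : \int[Pr]_w (q w)%:E <= \int[Pr]_w (S2 w)%:E + (n%:R * sigma ^+ 2)%:E.
  rewrite -(integral_cst_EFin Pr) -ge0_integral_EFinD//.
  apply: ge0_le_integral_EFin => //.
  - by apply: mS => k i; exact: measurableT_comp.
  - exact: measurable_funD.
  - move=> w; rewrite mulr_ge0 ?invr_ge0 ?exprn_ge0// sumr_ge0// => e _.
    exact: bigmax_ge_id.
apply: (@le_trans _ _ ((n%:R * sigma ^+ 2)%:E +
    2%:E * (\int[Pr]_w (S2 w)%:E + (n%:R * sigma ^+ 2)%:E))).
  by apply: leeD2l; apply: lee_wpmul2l.
rewrite ge0_muleDr ?lee_fin//; last by apply: integral_ge0 => w _; rewrite lee_fin.
rewrite -EFinM addeCA addeC -EFinD leeD2r// lee_fin; lra.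
Qed.

(** Symmetrization reduces the claim to [S1]. The pointwise chaining bounds [S1_le] and [S2_le],
    together with [EV], are the hypotheses of [self_bounding]. *)
Theorem independent_maximal_inequality :
  \int[Pr]_w (\big[Num.max/0%R]_k `|\sum_i f k (b i w)|%R)%:E <=
  ((500 * 400) * (Num.sqrt n%:R * sigma * Num.sqrt (v * ln (Num.sqrt a * N / sigma)) +
    m * (v * ln (Num.sqrt a * N / sigma))))%:E.
Proof.
apply: le_trans (symmetrize _ fi f0) _; first by move=> k; exact: mC.
have mPhib i : measurable_fun setT (fun w => Phi (b i w)) by exact: measurableT_comp.
apply: (self_bounding (V := V) (Y := Y) (M := M) (S1 := S1) (S2 := S2) (Phi := N)) => //.
- by apply: measurable_bigmax => k; apply: measurable_sum => i; exact: measurable_funX.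
- by apply: measurable_sum => i; exact: measurable_funX.
- exact: measurable_bigmax.
- exact: mS.
- by apply: mS => k i; exact: measurable_funX.
- by move=> w; rewrite mulr_ge0 ?invr_ge0 ?exprn_ge0// sumr_ge0// => e _; exact: bigmax_ge_id.
- by move=> w; rewrite mulr_ge0 ?invr_ge0 ?exprn_ge0// sumr_ge0// => e _; exact: bigmax_ge_id.
- by rewrite ler1n.
rewrite (eq_integral (fun w => \sum_i (Phi (b i w) ^+ 2)%:E)); last first.
  by move=> w _; rewrite sumEFin.
rewrite ge0_integral_sum//; last 2 first.
- by move=> i; apply/measurable_EFinP; exact: measurable_funX.
- by move=> i w _; rewrite lee_fin sqr_ge0.
apply: (@le_trans _ _ (\sum_(i < n) (N ^+ 2)%:E)).
  apply: lee_sum => i _.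
  rewrite (integral_copy mb indep i (g := fun x => (Phi x ^+ 2)%:E))//.
  - by apply/measurable_EFinP; exact: measurable_funX.
  - by move=> x; rewrite lee_fin sqr_ge0.
by rewrite sumEFin sumr_const card_ord mulr_natl.
Qed.

End maximal_inequality.

(** * Covering numbers of the class of block sums *)

Section norm2.
Context d (T : measurableType d) (R : realType) (mu : {measure set T -> \bar R}).
Local Open Scope ereal_scope.

Lemma Lnorm2E (h : T -> R) :
  'N[mu]_2[(fun x => (h x)%:E)] = sqrte (\int[mu]_x (h x ^+ 2)%:E).
Proof.
rewrite -poweR12_sqrt; last by apply: integral_ge0 => x _; rewrite lee_fin sqr_ge0.
rewrite unlock/=; congr (_ `^ _); apply: eq_integral => x _.
by rewrite /= powR_mulrn// real_normK// num_real.
Qed.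

End norm2.

Section covering_transfer.
Context d (E : measurableType d) (R : realType).
Local Open Scope ereal_scope.

Lemma finitely_discrete_mean (s : seq (R * E)) :
  (forall p, p \in s -> 0 <= p.1)%R -> (0 < \sum_(p <- s) p.1)%R ->
  exists2 Q : probability E R, finitely_discrete Q &
    forall h : E -> R, measurable_fun setT h -> (forall x, 0 <= h x)%R ->
    \int[Q]_x (h x)%:E =
      ((\sum_(p <- s) p.1)^-1 * \sum_(p <- s) p.1 * h p.2)%:E.
Proof.
move=> s0 Z0; pose z := (\sum_(p <- s) p.1)%R.
pose x i := (nth (0%R, point) s i).2.
(* The absolute value makes [w i] nonnegative for every index, as [mscale] requires; on the list it
   changes nothing. *)
pose w i := (`|(nth (0%R, point) s i).1| / z)%R.
have w0 i : (0 <= w i)%R by rewrite divr_ge0// ltW.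
have sumE (h : E -> R) :
    (\sum_(i < size s) w i * h (x i) = z^-1 * \sum_(p <- s) p.1 * h p.2)%R.
  rewrite (big_nth (0%R, point)) big_mkord mulr_sumr; apply: eq_bigr => i _.
  by rewrite /w ger0_norm ?s0 ?mem_nth// mulrA (mulrC (z^-1)%R).
pose mu : {measure set E -> \bar R} :=
  msum (fun i => mscale (NngNum (w0 i)) (\d_(x i) : probability E R)) (size s).
have muE A : mu A = \sum_(i < size s) (w i)%:E * \d_(x i) A by [].
have mu1 : mu setT = 1.
  rewrite muE; transitivity (\sum_(i < size s) (w i * (cst 1%R (x i)))%:E).
    by apply: eq_bigr => i _; rewrite diracT mule1 mulr1.
  rewrite sumEFin (sumE (cst 1%R)); congr EFin.
  by under eq_bigr do rewrite mulr1; rewrite mulVf// gt_eqF.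
pose Q : probability E R := mnormalize mu (\d_point : probability E R).
have QE A : Q A = mu A.
  by rewrite /Q /= /mnormalize mu1 onee_eq0/= invr1 mule1.
exists Q.
  exists (size s), (fun i => x i), (fun i => w i); split => // A _.
  by rewrite QE muE.
move=> h mh h0; transitivity (\int[mu]_x (h x)%:E).
  by apply: eq_measure_integral => A _ _; exact: QE.
have mhE : measurable_fun setT (EFin \o h) by exact/measurable_EFinP.
have hE0 y : setT y -> 0 <= (EFin \o h) y by move=> _; rewrite /= lee_fin.
rewrite ge0_integral_measure_sum//.
rewrite -/z -(sumE h) -sumEFin; apply: eq_bigr => i _.
rewrite ge0_integral_mscale// integral_dirac//.
by rewrite diracT mul1e.
Qed.

Variables (F : set (E -> R)) (Fenv : E -> R) (a v : R).
Hypotheses (envF : finite_envelope F Fenv) (vcF : VC_type F Fenv a v).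
Hypotheses (mF : forall f, F f -> measurable_fun setT f) (a0 : (0 < a)%R).
Variable f0 : E -> R.
Hypothesis Ff0 : F f0.

(** The given centers need not lie in [F]. A ball that meets [F] receives a center in [F] at the
    price of doubling the radius, and a ball that misses [F] receives the dummy [f0]. The factor 2
    in the cardinality provides the strict inequality that realizes the infimum in
    [covering_number]. *)
Lemma VC_cover (Q : probability E R) (e : R) : finitely_discrete Q ->
  (0 < e <= 1)%R -> exists k (c : 'I_k -> (E -> R)),
  [/\ (k%:R <= 2 * (a / e) `^ v)%R, forall i, F (c i) &
    forall g, F g -> exists i, \int[Q]_x ((g x - c i x) ^+ 2)%:E <=
      ((2 * e) ^+ 2)%:E * \int[Q]_x (Fenv x ^+ 2)%:E].
Proof.
have [mE E0 _] := envF.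
move=> Qd e01; have e0 : (0 < e)%R by case/andP: e01.
have ae0 : (0 < (a / e) `^ v)%R by apply: powR_gt0; exact: divr_gt0.
have : covering_number Q F (e%:E * 'N[Q]_2[EFin \o Fenv]) < (2 * (a / e) `^ v)%:E.
  apply: (@le_lt_trans _ _ ((a / e) `^ v)%:E); last by rewrite lte_fin; lra.
  apply: le_trans (vcF e01); apply: ereal_sup_ubound.
  by exists Q.
move=> /ereal_inf_lt[_ [k [c0 hc0] <-]]; rewrite lte_fin => k_lt.
have nE (h : E -> R) : 'N[Q]_2[(fun x => (h x)%:E)] <= e%:E * 'N[Q]_2[EFin \o Fenv] ->
    \int[Q]_x (h x ^+ 2)%:E <= (e ^+ 2)%:E * \int[Q]_x (Fenv x ^+ 2)%:E.
  rewrite !Lnorm2E.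
  have -> : e%:E = sqrte (e ^+ 2)%:E by rewrite /= sqrtr_sqr gtr0_norm.
  rewrite -sqrteM ?lee_fin ?sqr_ge0// lee_sqrt//.
  by apply: mule_ge0; [rewrite lee_fin sqr_ge0|apply: integral_ge0 => x _; rewrite lee_fin sqr_ge0].
pose near (i : 'I_k) (f : E -> R) := F f /\
  'N[Q]_2[(fun x => (f x - c0 i x)%:E)] <= e%:E * 'N[Q]_2[EFin \o Fenv].
have [c hc] : {c : 'I_k -> (E -> R) &
    forall i, F (c i) /\ (forall g, near i g -> near i (c i))}.
  apply: (@choice _ _ (fun i f => F f /\ (forall g, near i g -> near i f))) => i.
  have [[g [Fg gi]]|no] := pselect (exists g, near i g); first by exists g.
  by exists f0; split => // g gi; exfalso; apply: no; exists g.
exists k, c; split => [|i|g Fg].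
- exact: ltW.
- by have [] := hc i.
have [i gi] := hc0 g Fg; exists i.
have [Fc ci] := (hc i).2 g (conj Fg gi).
have := nE _ gi; have := nE _ ci => {ci gi}.
have msq (h : E -> R) : F h -> measurable_fun setT (fun x => (h x - c0 i x) ^+ 2)%R.
  move=> Fh; apply: measurable_funX; apply: measurable_funB; first exact: mF.
  exact: measurable_funP.
have mgc := msq _ Fg; have mcc := msq _ Fc.
set A := \int[Q]_x (Fenv x ^+ 2)%:E => h1 h2.
have A0 : 0 <= A by apply: integral_ge0 => x _; rewrite lee_fin sqr_ge0.
apply: (@le_trans _ _ (\int[Q]_x
    (2 * (g x - c0 i x) ^+ 2 + 2 * (c i x - c0 i x) ^+ 2)%:E)).
  apply: ge0_le_integral_EFin => //.
  - by apply: measurable_funX; apply: measurable_funB; exact: mF.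
  - by apply: measurable_funD; exact: measurable_funM.
  - by move=> x; rewrite sqr_ge0.
  - by move=> x; have := sqr_ge0 (g x + c i x - 2 * c0 i x); nra.
rewrite ge0_integral_EFinD; last 4 first.
- exact: measurable_funM.
- exact: measurable_funM.
- by move=> x; rewrite mulr_ge0// sqr_ge0.
- by move=> x; rewrite mulr_ge0// sqr_ge0.
rewrite !ge0_integral_EFinZl//; last 2 first.
- by move=> x; rewrite sqr_ge0.
- by move=> x; rewrite sqr_ge0.
apply: (@le_trans _ _ (2%:E * ((e ^+ 2)%:E * A) + 2%:E * ((e ^+ 2)%:E * A))).
  by apply: leeD; apply: lee_wpmul2l.
rewrite !muleA -ge0_muleDl ?mule_ge0 ?lee_fin ?sqr_ge0//.
by rewrite -!EFinM -EFinD; apply: lee_wpmul2r => //; rewrite lee_fin; lra.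
Qed.

Lemma block_sum_ge0 B : (0 <= block_sum Fenv B)%R.
Proof. by have [_ E0 _] := envF; exact: sumr_ge0. Qed.

Lemma norm_block_sum f B : F f -> (`|block_sum f B| <= block_sum Fenv B)%R.
Proof.
have [_ _ fE] := envF; move=> Ff; apply: le_trans (ler_norm_sum _ _ _) _.
by apply: ler_sum => x _; exact: fE.
Qed.

(* Cauchy-Schwarz with weights Fenv; terms with Fenv x = 0 vanish on both sides. *)
Lemma sqr_block_sum_le (h : E -> R) B : (forall x, `|h x| <= 2 * Fenv x)%R ->
  (block_sum h B ^+ 2 <= block_sum Fenv B * \sum_(x <- B) h x ^+ 2 / Fenv x)%R.
Proof.
have [_ E0 _] := envF; move=> hE; rewrite /block_sum.
elim: B => [|x B IH]; first by rewrite !big_nil expr0n mul0r.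
rewrite !big_cons; set u := (\sum_(j <- B) h j)%R in IH *.
set p := (\sum_(j <- B) Fenv j)%R in IH *; set q := (\sum_(j <- B) _)%R in IH *.
have p0 : (0 <= p)%R by exact: sumr_ge0.
have q0 : (0 <= q)%R by apply: sumr_ge0 => j _; rewrite divr_ge0 ?sqr_ge0.
have [Ex|Ex] := eqVneq (Fenv x) 0%R.
  have -> : h x = 0%R.
    by apply/eqP; rewrite -normr_le0; have := hE x; rewrite Ex mulr0.
  by rewrite expr0n mul0r !add0r Ex add0r.
have Ex0 : (0 < Fenv x)%R by rewrite lt_neqAle eq_sym Ex E0.
set y := h x; set z := Fenv x in Ex Ex0 *.
have -> : ((z + p) * (y ^+ 2 / z + q) = y ^+ 2 + (y ^+ 2 * p / z + z * q) + p * q)%R by field.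
rewrite sqrrD; apply: lerD; last exact: IH.
rewrite lerD2l.
have ag : (0 <= (y ^+ 2 * p / z + z * q))%R.
  have z0 := ltW Ex0.
  by apply: addr_ge0; [apply: divr_ge0 => //; apply: mulr_ge0 => //; exact: sqr_ge0|exact: mulr_ge0].
apply: le_trans (ler_norm _) _.
rewrite -(ger0_norm ag) -ler_sqr ?nnegrE ?normr_ge0// !real_normK ?num_real//.
have -> : ((y * u *+ 2) ^+ 2 = 4 * y ^+ 2 * u ^+ 2)%R by ring.
apply: (@le_trans _ _ (4 * y ^+ 2 * (p * q)))%R.
  by rewrite ler_wpM2l// mulr_ge0 ?sqr_ge0.
have -> : (4 * y ^+ 2 * (p * q) = 4 * (y ^+ 2 * p / z) * (z * q))%R by field.
by have := sqr_ge0 (y ^+ 2 * p / z - z * q); nra.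
Qed.

(** Give each entry [x] of [t j] the weight [block_sum Fenv (t j) / Fenv x] and normalize to a
    finitely discrete [Q]. The weighted sum of [Fenv x ^+ 2] is then the sum of the squared
    envelopes of the blocks, and by [sqr_block_sum_le] squared distances of block sums are at most
    weighted sums of squared distances in [F]. The normalization cancels, so a cover of [F] under
    [Q] becomes a cover of the block sums. *)
Lemma block_cover (n : nat) (t : 'I_n -> seq E) :
  (0 < \sum_i block_sum Fenv (t i) ^+ 2)%R ->
  forall e : R, (0 < e <= 1)%R -> exists k (c : 'I_k -> (seq E -> R)),
    [/\ (k%:R <= 2 * (a / e) `^ v)%R, forall i, (@block_sum _ _ _ @` F) (c i) &
      forall g, (@block_sum _ _ _ @` F) g -> exists i,
        (sqnorm (fun j => g (t j) - c i (t j)) <=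
           (2 * e) ^+ 2 * \sum_i block_sum Fenv (t i) ^+ 2)%R].
Proof.
have [mE E0 fE] := envF; move=> S0 e e01.
pose s := [seq (block_sum Fenv (t j) / Fenv x, x)%R | j <- enum 'I_n, x <- t j].
have sE (h : E -> R) : (\sum_(p <- s) p.1 * h p.2 =
    \sum_j block_sum Fenv (t j) * \sum_(x <- t j) h x / Fenv x)%R.
  rewrite big_allpairs_dep/= big_enum/=; apply: eq_bigr => j _.
  rewrite mulr_sumr; apply: eq_bigr => x _; rewrite mulrAC mulrA //.
have sF : (\sum_(p <- s) p.1 * Fenv p.2 ^+ 2 = \sum_i block_sum Fenv (t i) ^+ 2)%R.
  rewrite (sE (fun x => Fenv x ^+ 2)%R); apply: eq_bigr => j _.
  rewrite expr2; congr (_ * _)%R; apply: eq_bigr => x _.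
  by have [->|?] := eqVneq (Fenv x) 0%R; rewrite ?expr0n ?mul0r// expr2 mulfK.
have s_ge0 p : p \in s -> (0 <= p.1)%R.
  by move=> /allpairsPdep[j [x [_ _ ->]]]; rewrite divr_ge0// block_sum_ge0.
have Z0 : (0 < \sum_(p <- s) p.1)%R.
  have Zge : (0 <= \sum_(p <- s) p.1)%R by rewrite big_seq sumr_ge0.
  rewrite lt_neqAle Zge andbT; apply/eqP => /esym Z.
  suff : (\sum_(p <- s) p.1 * Fenv p.2 ^+ 2 = 0)%R by move=> e'; rewrite -sF e' ltxx in S0.
  rewrite big_seq big1// => p ps.
  have : (p.1 <= \sum_(p <- s) p.1)%R.
    by rewrite (big_rem p)//= lerDl big_seq sumr_ge0// => q /mem_rem /s_ge0.
  by rewrite Z => p0; rewrite (le_anti (_ : (p.1 <= 0 <= p.1)%R)) ?mul0r// p0 s_ge0.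
have [Q Qd QE] := finitely_discrete_mean s_ge0 Z0.
have [k [c [kc Fc hc]]] := VC_cover Qd e01.
exists k, (fun i => block_sum (c i)); split => //; first by move=> i; exists (c i).
move=> _ [g Fg <-]; have [i gi] := hc g Fg; exists i.
have mgc : measurable_fun setT (fun x => (g x - c i x) ^+ 2)%R.
  by apply: measurable_funX; apply: measurable_funB; exact: mF.
move: gi; rewrite !QE//; last 3 first.
- exact: measurable_funX.
- by move=> x; rewrite sqr_ge0.
- by move=> x; rewrite sqr_ge0.
rewrite -EFinM lee_fin mulrCA ler_pM2l ?invr_gt0// sF.
apply: le_trans; rewrite (sE (fun x => (g x - c i x) ^+ 2)%R); apply: ler_sum => j _.
have -> : (block_sum g (t j) - block_sum (c i) (t j) = block_sum (fun x => g x - c i x) (t j))%R.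
  by rewrite /block_sum sumrB.
apply: sqr_block_sum_le => x; apply: le_trans (ler_normB _ _) _.
by rewrite mulr_natl mulr2n; apply: lerD; exact: fE.
Qed.

End covering_transfer.

(** * Blocks of the split chain *)

Section block_law.
Context d (E : measurableType d) (R : realType) (P : R.-pker E ~> E).
Context (init nu pi : probability E R) (m : nat) (S : set E) (theta : R) (r : E * E -> R).
Context d' (Om : measurableType d') (Pr : probability Om R).
Context (X : nat -> {mfun Om >-> E}) (Y : nat -> {mfun Om >-> bool}).
Hypotheses (m1 : (1 <= m)%N) (minor : minorization P m S nu theta)
  (dens : minorization_density P m S nu r)
  (split : split_chain Pr X Y P init m S theta r)
  (inv : unique_invariant_probability P pi).
Local Open Scope ereal_scope.
Hypothesis piS : 0 < pi S.

Local Notation Inf := (infinitely_regenerating Y).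
Local Notation B i := (block X Y m i).

Let mInf : measurable Inf. Proof. exact: measurable_infinitely_regenerating. Qed.

Let mB i : measurable_fun setT (B i : Om -> block_space E).
Proof. exact: measurable_block. Qed.

Let mBD i (D : set (block_space E)) : measurable D -> measurable (B i @^-1` D).
Proof. by move=> mD; rewrite -[X in measurable X]setTI; exact: mB. Qed.

(** Without regeneration all regeneration times take the default 0, and the block runs over an empty
    range. *)
Lemma block_no_regeneration i w : (0 < i)%N -> (forall t, Y t w = false) ->
  B i w = [::].
Proof.
move=> i0 no; have reg0 j : regeneration Y j w = 0%N.
  case: j => [|j] /=; rewrite /first_regeneration_from; case: pselect => // h;
    by have [t /andP[_]] := h; rewrite no.
by rewrite /block !reg0 /index_iota subnn.
Qed.

(** Paths that never regenerate contribute nothing because [h] vanishes there; the others almost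
    surely regenerate infinitely often. *)
Lemma integral_regenerating (h : Om -> \bar R) : measurable_fun setT h ->
  (forall w, 0 <= h w) -> (forall w, (forall t, Y t w = false) -> h w = 0) ->
  \int[Pr]_w h w = \int[Pr]_(w in Inf) h w.
Proof.
move=> mh h0 hno; pose A := [set w | exists t, Y t w = true].
have mA : measurable A.
  rewrite (_ : A = \bigcup_t (Y t @^-1` [set true])).
    by apply: bigcup_measurable => t _; exact: measurable_funPTI.
  by apply/seteqP; split => w; [move=> [t]; exists t|move=> [t _]; exists t].
have InfA : Inf `<=` A by move=> w /(_ 0%N)[t [_ yt]]; exists t.
have PA : Pr (A `\` Inf) = 0.
  have := prob_infinitely_regenerating m1 minor dens split inv.1 piS mA (fun w h => h).
  have e : Pr A = Pr (A `\` Inf) + Pr (A `&` Inf) by exact: measureDI.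
  rewrite {}e => e; have fi : Pr (A `&` Inf) \is a fin_num.
    by rewrite fin_num_measure//; exact: measurableI.
  by move: (congr1 (fun z => z - Pr (A `&` Inf)) e); rewrite addeK// subee.
rewrite -(setIidr InfA).
transitivity (\int[Pr]_(w in A) h w).
  rewrite [RHS]integral_mkcond; apply: eq_integral => w _; rewrite patchE.
  case: ifPn => // /negP wA; apply: hno => t; apply/negP => yt; apply: wA.
  by rewrite inE; exists t.
have mAI : measurable (A `&` Inf) by exact: measurableI.
have mAD : measurable (A `\` Inf) by exact: measurableD.
rewrite -{1}(setUIDK A Inf) ge0_integral_setU//; last 2 first.
- exact: measurable_funTS.
- by rewrite disj_set2E; apply/eqP; apply/seteqP; split => // w [[_ ?] [_]].
by rewrite [X in _ + X]null_set_integral ?adde0//; exact: measurable_funTS.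
Qed.

Hypothesis I0 : Pr Inf != 0.

Let p : R := fine (Pr Inf).

Let pE : Pr Inf = p%:E. Proof. by rewrite /p fineK// fin_num_measure. Qed.

Let p0 : (0 < p)%R.
Proof. by rewrite fine_gt0// lt0e I0 measure_ge0/= ltey_eq fin_num_measure. Qed.

(** The second argument of [mnormalize] is a fallback for degenerate total mass, which [I0]
    excludes. *)
Definition conditional_probability : probability Om R :=
  mnormalize (mrestr Pr mInf) Pr.

Local Notation Pr' := conditional_probability.

Lemma conditional_probabilityE A : Pr' A = Pr (A `&` Inf) * (p^-1)%:E.
Proof.
pose q : {measure set Om -> \bar R} := mrestr Pr mInf.
have e : q setT = p%:E by rewrite /q /= /mrestr setTI.
have -> : Pr' A = mnormalize q Pr A by [].
by rewrite /mnormalize e eqe gt_eqF.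
Qed.

Lemma integral_conditional (h : Om -> \bar R) : measurable_fun setT h ->
  (forall w, 0 <= h w) -> \int[Pr]_(w in Inf) h w = p%:E * \int[Pr']_w h w.
Proof.
move=> mh h0.
rewrite -(ge0_integral_mscale Pr' measurableT (NngNum (ltW p0)))//.
apply/esym; apply: (integral_image (mu := Pr) (f := id)) => // U mU.
change (p%:E * Pr' U = Pr (Inf `&` U)).
by rewrite conditional_probabilityE muleCA -EFinM mulfV ?gt_eqF// mule1 setIC.
Qed.

Definition block_law : probability (block_space E) R :=
  mnormalize (measure_function_pushforward__canonical__measure_function_Measure
    Pr' (mB 1)) (\d_point : probability (block_space E) R).

Lemma block_lawE D : block_law D = Pr' (B 1 @^-1` D).
Proof.
pose q : {measure set (block_space E) -> \bar R} :=
  measure_function_pushforward__canonical__measure_function_Measure Pr' (mB 1).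
have qE U : q U = Pr' (B 1 @^-1` U) by [].
have -> : block_law D = mnormalize q (\d_point : probability (block_space E) R) D by [].
rewrite /mnormalize (qE setT) preimage_setT probability_setT onee_eq0/=.
by rewrite qE invr1 mule1.
Qed.

Lemma integral_block_law (g : block_space E -> \bar R) : measurable_fun setT g ->
  (forall x, 0 <= g x) ->
  p%:E * \int[block_law]_x g x = \int[Pr]_(w in Inf) g (B 1 w).
Proof.
move=> mg g0; rewrite (integral_conditional (h := fun w => g (B 1 w)))//.
  by congr (_ * _); apply: (integral_image (mB 1)) => // U _; apply: etrans (block_lawE U) _; rewrite setTI.
exact: (measurableT_comp mg (mB 1)).
Qed.

Lemma decided_bigcap j k (G : nat -> set Om) :
  (forall i, (i < k)%N -> decided_before X Y m j (G i)) ->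
  decided_before X Y m j (\bigcap_(i in `I_k) G i).
Proof.
elim: k => [|k IH] dG; first by rewrite II0 bigcap_set0; exact: decided_setT.
rewrite IIS bigcap_setU bigcap_set1; apply: decided_setI; last exact: dG.
by apply: IH => i ik; apply: dG; exact: ltnW.
Qed.

(** Induction on [k] by [renewal]. The spacing by two matters: block [2 * k + c] opens at the
    regeneration number [2 * k + c - 1], and by [decided_block] the events of blocks with index at
    most [2 * k + c - 2] are decided before it. *)
Lemma blocks_product (c k : nat) (D : nat -> set (block_space E)) : (0 < c)%N ->
  (forall i, measurable (D i)) ->
  Pr' (\bigcap_(i in `I_k) B (2 * i + c)%N @^-1` D i) =
  (\prod_(i < k) fine (block_law (D i)))%:E.
Proof.
move=> c0 mD; elim: k => [|k IH].
  by rewrite II0 bigcap_set0 probability_setT big_ord0.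
rewrite IIS bigcap_setU bigcap_set1 big_ord_recr/= EFinM -IH.
set A := \bigcap_(i in _) _ in IH *.
have mA : measurable A by apply: fin_bigcap_measurable => // i _; exact: mBD.
have dA : decided_before X Y m (2 * k + c)%N.-1 A.
  apply: decided_bigcap => i ik; apply: decided_block => //.
    by rewrite addn_gt0 c0 orbT.
  have i2 : (2 * i.+1 <= 2 * k)%N by rewrite leq_mul2l ik.
  by case: (c) c0 => // c' _; rewrite !addnS /= (leq_trans _ (leq_add i2 (leqnn c')))// mulnS !addSn.
have q0 : (0 < 2 * k + c)%N by rewrite addn_gt0 c0 orbT.
have := renewal m1 minor dens split inv.1 piS q0 mA dA (mD k).
have mAI : measurable (A `&` Inf) by exact: measurableI.
have fin (U : set Om) : measurable U -> Pr U = (fine (Pr U))%:E.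
  by move=> mU; rewrite fineK// fin_num_measure.
have mAB : measurable (A `&` Inf `&` B (2 * k + c)%N @^-1` D k).
  by apply: measurableI => //; exact: mBD.
have mIB : measurable (Inf `&` B 1 @^-1` D k) by apply: measurableI => //; exact: mBD.
rewrite fineK ?fin_num_measure// block_lawE !conditional_probabilityE.
rewrite (setIAC A _ Inf) (setIC (B 1 @^-1` D k)) pE (fin _ mAI) (fin _ mAB) (fin _ mIB).
rewrite -!EFinM => e; have h := EFin_inj e; congr EFin.
have pu : (p != 0)%R by rewrite gt_eqF.
by apply: (mulfI pu); rewrite mulrA h; field.
Qed.
Lemma blocks_independent (c k : nat) : (0 < c)%N ->
  independent_copies Pr' block_law (fun i : 'I_k => B (2 * i + c)%N : Om -> block_space E).
Proof.
move=> c0 D mD; pose D' i := if insub i is Some j then D j else setT.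
have D'E (j : 'I_k) : D' j = D j by rewrite /D' valK.
have mD' i : measurable (D' i) by rewrite /D'; case: insub.
rewrite (eq_bigr (fun j : 'I_k => fine (block_law (D' j)))); last by move=> j _; rewrite D'E.
rewrite -(blocks_product k c0 mD'); congr (Pr' _); apply/seteqP; split => w /= h.
  by move=> i ik; have := h (Ordinal ik) Logic.I; rewrite -D'E.
by move=> j _; have := h j (ltn_ord j); rewrite /= D'E.
Qed.

Section centering.
Variable f : E -> R.
Hypotheses (fi : pi.-integrable setT (EFin \o f)) (f0 : \int[pi]_x (f x)%:E = 0).

Let mf : measurable_fun setT f. Proof. by apply/measurable_EFinP; exact: measurable_int fi. Qed.

Let fpos x : R := Num.max (f x) 0%R.
Let fneg x : R := Num.max (- f x)%R 0%R.

Let mpos : measurable_fun setT fpos. Proof. exact: measurable_maxr. Qed.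

Let mneg : measurable_fun setT fneg.
Proof. by apply: measurable_maxr => //; exact: measurableT_comp. Qed.

Let mean_finite (g : E -> R) : measurable_fun setT g -> (forall x, 0 <= g x <= `|f x|)%R ->
  exists2 z : R, \int[pi]_x (g x)%:E = z%:E &
    \int[block_law]_B (block_sum g B)%:E \is a fin_num.
Proof.
move=> mg gf; have g0 x : (0 <= g x)%R by case/andP: (gf x).
have gfin : \int[pi]_x (g x)%:E \is a fin_num.
  rewrite ge0_fin_numE; last by apply: integral_ge0 => x _; rewrite lee_fin.
  move/integrableP: fi => [_]; apply: le_lt_trans; apply: ge0_le_integral => //.
  - by move=> x _; rewrite lee_fin.
  - exact/measurable_EFinP.
  - by apply: measurableT_comp => //; exact/measurable_EFinP.
  - by move=> x _; rewrite /= lee_fin; case/andP: (gf x).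
exists (fine (\int[pi]_x (g x)%:E)); first by rewrite fineK.
have [c c0 h] := integral_block_sum m1 minor dens split inv piS.
have := integral_block_law (g := EFin \o block_sum g).
rewrite h// -(fineK gfin) -EFinM => e.
have {e} : p%:E * \int[block_law]_B (block_sum g B)%:E = (c * fine (\int[pi]_x (g x)%:E))%:E.
  apply: e; first by apply/measurable_EFinP; exact: measurable_block_sum.
  by move=> B; rewrite /= lee_fin sumr_ge0.
move=> e; apply/negPn/negP => nfin.
have y : \int[block_law]_B (block_sum g B)%:E = +oo.
  apply/eqP; move: nfin; rewrite ge0_fin_numE -?leNgt ?leye_eq//.
  by apply: integral_ge0 => B _; rewrite lee_fin sumr_ge0.
by move: e; rewrite y gt0_muley ?lte_fin.
Qed.

Let block_sum_max x : (f x = fpos x - fneg x)%R.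
Proof. by rewrite /fpos /fneg; case: (leP (f x) 0%R); case: (leP (- f x)%R 0%R); lra. Qed.

Let pos_norm x : (0 <= fpos x <= `|f x|)%R.
Proof. by rewrite /fpos le_max lexx orbT ge_max ler_norm normr_ge0. Qed.

Let neg_norm x : (0 <= fneg x <= `|f x|)%R.
Proof. by rewrite /fneg le_max lexx orbT ge_max -normrN ler_norm normr_ge0. Qed.

Let bs_integrable (g : E -> R) : measurable_fun setT g -> (forall x, 0 <= g x <= `|f x|)%R ->
  block_law.-integrable setT (EFin \o (block_sum g : block_space E -> R)).
Proof.
move=> mg gf; apply/integrableP; split.
  by apply/measurable_EFinP; exact: measurable_block_sum.
have g0 x : (0 <= g x)%R by case/andP: (gf x).
have [z _] := mean_finite mg gf; rewrite fin_numElt => /andP[_].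
apply: le_lt_trans; rewrite le_eqVlt; apply/orP; left; apply/eqP.
by apply: eq_integral => B _; rewrite /= ger0_norm// sumr_ge0.
Qed.

Let bsE (B : block_space E) : (block_sum f B = block_sum fpos B - block_sum fneg B)%R.
Proof. by rewrite /block_sum -sumrB; apply: eq_bigr => x _. Qed.

Lemma block_sum_integrable : block_law.-integrable setT (EFin \o (block_sum f : block_space E -> R)).
Proof.
rewrite (_ : _ \o _ = ((EFin \o (block_sum fpos : block_space E -> R)) \-
  (EFin \o (block_sum fneg : block_space E -> R)))); last by apply/funext => B /=; rewrite bsE.
by apply: integrableB => //; exact: bs_integrable.
Qed.

(** [integral_block_sum] holds for nonnegative functions, so it is applied to the positive and the
    negative part, which have equal finite means under [pi]. *)
Lemma block_sum_centered : \int[block_law]_B (block_sum f B)%:E = 0.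
Proof.
rewrite (eq_integral (fun B : block_space E => ((EFin \o block_sum fpos) \-
    (EFin \o block_sum fneg)) B)); last by move=> B _ /=; rewrite bsE.
rewrite integralB//; [|exact: bs_integrable..].
have [c c0 h] := integral_block_sum m1 minor dens split inv piS.
have key (g : E -> R) : measurable_fun setT g -> (forall x, 0 <= g x)%R ->
    p%:E * \int[block_law]_B (block_sum g B)%:E = c%:E * \int[pi]_x (g x)%:E.
  move=> mg g0; rewrite -h//; apply: (integral_block_law (g := EFin \o block_sum g)).
    by apply/measurable_EFinP; exact: measurable_block_sum.
  by move=> B; rewrite /= lee_fin sumr_ge0.
have [zp zpE pfin] := mean_finite mpos pos_norm.
have [zn znE nfin] := mean_finite mneg neg_norm.
have zpn : zp = zn.
  apply/eqP; rewrite -subr_eq0; apply/eqP; apply: EFin_inj.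
  rewrite EFinB -zpE -znE -integralB//; last 2 first.
  - apply/integrableP; split; first exact/measurable_EFinP.
    rewrite (eq_integral (fun x => (fpos x)%:E)) ?zpE ?ltry// => x _ /=.
    by rewrite ger0_norm//; case/andP: (pos_norm x).
  - apply/integrableP; split; first exact/measurable_EFinP.
    rewrite (eq_integral (fun x => (fneg x)%:E)) ?znE ?ltry// => x _ /=.
    by rewrite ger0_norm//; case/andP: (neg_norm x).
  by rewrite -[RHS]f0; apply: eq_integral => x _; rewrite -EFinB -block_sum_max.
have kp := key _ mpos (fun x => proj1 (andP (pos_norm x))).
have kn := key _ mneg (fun x => proj1 (andP (neg_norm x))).
have e : \int[block_law]_B (block_sum fpos B)%:E = \int[block_law]_B (block_sum fneg B)%:E.
  move: kp kn; rewrite zpE znE zpn => <-.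
  rewrite -(fineK pfin) -(fineK nfin) -!EFinM => e; congr EFin.
  by apply: (mulfI (lt0r_neq0 p0)); apply/esym; exact: EFin_inj e.
by rewrite /= e subee.
Qed.

End centering.

End block_law.

(** * From independent blocks to all blocks of a finite class *)

Lemma sum_parity (V : zmodType) (G : nat -> V) (n : nat) :
  \sum_(1 <= i < n.+1) G i =
  \sum_(i < uphalf n) G (2 * i + 1)%N + \sum_(i < n./2) G (2 * i + 2)%N.
Proof.
elim: n => [|n IH]; first by rewrite big_geq// !big_ord0 addr0.
rewrite big_nat_recr//= IH uphalf_half.
have nE := odd_double_half n; rewrite -mul2n in nE.
case: (odd n) nE => /= nE.
  rewrite add1n [X in _ = _ + X]big_ord_recr/= addrA.
  by have <- : (2 * n./2 + 2 = n.+1)%N by rewrite -[in RHS]nE addn2.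
rewrite add0n [X in _ = X + _]big_ord_recr/= addrAC.
by have <- : (2 * n./2 + 1 = n.+1)%N by rewrite -[in RHS]nE addn1.
Qed.

Section finite_class.
Context d (E : measurableType d) (R : realType) (P : R.-pker E ~> E).
Context (init nu pi : probability E R) (m : nat) (S : set E) (theta : R) (r : E * E -> R).
Context d' (Om : measurableType d') (Pr : probability Om R).
Context (X : nat -> {mfun Om >-> E}) (Y : nat -> {mfun Om >-> bool}).
Hypotheses (m1 : (1 <= m)%N) (minor : minorization P m S nu theta)
  (dens : minorization_density P m S nu r)
  (split : split_chain Pr X Y P init m S theta r)
  (inv : unique_invariant_probability P pi).
Local Open Scope ereal_scope.
Hypothesis piS : 0 < pi S.

Local Notation Inf := (infinitely_regenerating Y).
Local Notation B i := (block X Y m i).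

Variables (F : set (E -> R)) (Fenv : E -> R) (a v sigma N M : R) (n : nat).
Hypotheses (envF : finite_envelope F Fenv) (vcF : VC_type F Fenv a v)
  (a4 : (4 <= a)%R) (v1 : (1 <= v)%R) (sigma0 : (0 < sigma)%R) (sigmaN : (sigma <= N)%R)
  (M0 : (0 <= M)%R).
Hypotheses (Fi : forall f, F f -> pi.-integrable setT (EFin \o f))
  (F0 : forall f, F f -> \int[pi]_x (f x)%:E = 0).
Hypothesis env_N : \int[Pr]_w (block_sum Fenv (B 1 w) ^+ 2)%:E <= (N ^+ 2)%:E.
Hypothesis F_sigma : forall f, F f ->
  \int[Pr]_w (block_sum f (B 1 w) ^+ 2)%:E <= (sigma ^+ 2)%:E.
Hypothesis max_M :
  \int[Pr]_w ((\big[Num.max/0%R]_(1 <= i < n.+1) block_sum Fenv (B i w)) ^+ 2)%:E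
  <= (M ^+ 2)%:E.
Variables (K : nat) (f : 'I_K -> E -> R).
Hypothesis Ff : forall k, F (f k).

Let L : R := (v * ln (Num.sqrt a * N / sigma))%R.
Let bound : R := (Num.sqrt n%:R * sigma * Num.sqrt L + M * L)%R.

Let mF g : F g -> measurable_fun setT g.
Proof. by move=> /Fi /measurable_int h; exact/measurable_EFinP. Qed.

Let mE : measurable_fun setT Fenv. Proof. by have [] := envF. Qed.

Let mInf : measurable Inf. Proof. exact: measurable_infinitely_regenerating. Qed.

Let mB i : measurable_fun setT (B i : Om -> block_space E).
Proof. exact: measurable_block. Qed.

Let mbs (g : E -> R) i : measurable_fun setT g ->
  measurable_fun setT (fun w => block_sum g (B i w)).
Proof. by move=> mg; exact: (measurableT_comp (measurable_block_sum mg) (mB i)). Qed.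

Let N0 : (0 < N)%R. Proof. exact: lt_le_trans sigmaN. Qed.

Lemma log_ge0 : (0 <= L)%R.
Proof.
have a2 : (1 <= Num.sqrt a)%R by rewrite -sqrtr1 ler_wsqrtr//; have := a4; lra.
rewrite mulr_ge0//; first by have := v1; lra.
by rewrite ln_ge0// ler_pdivlMr// mul1r (le_trans sigmaN)// ler_peMl// ltW.
Qed.

Let bound_ge0 : (0 <= bound)%R.
Proof.
have L0 := log_ge0; have s0 := ltW sigma0.
by apply: addr_ge0; [apply: mulr_ge0 => //; apply: mulr_ge0|exact: mulr_ge0].
Qed.

Let const_ge0 : (0 <= 500 * 400 :> R)%R.
Proof. exact: (mulr_ge0 (ler0n R 500) (ler0n R 400)). Qed.

Section regenerating.
Hypothesis I0 : Pr Inf != 0.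

Let p : R := fine (Pr Inf).

Let p0 : (0 < p)%R.
Proof. by rewrite fine_gt0// lt0e I0 measure_ge0/= ltey_eq fin_num_measure. Qed.

Let p1 : (p <= 1)%R.
Proof.
rewrite -lee_fin /p fineK ?fin_num_measure//; exact: probability_le1.
Qed.

(** Conditioning on [Inf] multiplies second moments by at most $1/p$, hence $L^2$ norms by at most
    $1/s$. *)
Let s := Num.sqrt p.

Let s0 : (0 < s)%R. Proof. by rewrite sqrtr_gt0. Qed.

Let s1 : (s <= 1)%R. Proof. by rewrite -sqrtr1 ler_wsqrtr. Qed.

Let s2 : (s ^+ 2 = p)%R. Proof. by rewrite sqr_sqrtr// ltW. Qed.

Let Pr' := conditional_probability Pr Y.
Let rho := block_law m Pr X Y.

Let divp (x : \bar R) (y : R) : p%:E * x <= (y ^+ 2)%:E -> x <= ((y / s) ^+ 2)%:E.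
Proof.
move=> h; rewrite -[x]mul1e -(mulVf (lt0r_neq0 p0)) EFinM -muleA.
apply: le_trans (lee_wpmul2l _ h) _; first by rewrite lee_fin invr_ge0 ltW.
by rewrite -EFinM lee_fin exprMn exprVn s2 mulrC.
Qed.

Let le_Inf (h : Om -> R) : measurable_fun setT h -> (forall w, 0 <= h w)%R ->
  \int[Pr]_(w in Inf) (h w)%:E <= \int[Pr]_w (h w)%:E.
Proof.
move=> mh h0; apply: ge0_subset_integral => //; last by move=> w _; rewrite lee_fin.
exact/measurable_EFinP.
Qed.

Let conditional_square (h : Om -> R) y : measurable_fun setT h ->
  \int[Pr]_w (h w ^+ 2)%:E <= (y ^+ 2)%:E -> \int[Pr']_w (h w ^+ 2)%:E <= ((y / s) ^+ 2)%:E.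
Proof.
move=> mh hy; apply: divp; rewrite -(integral_conditional I0 (h := fun w => (h w ^+ 2)%:E)).
- by apply: le_trans hy; apply: le_Inf; [exact: measurable_funX|move=> w; exact: sqr_ge0].
- by apply/measurable_EFinP; exact: measurable_funX.
- by move=> w; rewrite lee_fin sqr_ge0.
Qed.

Let law_square (g : E -> R) y : measurable_fun setT g ->
  \int[Pr]_w (block_sum g (B 1 w) ^+ 2)%:E <= (y ^+ 2)%:E ->
  \int[rho]_b (block_sum g b ^+ 2)%:E <= ((y / s) ^+ 2)%:E.
Proof.
move=> mg gy; apply: divp.
rewrite (integral_block_law m X I0 (g := fun b => (block_sum g b ^+ 2)%:E)).
- apply: le_trans gy; apply: (le_Inf (h := fun w => block_sum g (B 1 w) ^+ 2)%R).
    by apply: measurable_funX; exact: mbs.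
  by move=> w; exact: sqr_ge0.
- by apply/measurable_EFinP; apply: measurable_funX; exact: measurable_block_sum.
- by move=> b; rewrite lee_fin sqr_ge0.
Qed.

(** The independent inequality is applied under the conditional law with [sigma], [N] and [M] all
    divided by [s]. The ratio in the logarithm is unchanged, and returning to [Pr] multiplies by
    [p], which leaves the factor $p/s=s\le1$. *)
Lemma spaced_blocks_bound (c k : nat) : (0 < c)%N -> (forall i, (i < k)%N -> (2 * i + c <= n)%N) ->
  p%:E * \int[Pr']_w (\big[Num.max/0%R]_j `|\sum_(i < k) block_sum (f j) (B (2 * i + c)%N w)|%R)%:E
  <= ((500 * 400) * bound)%:E.
Proof.
move=> c0 ckn; have Lge0 := log_ge0.
have [->|k0] := posnP k.
  rewrite (eq_integral (cst 0)); last first.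
    move=> w _ /=; congr EFin; apply/eqP; rewrite eq_le bigmax_ge_id andbT.
    by apply: bigmax_le => // j _; rewrite big_ord0 normr0.
  by rewrite integral0 mule0 lee_fin; exact: mulr_ge0.
case: (posnP K) => [K0|K0].
  rewrite (eq_integral (cst 0)); last first.
    move=> w _ /=; congr EFin; apply/eqP; rewrite eq_le bigmax_ge_id andbT.
    by apply: bigmax_le => // j _; have := leq_trans (ltn_ord j) (eq_leq K0).
  by rewrite integral0 mule0 lee_fin; exact: mulr_ge0.
have a0 : (0 < a)%R by apply: lt_le_trans a4.
have indep : independent_copies Pr' rho
    (fun i : 'I_k => B (2 * i + c)%N : Om -> block_space E).
  by move=> D mD; exact: (blocks_independent m1 minor dens split inv piS I0 c0 mD).
have main := independent_maximal_inequality (Pr := Pr') (rho := rho)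
  (b := fun i : 'I_k => B (2 * i + c)%N : Om -> block_space E)
  (C := @block_sum _ _ _ @` F) (Phi := block_sum Fenv) (f := fun j => block_sum (f j))
  (a := a) (v := v) (sigma := (sigma / s)%R) (N := (N / s)%R) (m := (M / s)%R).
have {main} : \int[Pr']_w (\big[Num.max/0%R]_j `|\sum_(i < k) block_sum (f j) (B (2 * i + c)%N w)|%R)%:E
    <= ((500 * 400) * (Num.sqrt k%:R * (sigma / s) *
      Num.sqrt (v * ln (Num.sqrt a * (N / s) / (sigma / s))) +
    (M / s) * (v * ln (Num.sqrt a * (N / s) / (sigma / s)))))%:E.
  apply: main => //.
  - exact: measurable_block_sum.
  - by move=> j; exists (f j).
  - by move=> _ [g Fg <-]; apply: measurable_block_sum; exact: mF.
  - by move=> _ [g Fg <-] b; exact: (norm_block_sum envF b Fg).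
  - by rewrite divr_gt0.
  - by rewrite ler_pM2r ?invr_gt0.
  - by rewrite divr_ge0// ltW.
  - exact: law_square.
  - by move=> j; apply: law_square; [exact: mF|exact: F_sigma].
  - by move=> j; apply: (block_sum_centered m1 minor dens split inv piS I0); [exact: Fi|exact: F0].
  - by move=> j; apply: (block_sum_integrable m1 minor dens split inv piS I0); exact: Fi.
  - apply: conditional_square; first by apply: measurable_bigmax => i; exact: mbs.
    apply: le_trans max_M; apply: ge0_le_integral_EFin.
    + by apply: measurable_funX; apply: measurable_bigmax => i; exact: mbs.
    + by apply: measurable_funX; apply: measurable_bigmax => i; exact: mbs.
    + by move=> w; exact: sqr_ge0.
    + move=> w; rewrite lerXn2r ?nnegrE ?bigmax_ge_id//.
      apply: bigmax_le => [|i _]; first exact: bigmax_ge_id.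
      have q0 : (0 < 2 * i + c)%N by rewrite addn_gt0 c0 orbT.
      have qn : ((2 * i + c).-1 < n)%N by rewrite prednK// ckn.
      rewrite big_add1 big_mkord -[in leLHS](prednK q0).
      exact: (le_bigmax _ (fun i : 'I_n => block_sum Fenv (B i.+1 w)) (Ordinal qn)).
  - move=> t t0 e e01; have j0 : 'I_K := Ordinal K0.
    exact: (block_cover envF vcF mF a0 (Ff j0) t0 e01).
have -> : (Num.sqrt a * (N / s) / (sigma / s) = Num.sqrt a * N / sigma)%R.
  by field; rewrite !gt_eqF.
rewrite -/L => h; apply: le_trans (lee_wpmul2l _ h) _; first by rewrite lee_fin ltW.
rewrite -EFinM lee_fin.
have -> : (p * (500 * 400 * (Num.sqrt k%:R * (sigma / s) * Num.sqrt L + M / s * L)) =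
    500 * 400 * (s * (Num.sqrt k%:R * sigma * Num.sqrt L + M * L)))%R.
  by rewrite -s2; field; rewrite gt_eqF.
apply: ler_wpM2l; first exact: const_ge0.
have kn : (k <= n)%N.
  apply: leq_trans (ckn k.-1 _); last by rewrite prednK.
  by rewrite -{1}(prednK k0) -addn1 leq_add// mul2n -addnn leq_addr.
have b0 : (0 <= Num.sqrt k%:R * sigma * Num.sqrt L + M * L)%R.
  apply: addr_ge0; last exact: mulr_ge0.
  by apply: mulr_ge0 => //; apply: mulr_ge0 => //; exact: ltW.
apply: (@le_trans _ _ (Num.sqrt k%:R * sigma * Num.sqrt L + M * L)%R).
  by rewrite ler_piMl.
rewrite lerD2r ler_wpM2r ?sqrtr_ge0// ler_wpM2r ?(ltW sigma0)//.
by rewrite ler_wsqrtr// ler_nat.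
Qed.

End regenerating.

(** The odd-numbered and the even-numbered blocks are bounded separately, which doubles the
    constant. *)
Lemma finite_class_bound :
  \int[Pr]_w (\big[Num.max/0%R]_j `|\sum_(1 <= i < n.+1) block_sum (f j) (B i w)|%R)%:E
  <= ((2 * (500 * 400)) * bound)%:E.
Proof.
have mabs k (idx : nat -> nat) : measurable_fun setT (fun w =>
    \big[Num.max/0%R]_j `|\sum_(i < k) block_sum (f j) (B (idx i) w)|%R).
  apply: measurable_bigmax => j; apply: (measurableT_comp (@normr_measurable R setT)).
  by apply: measurable_sum => i; apply: mbs; exact: mF.
have mabs1 : measurable_fun setT (fun w =>
    \big[Num.max/0%R]_j `|\sum_(1 <= i < n.+1) block_sum (f j) (B i w)|%R).
  apply: measurable_bigmax => j; apply: (measurableT_comp (@normr_measurable R setT)).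
  by apply: measurable_sum => i; apply: mbs; exact: mF.
rewrite (integral_regenerating m1 minor dens split inv piS); last 3 first.
- exact/measurable_EFinP.
- by move=> w; rewrite lee_fin bigmax_ge_id.
- move=> w no; congr EFin; apply/eqP; rewrite eq_le bigmax_ge_id andbT.
  apply: bigmax_le => // j _; rewrite big_nat big1 ?normr0// => i /andP[i1 _].
  by rewrite block_no_regeneration// /block_sum big_nil.
have [I0|I0] := eqVneq (Pr Inf) 0.
  rewrite null_set_integral; [|exact: mInf| |exact: I0].
    rewrite lee_fin -mulrA mulr_natl mulr2n.
    by apply: addr_ge0; exact: mulr_ge0 const_ge0 bound_ge0.
  by apply: measurable_funTS; exact/measurable_EFinP.
rewrite (integral_conditional I0); last 2 first.
- exact/measurable_EFinP.
- by move=> w; rewrite lee_fin bigmax_ge_id.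
set p := fine _.
have h1 : forall i, (i < uphalf n)%N -> (2 * i + 1 <= n)%N.
  move=> i iu; rewrite addn1 mul2n; have := odd_double_half n; move: iu.
  rewrite uphalf_half; case: (odd n) => /= iu <-.
    by rewrite add1n ltnS leq_double.
  by rewrite add0n ltn_double.
have h2 : forall i, (i < n./2)%N -> (2 * i + 2 <= n)%N.
  move=> i iu; rewrite -[X in (_ + X)%N]/(2 * 1)%N -mulnDr addn1 mul2n.
  by rewrite -(odd_double_half n) (leq_trans _ (leq_addl _ _))// leq_double.
have b1 := spaced_blocks_bound I0 (ltn0Sn 0) h1.
have b2 := spaced_blocks_bound I0 (ltn0Sn 1) h2.
rewrite -mulrA mulr_natl mulr2n EFinD; apply: le_trans (leeD b1 b2).
rewrite -ge0_muleDr; last 2 first.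
- by apply: integral_ge0 => w _; rewrite lee_fin bigmax_ge_id.
- by apply: integral_ge0 => w _; rewrite lee_fin bigmax_ge_id.
apply: lee_wpmul2l; first by rewrite lee_fin fine_ge0.
have m1' := mabs (uphalf n) (fun i => 2 * i + 1)%N.
have m2' := mabs n./2 (fun i => 2 * i + 2)%N.
rewrite -ge0_integral_EFinD; [|exact: m1'|exact: m2'|by move=> w; exact: bigmax_ge_id..].
apply: ge0_le_integral_EFin => //.
- exact: measurable_funD.
- by move=> w; exact: bigmax_ge_id.
move=> w; apply: bigmax_le => [|j _]; first by rewrite addr_ge0// bigmax_ge_id.
rewrite (sum_parity (fun i => block_sum (f j) (B i w))).
apply: le_trans (ler_normD _ _) _; apply: lerD.
  exact: (le_bigmax _ (fun j => `|\sum_(i < uphalf n) block_sum (f j) (B (2 * i + 1)%N w)|%R)).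
exact: (le_bigmax _ (fun j => `|\sum_(i < n./2) block_sum (f j) (B (2 * i + 2)%N w)|%R)).
Qed.

End finite_class.

Lemma Lnorm2_le d (T : measurableType d) (R : realType) (mu : {measure set T -> \bar R})
    (h : T -> R) (y : R) : 0 <= y ->
  ('N[mu]_2[(fun x => (h x)%:E)] <= y%:E -> \int[mu]_x (h x ^+ 2)%:E <= (y ^+ 2)%:E)%E.
Proof.
move=> y0; rewrite Lnorm2E (_ : y%:E = sqrte (y ^+ 2)%:E); last first.
  by rewrite /= sqrtr_sqr ger0_norm.
by rewrite lee_sqrt// lee_fin sqr_ge0.
Qed.

Local Open Scope ereal_scope.

(** * Countable classes and the final assembly *)

Section countable_class.
Context d (Om : measurableType d) (R : realType) (Pr : probability Om R).
Variables (T : Type) (F : set T) (G : T -> Om -> R).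

(* Monotone convergence along an enumeration of the class. *)
Lemma integral_countable_sup_le (b : R) : countable F -> (0 <= b)%R ->
  (forall f, F f -> measurable_fun setT (G f)) ->
  (forall K (u : 'I_K -> T), (forall k, F (u k)) ->
    \int[Pr]_w (\big[Num.max/0%R]_k `|G (u k) w|%R)%:E <= b%:E) ->
  \int[Pr]_w ereal_sup [set `|G f w|%:E | f in F] <= b%:E.
Proof.
move=> cF b0 mG bound.
(* Either the class is empty, and the supremum is [-oo], or it is the image of a sequence [u]. *)
have [FE|[u]] := pfcard_geP cF.
  rewrite FE (eq_integral (cst -oo)); last by move=> w _; rewrite image_set0 ereal_sup0.
  by rewrite integral_cst// [X in _ * X](@probability_setT _ _ _ Pr) mule1 leNye.
have Fu k : F (u k) by exact: (@funS _ _ _ _ u k Logic.I).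
pose g K w := (\big[Num.max/0%R]_(k < K) `|G (u k) w|%R)%:E.
have g_ge0 K w : 0 <= g K w by rewrite lee_fin bigmax_ge_id.
have mg K : measurable_fun setT (g K).
  apply/measurable_EFinP; apply: measurable_bigmax => k.
  by apply: (measurableT_comp (@normr_measurable R setT)); exact: mG.
have ndg w : {homo g^~ w : k l / (k <= l)%N >-> k <= l}.
  move=> k l kl; rewrite lee_fin; apply: bigmax_le => [|i _]; first exact: bigmax_ge_id.
  exact: (le_bigmax _ (fun j : 'I_l => `|G (u j) w|%R) (widen_ord kl i)).
have supE w : ereal_sup [set `|G f w|%:E | f in F] = limn (g^~ w).
  rewrite (cvg_lim _ (ereal_nondecreasing_cvgn (ndg w)))//.
  apply/eqP; rewrite eq_le; apply/andP; split.
    apply: ub_ereal_sup => _ [f Ff <-].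
    have [j _ <-] : (u @` setT) f by exact: (@surj _ _ _ _ u).
    apply: (@le_trans _ _ (g j.+1 w)); last by apply: ereal_sup_ubound; exists j.+1.
    rewrite lee_fin.
    exact: (le_bigmax _ (fun i : 'I_j.+1 => `|G (u i) w|%R) ord_max).
  have memu k : `|G (u k) w|%:E <= ereal_sup [set `|G f w|%:E | f in F].
    by apply: ereal_sup_ubound; exists (u k).
  apply: ub_ereal_sup => _ [K _ <-]; rewrite /g.
  apply: (big_ind (fun z : R => z%:E <= ereal_sup [set `|G f w|%:E | f in F])) => //.
  - by apply: le_trans (memu 0%N); rewrite lee_fin.
  - by move=> x y; case: (leP x y).
under eq_integral do rewrite supE.
rewrite monotone_convergence//.
apply: lime_le.
  apply: ereal_nondecreasing_is_cvgn => k l kl; apply: ge0_le_integral => //.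
  by move=> w _; exact: ndg.
by apply: nearW => K; exact: bound.
Qed.

End countable_class.

Theorem lemmaA9 (R : realType) :
  exists C : R, (0 < C)%R /\
  forall (d : measure_display) (E : measurableType d)
    (P : R.-pker E ~> E) (lambda pi nu : probability E R)
    (m : nat) (S : set E) (theta : R) (r : E * E -> R)
    (d' : measure_display) (Om : measurableType d') (Pr : probability Om R)
    (X : nat -> {mfun Om >-> E}) (Y : nat -> {mfun Om >-> bool})
    (F : set (E -> R)) (Fenv : E -> R) (a v sigma : R) (n : nat),
  countably_generated E ->
  harris_recurrent P ->
  aperiodic P ->
  unique_invariant_probability P pi ->
  (1 <= m)%N ->
  minorization P m S nu theta ->
  0 < pi S ->
  minorization_density P m S nu r ->
  split_chain Pr X Y P lambda m S theta r ->
  countable F ->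
  (forall f, F f -> pi.-integrable setT (EFin \o f)) ->
  finite_envelope F Fenv ->
  (forall f, F f -> \int[pi]_x (f x)%:E = 0) ->
  VC_type F Fenv a v ->
  (4 <= a)%R ->
  (1 <= v)%R ->
  let B i w := block X Y m i w in
  let normF := 'N[Pr]_2[(fun w => (block_sum Fenv (B 1%N w))%:E)] in
  let logterm := lne ((Num.sqrt a / sigma)%:E * normF) in
  (0 < sigma)%R ->
  ereal_sup [set 'N[Pr]_2[(fun w => (block_sum f (B 1%N w))%:E)] | f in F]
    <= sigma%:E ->
  sigma%:E <= normF ->
  (1 <= n)%N ->
  \int[Pr]_w ereal_sup
      [set `|(Num.sqrt n%:R)^-1 * \sum_(1 <= i < n.+1) block_sum f (B i w)|%:E
      | f in F]
  <= C%:E *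
     (sigma%:E * sqrte (v%:E * logterm)
      + 'N[Pr]_2[(fun w =>
           (\big[Num.max/0%R]_(1 <= i < n.+1) block_sum Fenv (B i w))%:E)]
        * ((Num.sqrt n%:R)^-1)%:E * (v%:E * logterm)).
Proof.
(* The factor 2 pays for the two parities; the rest comes from [independent_maximal_inequality]. *)
pose C0 : R := (2 * (500 * 400))%R.
have C00 : (0 < C0)%R.
  by rewrite /C0; apply: mulr_gt0; [exact: ltr0n|apply: mulr_gt0; exact: ltr0n].
exists C0; split => // d E P lambda pi nu m S theta r d' Om Pr X Y F Fenv a v sigma n.
move=> _ _ _ inv m1 minor piS dens split cF Fi envF F0 vcF a4 v1 B normF logterm.
move=> sigma0 F_sigma sigma_norm n1.
set normM := Lnorm _ _ _.
have c0 : (0 < (Num.sqrt n%:R)^-1 :> R)%R by rewrite invr_gt0 sqrtr_gt0 ltr0n.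
have v0 : (0 < v)%R by apply: lt_le_trans v1.
have a0 : (0 < Num.sqrt a)%R by rewrite sqrtr_gt0; apply: lt_le_trans a4.
have normM0 : 0 <= normM by exact: Lnorm_ge0.
(* If the envelope norm is infinite, so are the logarithm and the right side. *)
case normFE : normF sigma_norm => [N| |] // sigmaN; last first.
  have -> : logterm = +oo.
    by rewrite /logterm normFE gt0_muley ?lte_fin ?divr_gt0.
  rewrite gt0_muley ?lte_fin//= gt0_muley ?lte_fin//.
  rewrite addye; first by rewrite gt0_muley ?lte_fin// leey.
  rewrite gt_eqF// (lt_le_trans (ltNyr 0))// mule_ge0 ?leey// mule_ge0// lee_fin ltW//.
rewrite lee_fin in sigmaN; have N0 := lt_le_trans sigma0 sigmaN.
pose L := (v * ln (Num.sqrt a * N / sigma))%R.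
(* The logarithm is strictly positive because [4 <= a]; this rules out a product of zero and
   infinity when the norm of the maximum is infinite. *)
have arg1 : (1 < Num.sqrt a * N / sigma)%R.
  rewrite ltr_pdivlMr// mul1r (le_lt_trans sigmaN)// ltr_pMl//.
  by rewrite -[ltLHS]sqrtr1 ltr_sqrt; have := a4; lra.
have L0 : (0 < L)%R by rewrite mulr_gt0// ln_gt0.
have LE : v%:E * logterm = L%:E.
  rewrite /logterm normFE -EFinM mulrAC lne_EFin; last exact: lt_trans arg1.
  by rewrite -EFinM.
rewrite LE; case normME : normM normM0 => [M| |] // M0; last first.
  rewrite gt0_mulye ?lte_fin// gt0_mulye ?lte_fin// addey; last by rewrite -EFinM.
  by rewrite gt0_muley ?lte_fin// leey.
rewrite lee_fin in M0.
set c := ((Num.sqrt n%:R)^-1)%R in c0 *.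
have -> : C0%:E * (sigma%:E * sqrte L%:E + M%:E * c%:E * L%:E) =
    (c * (C0 * (Num.sqrt n%:R * sigma * Num.sqrt L + M * L)))%:E.
  rewrite [sqrte _]/= -(EFinM sigma) -(EFinM M) -(EFinM (M * c)%R) -EFinD -EFinM; congr EFin.
  rewrite /c.
  have : Num.sqrt n%:R != 0%R :> R by rewrite gt_eqF// sqrtr_gt0 ltr0n.
  by move: (Num.sqrt n%:R) (C0) => z z1 z0; field.
have mF f : F f -> measurable_fun setT f.
  by move=> /Fi /measurable_int h; exact/measurable_EFinP.
have mbs f i : F f -> measurable_fun setT (fun w => block_sum f (B i w)).
  move=> Ff; apply: (measurableT_comp (measurable_block_sum (mF f Ff))).
  exact: measurable_block.
apply: (integral_countable_sup_le (F := F)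
  (G := fun f w => (c * \sum_(1 <= i < n.+1) block_sum f (B i w))%R)) => //.
- apply: mulr_ge0; [exact: ltW|apply: mulr_ge0; [exact: ltW|apply: addr_ge0]].
    by apply: mulr_ge0; [apply: mulr_ge0; [|exact: ltW]|].
  by apply: mulr_ge0; [|exact: ltW].
- move=> f Ff; apply: measurable_funM => //; apply: measurable_sum => i; exact: mbs.
move=> K u Fu.
have -> : \int[Pr]_w (\big[Num.max/0%R]_k
      `|c * \sum_(1 <= i < n.+1) block_sum (u k) (B i w)|%R)%:E =
    c%:E * \int[Pr]_w (\big[Num.max/0%R]_k
      `|\sum_(1 <= i < n.+1) block_sum (u k) (B i w)|%R)%:E.
  rewrite -ge0_integral_EFinZl//; last 3 first.
  - apply: measurable_bigmax => k; apply: (measurableT_comp (@normr_measurable R setT)).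
    by apply: measurable_sum => i; exact: mbs.
  - exact: ltW.
  - by move=> w; exact: bigmax_ge_id.
  apply: eq_integral => w _; congr EFin.
  rewrite (big_endo (fun z => c * z)%R) ?mulr0//; last first.
    by move=> x y; rewrite maxr_pMr// ltW.
  by apply: eq_bigr => k _; rewrite normrM gtr0_norm.
rewrite EFinM; apply: lee_wpmul2l; first by rewrite lee_fin ltW.
apply: (finite_class_bound m1 minor dens split inv piS envF vcF a4 v1 sigma0 sigmaN M0 Fi F0) => //.
- by apply: Lnorm2_le; [exact: ltW|rewrite -normFE].
- move=> f Ff; apply: Lnorm2_le; first exact: ltW.
  by apply: le_trans F_sigma; apply: ereal_sup_ubound; exists f.
- by apply: Lnorm2_le => //; rewrite -normME.
Qed.
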